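(* Given the run-length encoded Burrows–Wheeler transform $\mathrm{RLBWT}[0..r-1]$ of a text $T[0..n-1]$ (whose BWT is $\mathrm{BWT}[0..n-1]$), the irreducible PLCP array $\mathrm{PLCP}^{+}[0..r-1]$ can be computed in $O(n)$ time and $O(r)$ space.
   Context: Word RAM model with $\Theta(\log n)$-bit words; space in words. $T[0..n-1]$ is a string over an ordered alphabet terminated by a unique smallest symbol $\$$. $\mathrm{SA}[i]$ is the starting position of the $i$-th lexicographically smallest suffix of $T$, and $\mathrm{ISA}$ is its inverse. $\mathrm{BWT}[i]=T[(\mathrm{SA}[i]-1)\bmod n]$; $r$ is the number of maximal runs of equal characters in $\mathrm{BWT}$, and $\mathrm{RLBWT}[i]$ stores the character and length of the $i$-th run. $\mathrm{lcp}(X,Y)$ is the length of the longest common prefix of strings $X,Y$. The LCP array has $\mathrm{LCP}[0]=0$ and $\mathrm{LCP}[i]=\mathrm{lcp}(T[\mathrm{SA}[i-1]..n-1],T[\mathrm{SA}[i]..n-1])$ for $i>0$; $\mathrm{PLCP}[i]=\mathrm{LCP}[\mathrm{ISA}[i]]$. A value $\mathrm{LCP}[i]$ is irreducible if $i$ is the starting position of a BWT run, and its irreducible PLCP counterpart is $\mathrm{PLCP}[\mathrm{SA}[i]]$. $\mathrm{PLCP}^{+}[0..r-1]$ is the array of the $r$ irreducible PLCP values, listed in increasing order of their text position $\mathrm{SA}[i]$. *)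

(* Defs.v *)
From mathcomp Require Import all_boot all_order.

Set Implicit Arguments.
Unset Strict Implicit.
Unset Printing Implicit Defensive.

Section Text.

(* Characters are words of the machine, hence natural numbers, compared as
   such. *)
Variable T : seq nat.

Definition terminated : Prop :=
  exists s d, T = rcons s d /\ all (fun c => d < c) s.

Definition suffix_le (i j : nat) : bool :=
  ((drop i T : seqlexi nat) <= (drop j T : seqlexi nat))%O.

Definition SA : seq nat := sort suffix_le (iota 0 (size T)).

Definition ISA (j : nat) : nat := index j SA.

(* [SA[i] + (n - 1)] stands for [SA[i] - 1] modulo [n], as subtraction on [nat]
   is truncated. *)
Definition BWT : seq nat :=
  [seq nth 0 T ((j + (size T).-1) %% size T) | j <- SA].

Definition run_start (i : nat) : bool :=
  (i == 0) || (nth 0 BWT i.-1 != nth 0 BWT i).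

Definition run_starts : seq nat := [seq i <- iota 0 (size T) | run_start i].

Definition nruns : nat := size run_starts.

(* The default value [size T] of [nth] makes the last run end at the end of the
   text. *)
Definition RLBWT : seq (nat * nat) :=
  mkseq (fun k => let i := nth (size T) run_starts k in
                  (nth 0 BWT i, nth (size T) run_starts k.+1 - i)) nruns.

Fixpoint lcp (X Y : seq nat) : nat :=
  match X, Y with
  | x :: X', y :: Y' => if x == y then (lcp X' Y').+1 else 0
  | _, _ => 0
  end.

Definition LCP (i : nat) : nat :=
  if i == 0 then 0 else lcp (drop (nth 0 SA i.-1) T) (drop (nth 0 SA i) T).

Definition PLCP (j : nat) : nat := LCP (ISA j).

Definition PLCPplus : seq nat :=
  [seq PLCP j | j <- sort leq [seq nth 0 SA i | i <- run_starts]].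

End Text.

(* Word RAM with [w]-bit words: a fixed program acts on registers and on a
   word-addressed memory, every instruction costing one time unit. A program
   names finitely many registers, whose number does not depend on the input. *)

Inductive binop : Type :=
  | OpAdd | OpSub | OpMul | OpDiv | OpMod
  | OpAnd | OpOr | OpXor | OpShl | OpShr | OpEq | OpLt.

(* The first argument of [IConst], [IOp] and [ILoad] is the destination register.
   [ILoad d a] reads the cell whose address is in register [a], [IStore a x]
   writes register [x] there, and [IJz x l] jumps to [l] if register [x] is
   zero. *)
Inductive instr : Type :=
  | IConst of nat & nat
  | IOp of binop & nat & nat & nat
  | ILoad of nat & nat
  | IStore of nat & nat
  | IJmp of nat
  | IJz of nat & nat
  | IHalt.

Definition program : Type := seq instr.

Record config : Type := Config {
  pc : nat;
  reg : nat -> nat;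
  memory : nat -> nat
}.

Definition update (f : nat -> nat) (a v : nat) : nat -> nat :=
  fun x => if x == a then v else f x.

Definition trunc_word (w x : nat) : nat := x %% 2 ^ w.

Definition eval_binop (w : nat) (o : binop) (x y : nat) : nat :=
  trunc_word w
    match o with
    | OpAdd => x + y
    | OpSub => x + 2 ^ w - y
    | OpMul => x * y
    | OpDiv => x %/ y
    | OpMod => x %% y
    | OpAnd => Nat.land x y
    | OpOr => Nat.lor x y
    | OpXor => Nat.lxor x y
    | OpShl => x * 2 ^ y
    | OpShr => x %/ 2 ^ y
    | OpEq => x == y
    | OpLt => x < y
    end.

(* Leaving the program also halts. *)
Definition fetch (P : program) (c : config) : instr := nth IHalt P (pc c).

Definition halted (P : program) (c : config) : bool :=
  if fetch P c is IHalt then true else false.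

Definition step (w : nat) (P : program) (c : config) : config :=
  let: Config p r m := c in
  match fetch P c with
  | IConst d k => Config p.+1 (update r d (trunc_word w k)) m
  | IOp o d x y => Config p.+1 (update r d (eval_binop w o (r x) (r y))) m
  | ILoad d a => Config p.+1 (update r d (m (r a))) m
  | IStore a x => Config p.+1 r (update m (r a) (r x))
  | IJmp l => Config l r m
  | IJz x l => Config (if r x == 0 then l else p.+1) r m
  | IHalt => c
  end.

(* The memory in use is counted from address 0 up to the largest address ever
   accessed, so that a sparse use of a large address range is not cheap. *)
Definition access_below (P : program) (c : config) (s : nat) : bool :=
  match fetch P c with
  | ILoad _ a | IStore a _ => reg c a < s
  | _ => true
  end.

Definition initial (input : seq nat) : config :=
  Config 0 (fun=> 0) (nth 0 input).

Definition computes_within (w : nat) (P : program) (input output : seq nat)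
    (time space : nat) : Prop :=
  exists t : nat,
    [/\ t <= time,
        halted P (iter t (step w P) (initial input)),
        forall u, u < t ->
          access_below P (iter u (step w P) (initial input)) space
      & mkseq (memory (iter t (step w P) (initial input))) (size output)
        = output].

(* Memory layout of the input: the number of runs, followed by the character
   and the length of each run. *)
Definition encode_RLBWT (R : seq (nat * nat)) : seq nat :=
  size R :: flatten [seq [:: x.1; x.2] | x <- R].

Definition bit_length (n : nat) : nat := (trunc_log 2 n).+1.

(* Main.v *)
(* Kasai's algorithm, run on the irreducible positions only. Advancing by one text
   position is the map FL on ranks, which translates r intervals: the runs in the
   order (character, position), obtained by a radix sort in base r + 1. A pointer
   into the text is a rank together with a piece (an interval of translation) that
   contains it.

   A step of FL costs O(1) amortised time, because a piece whose output interval
   contains too many piece starts is split, when it is met, into two pieces that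
   both keep at least two of them: a piece start lies in only one output interval,
   so the number of pieces at most doubles. The link from a piece to the piece of
   its image may lag behind the splits; the pieces are first cut at the multiples
   of n / r, which bounds the total lag by O(n).

   One scan of the text finds the irreducible positions j in order, the suffix
   preceding each of them in the suffix array, and a pointer to every (n / r)-th
   text position. The two pointers needed at j are then reached in O(n / r) steps,
   and since j + PLCP[j] does not decrease the comparisons take O(n) steps in
   total. *)

From Stdlib Require PeanoNat.
Require Import Defs.
From mathcomp Require Import all_boot all_order zify.

Set Implicit Arguments.
Unset Strict Implicit.
Unset Printing Implicit Defensive.

(** * A while language compiled to the word RAM *)

Inductive exp : Type :=
  | EC of nat
  | EV of nat
  | EM of exp
  | EB of binop & exp & exp.

Inductive cmd : Type :=
  | Skip
  | Asg of nat & exp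
  | Sto of exp & exp
  | Seq of cmd & cmd
  | If of exp & cmd & cmd
  | While of exp & cmd.

Record state : Type := State { clk : nat; rg : nat -> nat; mm : nat -> nat }.

Definition rupd (f : nat -> nat) (a v x : nat) : nat :=
  if Nat.eqb x a then v else f x.

Arguments rupd f !a v !x /.

Lemma rupd_neq f a v x : x != a -> rupd f a v x = f x.
Proof. by move=> ne; rewrite /rupd; case: PeanoNat.Nat.eqb_spec ne => // ->; rewrite eqxx. Qed.

Lemma notin_neq (y c : nat) (s : seq nat) : y \notin s -> c \in s -> y != c.
Proof. by move=> Hy Hc; apply: contraNneq Hy => ->. Qed.

Definition evb (o : binop) (x y : nat) : nat :=
  match o with
  | OpAdd => x + y
  | OpSub => x - y
  | OpMul => x * y
  | OpDiv => x %/ y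
  | OpMod => x %% y
  | OpEq => x == y
  | OpLt => x < y
  | _ => 0
  end.

Fixpoint ev (r m : nat -> nat) (e : exp) : nat :=
  match e with
  | EC k => k
  | EV x => r x
  | EM a => m (ev r m a)
  | EB o a b => evb o (ev r m a) (ev r m b)
  end.

Fixpoint ecost (e : exp) : nat :=
  match e with
  | EC _ | EV _ => 1
  | EM a => S (ecost a)
  | EB _ a b => S (Nat.add (ecost a) (ecost b))
  end.

Section Logic.

Variables W sp : nat.

Definition safeb (o : binop) (x y : nat) : Prop :=
  match o with
  | OpAdd => x + y < W
  | OpMul => x * y < W
  | OpSub => y <= x
  | OpDiv | OpMod | OpEq | OpLt => True
  | _ => False
  end.

Fixpoint safe (r m : nat -> nat) (e : exp) : Prop :=
  match e with
  | EC k => k < W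
  | EV _ => True
  | EM a => safe r m a /\ ev r m a < sp
  | EB o a b => [/\ safe r m a, safe r m b & safeb o (ev r m a) (ev r m b)]
  end.

(* The clock is part of the state, so that a postcondition also bounds time. *)
Fixpoint wp_def (c : cmd) (Q : state -> Prop) (s : state) {struct c} : Prop :=
  match c with
  | Skip => Q s
  | Asg x e => safe (rg s) (mm s) e /\
      Q (State (clk s + S (ecost e)) (rupd (rg s) x (ev (rg s) (mm s) e)) (mm s))
  | Sto a e => [/\ safe (rg s) (mm s) a, safe (rg s) (mm s) e,
        ev (rg s) (mm s) a < sp &
        Q (State (clk s + S (Nat.add (ecost a) (ecost e))) (rg s)
             (update (mm s) (ev (rg s) (mm s) a) (ev (rg s) (mm s) e)))]
  | Seq c1 c2 => wp_def c1 (wp_def c2 Q) s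
  | If e c1 c2 => [/\ safe (rg s) (mm s) e,
        ev (rg s) (mm s) e <> 0 ->
          wp_def c1 (fun s' => Q (State (clk s' + 1) (rg s') (mm s')))
            (State (clk s + S (ecost e)) (rg s) (mm s)) &
        ev (rg s) (mm s) e = 0 ->
          wp_def c2 Q (State (clk s + S (ecost e)) (rg s) (mm s))]
  | While e c1 => exists I : nat -> state -> Prop,
      (exists n, I n s) /\
      forall n s1, I n s1 ->
        [/\ safe (rg s1) (mm s1) e,
            ev (rg s1) (mm s1) e <> 0 ->
              wp_def c1 (fun s2 => exists2 n', n' < n &
                                 I n' (State (clk s2 + 1) (rg s2) (mm s2)))
                (State (clk s1 + S (ecost e)) (rg s1) (mm s1)) &
            ev (rg s1) (mm s1) e = 0 ->
              Q (State (clk s1 + S (ecost e)) (rg s1) (mm s1))]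
  end.

(* Sealed, as [done] would otherwise unfold the whole program. *)
Fact wp_key : {f | f = wp_def}.
Proof. by exists wp_def. Qed.

Definition wp : cmd -> (state -> Prop) -> state -> Prop := sval wp_key.

Lemma wpE : wp = wp_def.
Proof. exact: (svalP wp_key). Qed.

Lemma wp_asg x e (Q : state -> Prop) c r m v :
  safe r m e -> ev r m e = v -> Q (State (c + S (ecost e)) (rupd r x v) m) ->
  wp (Asg x e) Q (State c r m).
Proof. by rewrite wpE => /= ? ->. Qed.

Lemma wp_sto a e (Q : state -> Prop) c r m ad v :
  safe r m a -> safe r m e -> ev r m a = ad -> ev r m e = v -> ad < sp ->
  Q (State (c + S (Nat.add (ecost a) (ecost e))) r (update m ad v)) ->
  wp (Sto a e) Q (State c r m).
Proof. by rewrite wpE => /= ? ? -> -> ? ?; split. Qed.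

Lemma wp_skip (Q : state -> Prop) s : Q s -> wp Skip Q s.
Proof. by rewrite wpE. Qed.

Lemma wp_seq c1 c2 (Q : state -> Prop) s :
  wp c1 (wp c2 Q) s -> wp (Seq c1 c2) Q s.
Proof. by rewrite wpE. Qed.

Lemma wp_if e c1 c2 (Q : state -> Prop) c r m :
  safe r m e ->
  (ev r m e <> 0 -> wp c1 (fun s' => Q (State (clk s' + 1) (rg s') (mm s')))
     (State (c + S (ecost e)) r m)) ->
  (ev r m e = 0 -> wp c2 Q (State (c + S (ecost e)) r m)) ->
  wp (If e c1 c2) Q (State c r m).
Proof. by rewrite wpE; split. Qed.

Lemma wp_while e c1 (Q : state -> Prop) s (I : nat -> state -> Prop) n0 :
  I n0 s ->
  (forall n c r m, I n (State c r m) ->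
     [/\ safe r m e,
         ev r m e <> 0 ->
           wp c1 (fun s2 => exists2 n', n' < n &
                    I n' (State (clk s2 + 1) (rg s2) (mm s2)))
             (State (c + S (ecost e)) r m) &
         ev r m e = 0 -> Q (State (c + S (ecost e)) r m)]) ->
  wp (While e c1) Q s.
Proof.
rewrite wpE => H0 H; exists I; split; first by exists n0.
by move=> n [c r m]; apply: H.
Qed.

End Logic.

(* Program variables live in the even registers, the temporaries of expression
   evaluation in the odd ones. *)
Fixpoint cexp (e : exp) (k : nat) : program :=
  match e with
  | EC n => [:: IConst k.*2.+1 n]
  | EV x => [:: IOp OpAnd k.*2.+1 x.*2 x.*2]
  | EM a => cexp a k ++ [:: ILoad k.*2.+1 k.*2.+1]
  | EB o a b =>
      cexp a k ++ cexp b k.+1 ++ [:: IOp o k.*2.+1 k.*2.+1 k.+1.*2.+1]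
  end.

Fixpoint csize (c : cmd) : nat :=
  match c with
  | Skip => 0
  | Asg _ e => (ecost e).+1
  | Sto a e => (ecost a + ecost e).+1
  | Seq c1 c2 => csize c1 + csize c2
  | If e c1 c2 => ecost e + (csize c1 + (csize c2).+2)
  | While e c => ecost e + (csize c).+2
  end.

Fixpoint compile (c : cmd) (l : nat) : program :=
  match c with
  | Skip => [::]
  | Asg x e => cexp e 0 ++ [:: IOp OpAnd x.*2 1 1]
  | Sto a e => cexp a 0 ++ cexp e 1 ++ [:: IStore 1 3]
  | Seq c1 c2 => compile c1 l ++ compile c2 (l + csize c1)
  | If e c1 c2 =>
      cexp e 0 ++ [:: IJz 1 (l + (ecost e + (csize c1).+2))] ++
      compile c1 (l + (ecost e).+1) ++
      [:: IJmp (l + (ecost e + (csize c1 + (csize c2).+2)))] ++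
      compile c2 (l + (ecost e + (csize c1).+2))
  | While e c =>
      cexp e 0 ++ [:: IJz 1 (l + (ecost e + (csize c).+2))] ++
      compile c (l + (ecost e).+1) ++ [:: IJmp l]
  end.

Lemma size_cexp e k : size (cexp e k) = ecost e.
Proof.
by elim: e k => [n|x|a IHa|o a IHa b IHb] k //=;
  rewrite !size_cat /= ?IHa ?IHb; lia.
Qed.

Lemma size_compile c l : size (compile c l) = csize c.
Proof.
elim: c l => [|x e|a e|c1 IH1 c2 IH2|e c1 IH1 c2 IH2|e c IH] l //=;
  rewrite !(size_cat, size_cexp) /= ?size_cat /= ?size_cexp ?IH ?IH1 ?IH2 /=; lia.
Qed.

Section Sound.

Variables (w sp : nat) (P : program).
Hypothesis w_gt0 : 0 < w.

Let W := 2 ^ w.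

Definition reaches (c : config) (t : nat) (c' : config) : Prop :=
  iter t (step w P) c = c' /\
  forall u, u < t -> access_below P (iter u (step w P) c) sp.

Lemma reaches_trans c1 c2 c3 t1 t2 :
  reaches c1 t1 c2 -> reaches c2 t2 c3 -> reaches c1 (t1 + t2) c3.
Proof.
move=> [E1 A1] [E2 A2]; split; first by rewrite addnC iterD E1.
move=> u ltu; case: (ltnP u t1) => [/A1 // | le].
by rewrite -(subnK le) iterD E1; apply: A2; lia.
Qed.

Lemma reaches1 c : access_below P c sp -> reaches c 1 (step w P c).
Proof. by move=> A; split=> // -[]. Qed.

Definition at_pc (l : nat) (Q : program) : Prop :=
  forall i, i < size Q -> nth IHalt P (l + i) = nth IHalt Q i.

Lemma at_pc_cat l Q1 Q2 :
  at_pc l (Q1 ++ Q2) -> at_pc l Q1 /\ at_pc (l + size Q1) Q2.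
Proof.
move=> H; split=> i lti.
  by rewrite H ?size_cat ?nth_cat ?lti //; lia.
rewrite -addnA H ?size_cat ?nth_cat; last by lia.
by rewrite ltnNge leq_addr /= addKn.
Qed.

Lemma at_pc_cons l i Q :
  at_pc l (i :: Q) -> nth IHalt P l = i /\ at_pc l.+1 Q.
Proof.
move=> H; split; first by have := H 0 isT; rewrite addn0.
by move=> j ltj; rewrite addSnnS (H j.+1).
Qed.

Definition small (r m : nat -> nat) : Prop :=
  (forall x, r x < W) /\ (forall a, m a < W).

Lemma W_gt1 : 1 < W.
Proof. by rewrite -{1}(expn0 2) ltn_exp2l. Qed.

Lemma W_gt0 : 0 < W.
Proof. exact: ltnW W_gt1. Qed.

Lemma update_small f a v : (forall x, f x < W) -> v < W ->
  forall x, update f a v x < W.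
Proof. by move=> Hf Hv x; rewrite /update; case: ifP. Qed.

Lemma eval_binop_small o x y : eval_binop w o x y < W.
Proof. by rewrite /eval_binop /trunc_word ltn_pmod ?W_gt0. Qed.

Lemma evb_sound o x y : x < W -> y < W -> safeb W o x y ->
  eval_binop w o x y = evb o x y.
Proof.
rewrite /eval_binop /trunc_word -/W => ltx lty.
have bW (b : bool) : b < W by exact: leq_ltn_trans (leq_b1 b) W_gt1.
case: o => //= H; try by rewrite modn_small.
- by rewrite addnC -addnBA // -{1}(mul1n W) modnMDl modn_small //; lia.
- by rewrite modn_small // (leq_ltn_trans (leq_div _ _)).
- by rewrite modn_small // (leq_ltn_trans (leq_mod _ _)).
Qed.

Lemma copy_sound x : x < W -> eval_binop w OpAnd x x = x.
Proof. by move=> ltx; rewrite /eval_binop PeanoNat.Nat.land_diag /trunc_word modn_small. Qed.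

Definition models (r : nat -> nat) (g : nat -> nat) : Prop :=
  forall x, r x.*2 = g x.

Lemma cexp_sound e k l r m g :
  at_pc l (cexp e k) -> small r m -> models r g -> safe W sp g m e ->
  exists r', [/\ reaches (Config l r m) (ecost e) (Config (l + ecost e) r' m),
    small r' m, models r' g, r' k.*2.+1 = ev g m e &
    forall i, i < k -> r' i.*2.+1 = r i.*2.+1].
Proof.
elim: e k l r => [n|x|a IH|o a IHa b IHb] k l r /=.
- move=> /at_pc_cons [Hi _] [sr smm] rg_r Hs.
  exists (update r k.*2.+1 n); split.
  + rewrite addn1; have -> : Config l.+1 (update r k.*2.+1 n) m =
       step w P (Config l r m).
      by rewrite /step /fetch /= Hi /trunc_word modn_small.
    by apply: reaches1; rewrite /access_below /fetch /= Hi.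
  + by split=> //; apply: update_small.
  + by move=> x; rewrite /update; case: eqP => [E|_]; [lia|apply: rg_r].
  + by rewrite /update eqxx.
  + by move=> i ltik; rewrite /update; case: eqP => //; lia.
- move=> /at_pc_cons [Hi _] [sr smm] rg_r _.
  exists (update r k.*2.+1 (g x)); split.
  + rewrite addn1; have -> : Config l.+1 (update r k.*2.+1 (g x)) m =
       step w P (Config l r m).
      by rewrite /step /fetch /= Hi copy_sound ?sr // rg_r.
    by apply: reaches1; rewrite /access_below /fetch /= Hi.
  + by split=> //; apply: update_small => //; rewrite -rg_r.
  + by move=> y; rewrite /update; case: eqP => [E|_]; [lia|apply: rg_r].
  + by rewrite /update eqxx.
  + by move=> i ltik; rewrite /update; case: eqP => //; lia.
- move=> /at_pc_cat [Ha]; rewrite size_cexp => /at_pc_cons [Hi _] sr rg_r [sa la].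
  have [r1 [R1 S1 M1 E1 F1]] := IH _ _ _ Ha sr rg_r sa.
  exists (update r1 k.*2.+1 (m (ev g m a))); split.
  + rewrite -addn1; apply: reaches_trans R1 _.
    rewrite addnA addn1; have -> : Config (l + ecost a).+1 (update r1 k.*2.+1 (m (ev g m a))) m =
       step w P (Config (l + ecost a) r1 m).
      by rewrite /step /fetch /= Hi E1.
    by apply: reaches1; rewrite /access_below /fetch /= Hi E1.
  + by case: S1 => ? ?; split=> //; apply: update_small.
  + by move=> y; rewrite /update; case: eqP => [E|_]; [lia|apply: M1].
  + by rewrite /update eqxx.
  + by move=> i ltik; rewrite /update; case: eqP => [|_]; [lia|apply: F1].
- move=> /at_pc_cat [Ha]; rewrite size_cexp => /at_pc_cat [Hb].
  rewrite size_cexp => /at_pc_cons [Hi _] sr rg_r [sa sb so].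
  have [r1 [R1 S1 M1 E1 F1]] := IHa _ _ _ Ha sr rg_r sa.
  have [r2 [R2 S2 M2 E2 F2]] := IHb _ _ _ Hb S1 M1 sb.
  have Eo : eval_binop w o (r2 k.*2.+1) (r2 k.+1.*2.+1) = evb o (ev g m a) (ev g m b).
    rewrite evb_sound; first by rewrite E2 F2 // E1.
    - exact: (proj1 S2).
    - exact: (proj1 S2).
    - by rewrite E2 F2 // E1.
  exists (update r2 k.*2.+1 (evb o (ev g m a) (ev g m b))); split.
  + have -> : (ecost a + ecost b)%coq_nat.+1 = ecost a + (ecost b + 1) by lia.
    apply: reaches_trans R1 _; apply: reaches_trans R2 _.
    have -> : Config (l + (ecost a + (ecost b + 1)))
        (update r2 k.*2.+1 (evb o (ev g m a) (ev g m b))) m =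
       step w P (Config (l + ecost a + ecost b) r2 m).
      rewrite /step /fetch /= Hi Eo.
      by have -> : l + (ecost a + (ecost b + 1)) = (l + ecost a + ecost b).+1 by lia.
    by apply: reaches1; rewrite /access_below /fetch /= Hi.
  + split; last exact: (proj2 S2).
    by apply: update_small; [apply: (proj1 S2)|rewrite -Eo eval_binop_small].
  + by move=> y; rewrite /update; case: eqP => [E|_]; [lia|apply: M2].
  + by rewrite /update eqxx.
  + move=> i ltik; rewrite /update; case: eqP => [|_]; first by lia.
    by rewrite F2 ?F1 //; lia.
Qed.

Lemma compile_sound c (Q : state -> Prop) s l r :
  at_pc l (compile c l) -> small r (mm s) -> models r (rg s) -> wp W sp c Q s ->
  exists t s' r', [/\ Q s', reaches (Config l r (mm s)) t (Config (l + csize c) r' (mm s')),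
    clk s' = clk s + t, small r' (mm s') & models r' (rg s')].
Proof.
rewrite wpE.
elim: c Q s l r => [|x e|a e|c1 IH1 c2 IH2|e c1 IH1 c2 IH2|e c IH] Q s l r /=.
- move=> _ sr mr Qs; exists 0, s, r; split=> //; rewrite ?addn0 //.
- move=> /at_pc_cat [He]; rewrite size_cexp => /at_pc_cons [Hi _] sr mr [se HQ].
  have [r1 [R1 S1 M1 E1 _]] := cexp_sound He sr mr se.
  set v := ev _ _ e in E1 HQ.
  exists (ecost e).+1, (State (clk s + (ecost e).+1) (rupd (rg s) x v) (mm s)),
    (update r1 x.*2 v); split=> //=.
  + rewrite -addn1; apply: reaches_trans R1 _.
    have -> : Config (l + (ecost e + 1)) (update r1 x.*2 v) (mm s) =
       step w P (Config (l + ecost e) r1 (mm s)).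
      rewrite /step /fetch /= Hi copy_sound; last exact: (proj1 S1).
      by rewrite E1 addn1 addnS.
    by apply: reaches1; rewrite /access_below /fetch /= Hi.
  + split; last exact: (proj2 S1).
    by apply: update_small; [apply: (proj1 S1)|rewrite -E1; apply: (proj1 S1)].
  + move=> y; rewrite /update /rupd; case: eqP => E.
      have -> : y = x by lia.
      by rewrite PeanoNat.Nat.eqb_refl.
    by have -> : Nat.eqb y x = false; [apply/PeanoNat.Nat.eqb_neq => E'; apply: E; rewrite E'|apply: M1].
- move=> /at_pc_cat [Ha]; rewrite size_cexp => /at_pc_cat [He].
  rewrite size_cexp => /at_pc_cons [Hi _] sr mr [sa se la HQ].
  have [r1 [R1 S1 M1 E1 _]] := cexp_sound Ha sr mr sa.
  have [r2 [R2 S2 M2 E2 F2]] := cexp_sound He S1 M1 se.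
  set v := ev _ _ e in E2 HQ; set ad := ev _ _ a in E1 HQ la.
  have E12 : r2 1 = ad by rewrite -E1 (F2 0).
  exists (ecost a + ecost e).+1, (State (clk s + (ecost a + ecost e).+1) (rg s)
    (update (mm s) ad v)), r2; split=> //=.
  + have -> : (ecost a + ecost e).+1 = ecost a + (ecost e + 1) by lia.
    apply: reaches_trans R1 _; apply: reaches_trans R2 _.
    have -> : Config (l + (ecost a + (ecost e + 1))) r2 (update (mm s) ad v) =
       step w P (Config (l + ecost a + ecost e) r2 (mm s)).
      rewrite /step /fetch /= Hi E12 E2.
      by have -> : l + (ecost a + (ecost e + 1)) = (l + ecost a + ecost e).+1 by lia.
    by apply: reaches1; rewrite /access_below /fetch /= Hi E12.
  + split; first exact: (proj1 S2).
    by apply: update_small; [apply: (proj2 S2)|rewrite -E2; apply: (proj1 S2)].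
- move=> /at_pc_cat [H1]; rewrite size_compile => H2 sr mr Hw.
  have [t1 [s1 [r1 [Hw1 R1 C1 S1 M1]]]] := IH1 _ _ _ _ H1 sr mr Hw.
  have [t2 [s2 [r2 [Q2 R2 C2 S2 M2]]]] := IH2 _ _ _ _ H2 S1 M1 Hw1.
  exists (t1 + t2), s2, r2; split=> //; last by rewrite C2 C1 addnA.
  by rewrite addnA; apply: reaches_trans R1 R2.
- move=> /at_pc_cat [He]; rewrite size_cexp => /at_pc_cons [Hz].
  move=> /at_pc_cat [H1]; rewrite size_compile => /at_pc_cons [Hj H2].
  move=> sr mr [se W1 W2].
  have [r1 [R1 S1 M1 E1 _]] := cexp_sound He sr mr se.
  set v := ev _ _ e in E1 W1 W2.
  case: (eqVneq v 0) => Ev.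
  + have R2 : reaches (Config (l + ecost e) r1 (mm s)) 1
        (Config (l + (ecost e + (csize c1).+2)) r1 (mm s)).
      have -> : Config (l + (ecost e + (csize c1).+2)) r1 (mm s) =
         step w P (Config (l + ecost e) r1 (mm s)).
        by rewrite /step /fetch /= Hz E1 Ev.
      by apply: reaches1; rewrite /access_below /fetch /= Hz.
    have H2' : at_pc (l + (ecost e + (csize c1).+2))
                 (compile c2 (l + (ecost e + (csize c1).+2))).
      by move: H2; have -> : ((l + ecost e).+1 + csize c1).+1 = l + (ecost e + (csize c1).+2) by lia.
    have [t2 [s2 [r2 [Q2 R3 C2 S2 M2]]]] := IH2 _ (State (clk s + (ecost e).+1) (rg s) (mm s)) _ _ H2' S1 M1 (W2 Ev).
    exists (ecost e + (1 + t2)), s2, r2; split=> //; last by rewrite C2 /=; lia.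
    apply: reaches_trans R1 _; apply: reaches_trans R2 _.
    by have -> : l + (ecost e + (csize c1 + (csize c2).+2)) =
       l + (ecost e + (csize c1).+2) + csize c2 by lia.
  + have R2 : reaches (Config (l + ecost e) r1 (mm s)) 1
        (Config (l + (ecost e).+1) r1 (mm s)).
      have -> : Config (l + (ecost e).+1) r1 (mm s) =
         step w P (Config (l + ecost e) r1 (mm s)).
        by rewrite /step /fetch /= Hz E1 (negbTE Ev) addnS.
      by apply: reaches1; rewrite /access_below /fetch /= Hz.
    rewrite -addnS in H1.
    have [t2 [s2 [r2 [Q2 R3 C2 S2 M2]]]] := IH1 _ (State (clk s + (ecost e).+1) (rg s) (mm s)) _ _ H1 S1 M1 (W1 (elimN eqP Ev)).
    exists (ecost e + (1 + (t2 + 1))), (State (clk s2 + 1) (rg s2) (mm s2)), r2.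
    split=> //; last by rewrite /= C2 /=; lia.
    apply: reaches_trans R1 _; apply: reaches_trans R2 _; apply: reaches_trans R3 _.
    have Hj' : nth IHalt P (l + (ecost e).+1 + csize c1) =
        IJmp (l + (ecost e + (csize c1 + (csize c2).+2))).
      by rewrite -Hj addnS.
    have -> : Config (l + (ecost e + (csize c1 + (csize c2).+2))) r2
        (mm (State (clk s2 + 1) (rg s2) (mm s2))) =
       step w P (Config (l + (ecost e).+1 + csize c1) r2 (mm s2)).
      by rewrite /step /fetch /= Hj'.
    by apply: reaches1; rewrite /access_below /fetch /= Hj'.
- move=> /at_pc_cat [He]; rewrite size_cexp => /at_pc_cons [Hz].
  move=> /at_pc_cat [H1]; rewrite size_compile => /at_pc_cons [Hj _].
  move=> sr mr [I [[n In] HI]].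
  rewrite -addnS in H1; rewrite -addnS in Hj.
  elim/ltn_ind: n s r sr mr In => n IHn s r sr mr In.
  have [se W1 W2] := HI _ _ In.
  have [r1 [R1 S1 M1 E1 _]] := cexp_sound He sr mr se.
  set v := ev _ _ e in E1 W1 W2.
  case: (eqVneq v 0) => Ev.
  + exists (ecost e).+1, (State (clk s + (ecost e).+1) (rg s) (mm s)), r1.
    split=> //; first exact: W2.
    rewrite -addn1; apply: reaches_trans R1 _.
    have -> : Config (l + (ecost e + (csize c).+2)) r1
        (mm (State (clk s + (ecost e + 1)) (rg s) (mm s))) =
       step w P (Config (l + ecost e) r1 (mm s)).
      by rewrite /step /fetch /= Hz E1 Ev.
    by apply: reaches1; rewrite /access_below /fetch /= Hz.
  + have R2 : reaches (Config (l + ecost e) r1 (mm s)) 1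
        (Config (l + (ecost e).+1) r1 (mm s)).
      have -> : Config (l + (ecost e).+1) r1 (mm s) =
         step w P (Config (l + ecost e) r1 (mm s)).
        by rewrite /step /fetch /= Hz E1 (negbTE Ev) addnS.
      by apply: reaches1; rewrite /access_below /fetch /= Hz.
    have [t2 [s2 [r2 [Q2 R3 C2 S2 M2]]]] := IH _ (State (clk s + (ecost e).+1) (rg s) (mm s)) _ _ H1 S1 M1 (W1 (elimN eqP Ev)).
    case: Q2 => n' ltn' In'.
    have [t3 [s3 [r3 [Q3 R4 C3 S3 M3]]]] := IHn _ ltn' (State (clk s2 + 1) (rg s2) (mm s2)) r2 S2 M2 In'.
    exists (ecost e + (1 + (t2 + (1 + t3)))), s3, r3.
    split=> //; last by rewrite C3 /= C2 /=; lia.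
    apply: reaches_trans R1 _; apply: reaches_trans R2 _; apply: reaches_trans R3 _.
    apply: reaches_trans R4.
    have -> : Config l r2 (mm (State (clk s2 + 1) (rg s2) (mm s2))) =
       step w P (Config (l + (ecost e).+1 + csize c) r2 (mm s2)).
      by rewrite /step /fetch /= Hj.
    by apply: reaches1; rewrite /access_below /fetch /= Hj.
Qed.

End Sound.

Lemma compile_computes w c input output time sp : 0 < w ->
  (forall a, nth 0 input a < 2 ^ w) ->
  wp (2 ^ w) sp c
    (fun s => clk s <= time /\ mkseq (mm s) (size output) = output)
    (State 0 (fun=> 0) (nth 0 input)) ->
  computes_within w (compile c 0) input output time sp.
Proof.
move=> w0 sm H.
have at0 : at_pc (compile c 0) 0 (compile c 0) by move=> i _.
have small0 : small w (fun=> 0) (nth 0 input) by split=> // x; rewrite expn_gt0.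
have models0 : models (fun=> 0) (fun=> 0) by [].
have [t [s [r [[Qt Qo] [E A] C _ _]]]] := @compile_sound w sp _ w0 c _
  (State 0 (fun=> 0) (nth 0 input)) _ _ at0 small0 models0 H.
exists t; rewrite /initial E; split=> //.
- by rewrite C in Qt.
- by rewrite /halted /fetch /= add0n nth_default // size_compile.
Qed.

(** * Pieces of a piecewise translation *)

Section Pieces.

Variables (b N0 n dmax : nat) (fl ro : nat -> nat).
Hypothesis fl_inj : forall x y, x < n -> y < n -> fl x = fl y -> x = y.

Definition hits (q d p : nat -> nat) (N k : nat) : nat :=
  count (fun j => q k <= p j < q k + d k) (iota b N).

(* Piece [k] maps the input interval [p k, p k + d k) to the output interval
   starting at [q k], inside run [rn k]; [nx k] is the next piece in input order,
   and [ci k] a piece at or before the one that contains [q k]. *)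
Record pieces (p q d nx ci rn : nat -> nat) (N : nat) : Prop := Pieces {
  piece_range : forall k, b <= k < b + N -> 0 < d k /\ p k + d k <= n;
  piece_fl : forall k o, b <= k < b + N -> o < d k ->
    fl (p k + o) = q k + o /\ ro (q k + o) = rn k;
  piece_uniq : forall k j x, b <= k < b + N -> b <= j < b + N ->
    p k <= x < p k + d k -> p j <= x < p j + d j -> k = j;
  piece_next : forall k, b <= k < b + N ->
    p k + d k = n \/ (b <= nx k < b + N /\ p (nx k) = p k + d k);
  piece_dest : forall k, b <= k < b + N -> b <= ci k < b + N /\ p (ci k) <= q k;
  piece_len : forall k, b <= k < b + N -> d k <= dmax;
  piece_full : N <= N0 + count (fun k => 2 <= hits q d p N k) (iota b N)
}.

Lemma mem_ids N k : (k \in iota b N) = (b <= k < b + N).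
Proof. by rewrite mem_iota. Qed.

Lemma sum_const_iota c N : \sum_(k <- iota b N) c = N * c.
Proof. by rewrite big_const_seq count_predT size_iota iter_addn_0 mulnC. Qed.

Lemma piece_out_uniq p q d nx ci rn N k j y :
  pieces p q d nx ci rn N -> b <= k < b + N -> b <= j < b + N ->
  q k <= y < q k + d k -> q j <= y < q j + d j -> k = j.
Proof.
move=> H Hk Hj Yk Yj.
have [] := piece_fl H Hk (_ : y - q k < d k); first by lia.
have [] := piece_fl H Hj (_ : y - q j < d j); first by lia.
have [? ?] := piece_range H Hk; have [? ?] := piece_range H Hj.
move=> Ej _ Ek _.
have E : p k + (y - q k) = p j + (y - q j).
  by apply: fl_inj; rewrite ?Ek ?Ej; lia.
by apply: (piece_uniq H (x := p k + (y - q k))); lia.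
Qed.

(* Every piece start lies in exactly one output interval, and each split leaves
   one more output interval that contains two piece starts. *)
Lemma pieces_bound p q d nx ci rn N :
  pieces p q d nx ci rn N -> N <= 2 * N0.
Proof.
move=> H; have Hf := piece_full H.
have H1 : \sum_(k <- iota b N) hits q d p N k <= N.
  have -> : \sum_(k <- iota b N) hits q d p N k =
      \sum_(j <- iota b N) count (fun k => q k <= p j < q k + d k) (iota b N).
    under eq_bigr do rewrite /hits -sum1_count big_mkcond /=.
    rewrite exchange_big /=.
    by under [RHS]eq_bigr do rewrite -sum1_count big_mkcond /=.
  rewrite -[leqRHS]muln1 -sum_const_iota !big_seq; apply: leq_sum => j Hj.
  rewrite -size_filter leqNgt; apply/negP => Hs.
  set s := filter _ _ in Hs.
  have us : uniq s by rewrite filter_uniq // iota_uniq.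
  case Es: s Hs us => [|x [|y t]] //= _; rewrite inE negb_or => /andP[/andP[xy _] _].
  have xs : x \in s by rewrite Es inE eqxx.
  have ys : y \in s by rewrite Es !inE eqxx orbT.
  move: xs ys; rewrite !mem_filter !mem_ids => /andP[x1 x2] /andP[y1 y2].
  by rewrite (piece_out_uniq H x2 y2 x1 y1) eqxx in xy.
have H2 : 2 * count (fun k => 2 <= hits q d p N k) (iota b N) <=
    \sum_(k <- iota b N) hits q d p N k.
  rewrite -sum1_count big_distrr /= big_mkcond /=; apply: leq_sum => k _.
  by case: ifP => //; rewrite muln1.
lia.
Qed.

Lemma piece_start_inj p q d nx ci rn N k j :
  pieces p q d nx ci rn N -> b <= k < b + N -> b <= j < b + N ->
  p k = p j -> k = j.
Proof.
move=> H Hk Hj E; have [? ?] := piece_range H Hk; have [? ?] := piece_range H Hj.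
by apply: (piece_uniq H (x := p k)); lia.
Qed.

Definition starts (p : nat -> nat) (N lo hi : nat) : nat :=
  count (fun j => lo < p j <= hi) (iota b N).

Lemma count_two (a : pred nat) (s : seq nat) x y :
  x \in s -> y \in s -> x != y -> a x -> a y -> 2 <= count a s.
Proof.
move=> xs ys xy ax ay.
have : 1 < size (filter a s).
  have : {subset [:: x; y] <= filter a s}.
    by move=> z; rewrite !inE => /orP[] /eqP ->; rewrite mem_filter ?ax ?ay ?xs ?ys.
  by move/uniq_leq_size => /(_ _); apply; rewrite /= inE xy.
by rewrite size_filter.
Qed.

Lemma leq_count_in (a a' : pred nat) (s : seq nat) :
  (forall y, y \in s -> a y -> a' y) -> count a s <= count a' s.
Proof.
elim: s => //= y s IH sub; apply: leq_add.
  by case E: (a y) => //; rewrite (sub y) // inE eqxx.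
by apply: IH => z zs; apply: sub; rewrite inE zs orbT.
Qed.

Lemma ltn_count_in (a a' : pred nat) (s : seq nat) x :
  (forall y, y \in s -> a y -> a' y) -> x \in s -> ~~ a x -> a' x ->
  count a s < count a' s.
Proof.
move=> sub /perm_to_rem Hx nax a'x; rewrite !(permP Hx) /= (negbTE nax) a'x ltnS.
by apply: leq_count_in => y /mem_rem; apply: sub.
Qed.

Lemma starts_next p N lo k k' :
  b <= k' < b + N -> lo < p k' -> p k < p k' ->
  starts p N lo (p k) < starts p N lo (p k').
Proof.
move=> Hk' l1 l2; apply: (@ltn_count_in _ _ _ k').
- by move=> y _; lia.
- by rewrite mem_ids.
- by lia.
- by lia.
Qed.

Lemma starts_leq p q d nx ci rn N lo M :
  pieces p q d nx ci rn N -> b <= M < b + N ->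
  starts p N lo (p M) <= (count (fun j => lo <= p j < p M) (iota b N)).+1.
Proof.
move=> H HM; rewrite /starts -!size_filter.
apply: (@uniq_leq_size _ _ (M :: [seq j <- iota b N | lo <= p j < p M])).
  by rewrite filter_uniq ?iota_uniq.
move=> j; rewrite inE !mem_filter mem_ids => /andP[h Hj].
case: eqP => //= nM; rewrite Hj andbT.
have : p j <> p M by move/(piece_start_inj H Hj HM).
lia.
Qed.

Lemma pieces_ext p q d nx ci rn p' q' d' nx' ci' rn' N :
  pieces p q d nx ci rn N ->
  (forall j, b <= j -> p' j = p j) -> (forall j, b <= j -> q' j = q j) ->
  (forall j, b <= j -> d' j = d j) -> (forall j, b <= j -> nx' j = nx j) ->
  (forall j, b <= j -> rn' j = rn j) ->
  (forall k, b <= k < b + N -> b <= ci' k < b + N /\ p (ci' k) <= q k) ->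
  pieces p' q' d' nx' ci' rn' N.
Proof.
move=> H Ep Eq Ed En Er Hc.
have bk k : b <= k < b + N -> b <= k by case/andP.
split.
- by move=> k Hk; have h := bk _ Hk; rewrite Ep // Ed //; apply: (piece_range H).
- move=> k o Hk; have h := bk _ Hk; rewrite Ep // Ed // Eq // Er //.
  exact: (piece_fl H).
- move=> k j x Hk Hj; have hk := bk _ Hk; have hj := bk _ Hj.
  by rewrite (Ep k) // (Ep j) // (Ed k) // (Ed j) //; apply: (piece_uniq H).
- move=> k Hk; have hk := bk _ Hk; rewrite (Ep k) // Ed // En //.
  have [->|[h E]] := piece_next H Hk; [by left|right].
  by have hn := bk _ h; rewrite Ep.
- move=> k Hk; have [h1 h2] := Hc _ Hk; have hk := bk _ Hk; have hc := bk _ h1.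
  by rewrite Ep // Eq.
- by move=> k Hk; have hk := bk _ Hk; rewrite Ed //; apply: (piece_len H).
- apply: leq_trans (piece_full H) _; rewrite leq_add2l.
  apply: leq_count_in => k; rewrite mem_ids => Hk; have hk := bk _ Hk.
  rewrite /hits Eq // Ed // => h.
  apply: leq_trans h _; apply: leq_count_in => j; rewrite mem_ids => Hj.
  by have hj := bk _ Hj; rewrite Ep.
Qed.

Lemma pieces_split p q d nx ci rn p' q' d' nx' ci' rn' N k o M :
  pieces p q d nx ci rn N -> b <= k < b + N -> b <= M < b + N ->
  0 < o < d k -> p M = q k + o ->
  2 <= count (fun j => q k <= p j < q k + o) (iota b N) ->
  2 <= count (fun j => q k + o <= p j < q k + d k) (iota b N) ->
  (forall j, p' j = if j == b + N then p k + o else p j) ->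
  (forall j, q' j = if j == b + N then q k + o else q j) ->
  (forall j, d' j = if j == b + N then d k - o else if j == k then o else d j) ->
  (forall j, nx' j = if j == b + N then nx k else
                     if j == k then b + N else nx j) ->
  (forall j, ci' j = if j == b + N then M else ci j) ->
  (forall j, rn' j = if j == b + N then rn k else rn j) ->
  pieces p' q' d' nx' ci' rn' N.+1.
Proof.
move=> H Hk HM Ho EM L1 L2 Ep Eq Ed En Ec Er.
have [dk pk] := piece_range H Hk.
have ids j : b <= j < b + N.+1 -> j != b + N -> b <= j < b + N by lia.
have kN : (k == b + N) = false by lia.
split.
- move=> j Hj; rewrite Ep Ed; case: eqP => [_|/eqP nj]; first by lia.
  have [? ?] := piece_range H (ids _ Hj nj).
  by case: eqP => [->|_]; lia.
- move=> j u Hj; rewrite Ep Ed Eq Er; case: eqP => [_|/eqP nj].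
    move=> Hu; have [] := piece_fl H Hk (_ : o + u < d k); first by lia.
    by rewrite !addnA.
  case: eqP => [->|_] Hu; last exact: (piece_fl H (ids _ Hj nj) Hu).
  by apply: (piece_fl H) => //; lia.
- pose par j := if j == b + N then k else j.
  have parP j : b <= j < b + N.+1 -> b <= par j < b + N.
    by rewrite /par; case: eqP => // /eqP nj Hj; apply: ids.
  have parI j x : p' j <= x < p' j + d' j -> p (par j) <= x < p (par j) + d (par j).
    rewrite Ep Ed /par; case: eqP => _; first by lia.
    by case: eqP => [->|_]; lia.
  move=> j1 j2 x H1 H2 X1 X2.
  have := piece_uniq H (parP _ H1) (parP _ H2) (parI _ _ X1) (parI _ _ X2).
  move: X1 X2; rewrite !Ep !Ed /par.
  case: (eqVneq j1 (b + N)) => [->|n1]; case: (eqVneq j2 (b + N)) => [->|n2] //.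
  + by move=> X1 X2 E; move: X2; rewrite -E eqxx; lia.
  + by move=> X1 X2 E; move: X1; rewrite E eqxx; lia.
- move=> j Hj; rewrite Ep Ed En; case: eqP => [_|/eqP nj].
    have -> : p k + o + (d k - o) = p k + d k by lia.
    have [->|[h E]] := piece_next H Hk; [by left|right].
    rewrite Ep; case: eqP => [E'|_]; first by lia.
    by split; first by lia.
  case: eqP => [->|_]; first by right; rewrite Ep eqxx; lia.
  have [->|[h E]] := piece_next H (ids _ Hj nj); [by left|right].
  rewrite Ep; case: eqP => [E'|_]; first by lia.
  by split; first by lia.
- move=> j Hj; rewrite Ec Eq; case: eqP => [_|/eqP nj].
    by rewrite Ep; case: eqP => [|_]; lia.
  have [h1 h2] := piece_dest H (ids _ Hj nj).
  by rewrite Ep; case: eqP => [|_]; lia.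
- move=> j Hj; rewrite Ed; case: eqP => [_|/eqP nj].
    by have := piece_len H Hk; lia.
  case: eqP => [_|_]; first by have := piece_len H Hk; lia.
  exact: (piece_len H (ids _ Hj nj)).
- have Hf := piece_full H.
  have ids_in j : j \in iota b N -> (j == b + N) = false.
    by rewrite mem_ids; lia.
  have hits_mono lo hi :
      2 <= count (fun i => lo <= p i < hi) (iota b N) ->
      2 <= count (fun i => lo <= p' i < hi) (iota b N.+1).
    move=> h; apply: leq_trans h _.
    rewrite -addn1 iotaD count_cat; apply: leq_trans (leq_addr _ _).
    by apply: leq_count_in => i /ids_in iN; rewrite Ep iN.
  have newfull : 2 <= hits q' d' p' N.+1 (b + N).
    rewrite /hits Eq Ed eqxx.
    have -> : q k + o + (d k - o) = q k + d k by lia.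
    exact: hits_mono.
  have kfull : 2 <= hits q' d' p' N.+1 k.
    by rewrite /hits Eq Ed kN eqxx; apply: hits_mono.
  rewrite -[X in iota b X]addn1 iotaD count_cat /= newfull addn0 addnA addn1 ltnS.
  apply: leq_trans Hf _; rewrite leq_add2l; apply: leq_count_in => j jN.
  case: (eqVneq j k) => [-> //|njk].
  by rewrite /hits Eq Ed (ids_in _ jN) (negbTE njk); apply: hits_mono.
Qed.

End Pieces.

(** * One step of FL *)

(* Memory is an array of records of 17 cells: field [f] of record [k] is cell
   [17 k + f]. Runs and pieces are records numbered from [r + 1] on, above the
   input; record 0 serves as the null pointer. *)
Definition adr (f : nat) (e : exp) : exp := EB OpAdd (EB OpMul e (EC 17)) (EC f).
Definition get (f x : nat) : exp := EM (adr f (EV x)).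
Definition put (f x : nat) (e : exp) : cmd := Sto (adr f (EV x)) e.

Notation "a +' c" := (EB OpAdd a c) (at level 50, left associativity).
Notation "a -' c" := (EB OpSub a c) (at level 50, left associativity).
Notation "a <' c" := (EB OpLt a c) (at level 70).
Notation "a =' c" := (EB OpEq a c) (at level 70).
Notation "c1 ;; c2" := (Seq c1 c2) (at level 90, right associativity).

Lemma update_field m k f v j g : f < 17 -> g < 17 ->
  update m (k * 17 + f) v (j * 17 + g) =
  if (g == f) && (j == k) then v else m (j * 17 + g).
Proof.
move=> Hf Hg; rewrite /update.
have -> // : (j * 17 + g == k * 17 + f) = (g == f) && (j == k).
apply/eqP/andP => [E|[/eqP-> /eqP->] //].
by split; apply/eqP; lia.
Qed.

Notation fP := 0%N (only parsing).
Notation fQ := 1%N (only parsing).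
Notation fD := 2%N (only parsing).
Notation fNX := 3%N (only parsing).
Notation fCI := 4%N (only parsing).
Notation fRN := 5%N (only parsing).
Notation vNP := 4%N (only parsing).
Notation vK := 5%N (only parsing).
Notation vI := 6%N (only parsing).
Notation vM := 7%N (only parsing).
Notation vX := 8%N (only parsing).
Notation vR := 9%N (only parsing).
Notation vC := 10%N (only parsing).
Notation vO := 11%N (only parsing).

Definition walk (x : nat) (e : exp) : cmd :=
  While ((e <' get fP x +' get fD x) =' EC 0) (Asg x (get fNX x)).

Definition split_piece : cmd :=
  Asg vO (get fP vM -' get fQ vK) ;;
  put fP vNP (get fP vK +' EV vO) ;;
  put fQ vNP (get fP vM) ;;
  put fD vNP (get fD vK -' EV vO) ;;
  put fNX vNP (get fNX vK) ;;
  put fRN vNP (EV vR) ;;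
  put fCI vNP (EV vM) ;;
  put fD vK (EV vO) ;;
  put fNX vK (EV vNP) ;;
  Asg vK (EV vNP) ;;
  Asg vNP (EV vNP +' EC 1) ;;
  Asg vC (EC 0).

(* [vI] is a rank and [vK] a piece at or before the one that contains it; they
   are replaced by [fl vI] and its piece, and [vR] becomes the run of [fl vI]. A
   split happens when the third piece start met in the output interval of [vK] is
   followed by another one. *)
Definition fl_step : cmd :=
  walk vK (EV vI) ;;
  Asg vM (get fCI vK) ;;
  walk vM (get fQ vK) ;;
  put fCI vK (EV vM) ;;
  Asg vX (get fQ vK +' (EV vI -' get fP vK)) ;;
  Asg vR (get fRN vK) ;;
  Asg vC (EC 0) ;;
  While ((EV vX <' get fP vM +' get fD vM) =' EC 0)
    (If (EV vC =' EC 3) split_piece Skip ;;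
     Asg vM (get fNX vM) ;;
     Asg vC (EV vC +' EC 1)) ;;
  Asg vK (EV vM) ;;
  Asg vI (EV vX).

Section Layout.

Variables (b N0 n dmax : nat) (fl ro : nat -> nat).

Definition pcs (m : nat -> nat) (N : nat) : Prop :=
  pieces b N0 n dmax fl ro (fun k => m (k * 17 + 0)) (fun k => m (k * 17 + 1))
    (fun k => m (k * 17 + 2)) (fun k => m (k * 17 + 3))
    (fun k => m (k * 17 + 4)) (fun k => m (k * 17 + 5)) N.

Definition nstarts (m : nat -> nat) (N lo hi : nat) : nat :=
  starts b (fun k => m (k * 17 + 0)) N lo hi.

Definition keep (m m' : nat -> nat) : Prop :=
  forall a, (a < b * 17) || (6 <= a %% 17) -> m' a = m a.

Lemma keep_update m m' k f v : f < 6 -> b <= k -> keep m m' ->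
  keep m (update m' (k * 17 + f) v).
Proof.
move=> Hf Hk H a Ha; rewrite /update; case: eqP => [E|_]; last exact: H.
by move: Ha; rewrite E modnMDl modn_small; lia.
Qed.

Lemma keep_trans m1 m2 m3 : keep m1 m2 -> keep m2 m3 -> keep m1 m3.
Proof. by move=> H1 H2 a Ha; rewrite H2 // H1. Qed.

(* The work still to be paid for: catching up with the [ci] fields, which splits
   leave behind, and the splits to come. *)
Definition lag (m : nat -> nat) (N : nat) : nat :=
  \sum_(k <- iota b N) (m (k * 17 + 1) - m (m (k * 17 + 4) * 17 + 0)).

Definition pot (m : nat -> nat) (N : nat) : nat := lag m N + (2 * N0 - N).

Lemma lag_update m N K M : b <= K < b + N ->
  m (m (K * 17 + 4) * 17 + 0) <= m (M * 17 + 0) <= m (K * 17 + 1) ->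
  lag (update m (K * 17 + 4) M) N +
    (m (M * 17 + 0) - m (m (K * 17 + 4) * 17 + 0)) <= lag m N.
Proof.
move=> HK HM; rewrite /lag.
have Kin : K \in iota b N by rewrite mem_ids.
rewrite !(bigD1_seq K Kin (iota_uniq b N)) /= !update_field //= eqxx.
set s1 := \sum_(_ <- _ | _) _; set s2 := \sum_(_ <- _ | _) _.
have -> : s1 = s2.
  by apply: eq_bigr => j nj; rewrite !update_field //= (negbTE nj).
lia.
Qed.

Lemma leq_nstarts m N lo hi hi' : hi <= hi' -> nstarts m N lo hi <= nstarts m N lo hi'.
Proof. by move=> le; apply: sub_count => j; lia. Qed.

Lemma keep_field m m' k f : keep m m' -> 6 <= f < 17 ->
  m' (k * 17 + f) = m (k * 17 + f).
Proof. by move=> H Hf; rewrite H // modnMDl modn_small; lia. Qed.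

Definition same_pieces (m m' : nat -> nat) : Prop :=
  forall k f, b <= k -> f < 6 -> m' (k * 17 + f) = m (k * 17 + f).

Lemma same_pcs m m' N : same_pieces m m' -> pcs m N -> pcs m' N.
Proof.
move=> E H; apply: (pieces_ext H) => j Hj; try exact: E.
case/andP: (Hj) => bj _; rewrite E //; exact: (piece_dest H Hj).
Qed.

Lemma same_pot m m' N : same_pieces m m' -> pcs m N -> pot m' N = pot m N.
Proof.
move=> E H; congr (_ + _); rewrite /lag !big_seq.
apply: eq_bigr => k; rewrite mem_ids => Hk; have [/andP[h _] _] := piece_dest H Hk.
by case/andP: Hk => bk _; rewrite !E // E.
Qed.

Lemma same_nstarts m m' N lo hi : same_pieces m m' ->
  nstarts m' N lo hi = nstarts m N lo hi.
Proof.
by move=> E; apply: eq_in_count => k; rewrite mem_ids => /andP[bk _]; rewrite E.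
Qed.

Lemma nstarts_grow m m' N N' lo hi : N <= N' ->
  (forall j, b <= j < b + N -> m' (j * 17 + 0) = m (j * 17 + 0)) ->
  nstarts m' N' lo hi <= nstarts m N lo hi + (N' - N).
Proof.
move=> le E; rewrite /nstarts /starts -{1}(subnKC le) iotaD count_cat; apply: leq_add.
  by apply: leq_count_in => j; rewrite mem_ids => /E ->.
by rewrite -[leqRHS](size_iota (b + N)) count_size.
Qed.

Lemma nstarts_leq m N lo hi : pcs m N -> nstarts m N lo hi <= hi - lo.
Proof.
move=> H; rewrite /nstarts /starts -size_filter -(size_map (fun j => m (j * 17 + 0))).
rewrite -[leqRHS](size_iota lo.+1); apply: uniq_leq_size.
  rewrite map_inj_in_uniq ?filter_uniq ?iota_uniq // => j k.
  rewrite !mem_filter !mem_ids => /andP[_ Hj] /andP[_ Hk].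
  exact: (piece_start_inj H Hj Hk).
by move=> y /mapP [j]; rewrite mem_filter => /andP[h _] ->; rewrite mem_iota; lia.
Qed.

Lemma nstarts0 m N k i : pcs m N -> b <= k < b + N ->
  i < m (k * 17 + 0) + m (k * 17 + 2) -> nstarts m N (m (k * 17 + 0)) i = 0.
Proof.
move=> H Hk Hi; apply/eqP; rewrite -leqn0 leqNgt -has_count; apply/hasP => -[j].
rewrite mem_ids => Hj Hp; have [d0 _] := piece_range H Hj.
have E : k = j by apply: (piece_uniq H Hk Hj (x := m (j * 17 + 0))); lia.
by move: Hp; rewrite E; lia.
Qed.

End Layout.

Section Step.

Variables (W sp b N0 n dmax : nat) (fl ro : nat -> nat).
Hypothesis fl_inj : forall x y, x < n -> y < n -> fl x = fl y -> x = y.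
Hypothesis fl_lt : forall x, x < n -> fl x < n.
Hypothesis sp_ge : (b + 2 * N0 + 2) * 17 <= sp.
Hypothesis W_ge : sp + 2 * n + 100 <= W.
Hypothesis b_gt0 : 0 < b.

Local Notation pcs := (pcs b N0 n dmax fl ro).
Local Notation nstarts := (nstarts b).
Local Notation keep := (keep b).
Local Notation lag := (lag b).
Local Notation pot := (pot b N0).

Lemma pcs_size m N : pcs m N -> N <= 2 * N0.
Proof. exact: pieces_bound. Qed.

Lemma pcs_range m N k : pcs m N -> b <= k < b + N ->
  [/\ 0 < m (k * 17 + 2), m (k * 17 + 0) + m (k * 17 + 2) <= n & k < b + 2 * N0].
Proof.
move=> H Hk; have [? ?] := piece_range H Hk.
by split=> //; have := pcs_size H; lia.
Qed.

Lemma pcs_next m N k : pcs m N -> b <= k < b + N ->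
  m (k * 17 + 0) + m (k * 17 + 2) < n ->
  b <= m (k * 17 + 3) < b + N /\
  m (m (k * 17 + 3) * 17 + 0) = m (k * 17 + 0) + m (k * 17 + 2).
Proof. by move=> H Hk lt; have [E|//] := piece_next H Hk; lia. Qed.

Lemma pcs_fl m N k o : pcs m N -> b <= k < b + N -> o < m (k * 17 + 2) ->
  fl (m (k * 17 + 0) + o) = m (k * 17 + 1) + o /\
  ro (m (k * 17 + 1) + o) = m (k * 17 + 5).
Proof. by move=> H; apply: (piece_fl H). Qed.

Lemma pcs_dest m N k : pcs m N -> b <= k < b + N ->
  b <= m (k * 17 + 4) < b + N /\ m (m (k * 17 + 4) * 17 + 0) <= m (k * 17 + 1).
Proof. by move=> H; apply: (piece_dest H). Qed.

Lemma walk_spec x e s N v (Q : state -> Prop) :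
  (forall r', (forall y, y != x -> r' y = rg s y) ->
     safe W sp r' (mm s) e /\ ev r' (mm s) e = v) ->
  ecost e <= 6 -> pcs (mm s) N -> b <= rg s x < b + N ->
  mm s (rg s x * 17 + 0) <= v < n ->
  (forall c r' t, (forall y, y != x -> r' y = rg s y) -> b <= r' x < b + N ->
     mm s (r' x * 17 + 0) <= v < mm s (r' x * 17 + 0) + mm s (r' x * 17 + 2) ->
     mm s (rg s x * 17 + 0) + t <= mm s (r' x * 17 + 0) ->
     t <= nstarts (mm s) N (mm s (rg s x * 17 + 0)) (mm s (r' x * 17 + 0)) ->
     c <= clk s + 40 * t + 40 -> Q (State c r' (mm s))) ->
  wp W sp (walk x e) Q s.
Proof.
case: s => c0 r0 m /= He ce H Hx Hv HQ.
apply: (@wp_while _ _ _ _ _ _ (fun k s1 => exists t, [/\ mm s1 = m /\ k = n - m (rg s1 x * 17 + 0),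
  (forall y, y != x -> rg s1 y = r0 y) /\ b <= rg s1 x < b + N,
  m (rg s1 x * 17 + 0) <= v, m (r0 x * 17 + 0) + t <= m (rg s1 x * 17 + 0) /\
  t <= nstarts m N (m (r0 x * 17 + 0)) (m (rg s1 x * 17 + 0)) &
  clk s1 <= c0 + 40 * t]) (n - m (r0 x * 17 + 0))).
  by exists 0; split=> //=; lia.
move=> k c1 r1 m1 /= [t [[-> ->] [Fr Hr1] lev [Ht1 Ht2] Hc]].
have [se Ee] := He _ Fr.
have [? ? ?] := pcs_range H Hr1.
rewrite Ee; split.
- by repeat split=> //; lia.
- move=> Hlt; have [Hn En] := pcs_next H Hr1 ltac:(lia).
  apply: wp_asg; [by rewrite /=; repeat split=> //; lia|by []|].
  exists (n - m (m (r1 x * 17 + 3) * 17 + 0)); first by rewrite En; lia.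
  have Ex : rupd r1 x (m (r1 x * 17 + 3)) x = m (r1 x * 17 + 3).
    by rewrite /rupd PeanoNat.Nat.eqb_refl.
  exists t.+1; rewrite /= Ex; split=> //.
  + split=> // y ny; rewrite /rupd; case E: (Nat.eqb y x); last exact: Fr.
    by move/PeanoNat.Nat.eqb_eq: E ny => ->; rewrite eqxx.
  + by rewrite En; lia.
  + split; first by rewrite En; lia.
    apply: leq_ltn_trans Ht2 _; rewrite /nstarts.
    by apply: (@starts_next b (fun k => m (k * 17 + 0)) N _ (r1 x)) => //; lia.
  + lia.
- by move=> Hge; apply: (HQ _ _ t) => //; lia.
Qed.

Lemma split_spec s N K M (Q : state -> Prop) :
  let m := mm s in let r := rg s in
  r vNP = b + N -> r vK = K -> r vM = M ->
  pcs m N -> b <= K < b + N -> b <= M < b + N ->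
  m (M * 17 + 0) + m (M * 17 + 2) < m (K * 17 + 1) + m (K * 17 + 2) <= n ->
  3 <= nstarts m N (m (K * 17 + 1)) (m (M * 17 + 0)) ->
  r vR = m (K * 17 + 5) ->
  (forall c r' m', (forall y, y \notin [:: vNP; vK; vC; vO] -> r' y = r y) ->
     r' vNP = b + N.+1 -> r' vK = b + N -> r' vC = 0 -> pcs m' N.+1 -> keep m m' ->
     (forall j, b <= j < b + N -> m' (j * 17 + 0) = m (j * 17 + 0)) ->
     m' ((b + N) * 17 + 1) = m (M * 17 + 0) ->
     m' ((b + N) * 17 + 1) + m' ((b + N) * 17 + 2) =
       m (K * 17 + 1) + m (K * 17 + 2) ->
     m' ((b + N) * 17 + 5) = r vR ->
     m' (M * 17 + 0) + m' (M * 17 + 2) <= m (M * 17 + 0) + m (M * 17 + 2) ->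
     pot m' N.+1 < pot m N -> c <= clk s + 400 -> Q (State c r' m')) ->
  wp W sp split_piece Q s.
Proof.
case: s => c0 r m /= ENP EK EM H HK HM Hend H3 HR HQ.
have Hs := starts_leq (m (K * 17 + 1)) H HM.
have H3' := H3; rewrite /nstarts in H3'.
have {Hs} Hl := leq_trans H3' Hs; rewrite ltnS in Hl.
have [x xin Hx] : exists2 x, x \in iota b N & m (K * 17 + 1) < m (x * 17 + 0) <= m (M * 17 + 0).
  by apply/hasP; rewrite has_count; apply: leq_trans H3'.
have [KD KR KB] := pcs_range H HK; have [MD MR MB] := pcs_range H HM.
have [HX EX] := pcs_next H HM ltac:(lia).
have [o Eo] : exists o, o = m (M * 17 + 0) - m (K * 17 + 1) by exists (m (M * 17 + 0) - m (K * 17 + 1)).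
have Hh : 2 <= count (fun j => m (K * 17 + 1) + o <= m (j * 17 + 0) <
                        m (K * 17 + 1) + m (K * 17 + 2)) (iota b N).
  apply: (@count_two _ _ M (m (M * 17 + 3))); rewrite ?mem_ids //.
  - by apply/eqP => E; move: EX; rewrite -E; lia.
  - by lia.
  - by rewrite EX; lia.
have KN : (K == b + N) = false by lia.
have MN : (M == b + N) = false by lia.
have [m1 Fm1] : exists m', m' = update m ((b + N) * 17 + 0) (m (K * 17 + 0) + o) by eexists.
have [m2 Fm2] : exists m', m' = update m1 ((b + N) * 17 + 1) (m (M * 17 + 0)) by eexists.
have [m3 Fm3] : exists m', m' = update m2 ((b + N) * 17 + 2) (m (K * 17 + 2) - o) by eexists.
have [m4 Fm4] : exists m', m' = update m3 ((b + N) * 17 + 3) (m (K * 17 + 3)) by eexists.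
have [m5 Fm5] : exists m', m' = update m4 ((b + N) * 17 + 5) (r vR) by eexists.
have [m6 Fm6] : exists m', m' = update m5 ((b + N) * 17 + 4) M by eexists.
have [m7 Fm7] : exists m', m' = update m6 (K * 17 + 2) o by eexists.
have [m8 Fm8] : exists m', m' = update m7 (K * 17 + 3) (b + N) by eexists.
have E0 j : m8 (j * 17 + 0) = if j == b + N then m (K * 17 + 0) + o else m (j * 17 + 0).
  by rewrite Fm8 Fm7 Fm6 Fm5 Fm4 Fm3 Fm2 Fm1 !update_field.
have E1 j : m8 (j * 17 + 1) = if j == b + N then m (K * 17 + 1) + o else m (j * 17 + 1).
  by rewrite Fm8 Fm7 Fm6 Fm5 Fm4 Fm3 Fm2 Fm1 !update_field //=; case: eqP => // _; lia.
have E2 j : m8 (j * 17 + 2) = if j == b + N then m (K * 17 + 2) - o else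
    if j == K then o else m (j * 17 + 2).
  by rewrite Fm8 Fm7 Fm6 Fm5 Fm4 Fm3 Fm2 Fm1 !update_field //=; case: eqP => // ->; rewrite KN.
have E3 j : m8 (j * 17 + 3) = if j == b + N then m (K * 17 + 3) else
    if j == K then b + N else m (j * 17 + 3).
  by rewrite Fm8 Fm7 Fm6 Fm5 Fm4 Fm3 Fm2 Fm1 !update_field //=; case: eqP => // ->; rewrite KN.
have E4 j : m8 (j * 17 + 4) = if j == b + N then M else m (j * 17 + 4).
  by rewrite Fm8 Fm7 Fm6 Fm5 Fm4 Fm3 Fm2 Fm1 !update_field.
have E5 j : m8 (j * 17 + 5) = if j == b + N then m (K * 17 + 5) else m (j * 17 + 5).
  by rewrite Fm8 Fm7 Fm6 Fm5 Fm4 Fm3 Fm2 Fm1 !update_field //= HR.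
have H8 : pcs m8 N.+1.
  apply: (@pieces_split b N0 n dmax fl ro _ _ _ _ _ _ _ _ _ _ _ _ N K o M H HK HM _ _ _ Hh E0 E1 E2 E3 E4 E5).
  - by lia.
  - by lia.
  - have -> : m (K * 17 + 1) + o = m (M * 17 + 0) by lia.
    exact: Hl.
have NB := pcs_size H8.
have ids j : b <= j < b + N -> (j == b + N) = false by lia.
have lag8 : lag m8 N.+1 = lag m N.
  rewrite /lag -addn1 iotaD big_cat /= big_seq1 E1 E4 eqxx E0 MN.
  have -> : m (K * 17 + 1) + o - m (M * 17 + 0) = 0 by lia.
  rewrite addn0 !big_seq; apply: eq_bigr => j; rewrite mem_ids => Hj.
  rewrite E1 E4 E0 (ids j Hj) ids //.
  by have [] := pcs_dest H Hj.
have rd f k : (k == b + N) = false -> f < 17 ->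
    [/\ m1 (k * 17 + f) = m (k * 17 + f), m2 (k * 17 + f) = m (k * 17 + f),
        m3 (k * 17 + f) = m (k * 17 + f) & m6 (k * 17 + f) = m (k * 17 + f)].
  move=> Hk Hf; rewrite Fm6 Fm5 Fm4 Fm3 Fm2 Fm1.
  by split; rewrite !update_field // ?Hk ?andbF.
rewrite /split_piece.
apply: wp_seq; apply: (@wp_asg _ _ _ _ _ _ _ _ o).
  by rewrite /= EK EM; repeat split=> //; lia.
  by rewrite /= EK EM.
apply: wp_seq; apply: (@wp_sto _ _ _ _ _ _ _ _ ((b + N) * 17 + 0) (m (K * 17 + 0) + o));
  rewrite /= ?ENP ?EK ?EM //; try by (repeat split=> //; lia).
rewrite -Fm1.
apply: wp_seq; apply: (@wp_sto _ _ _ _ _ _ _ _ ((b + N) * 17 + 1) (m (M * 17 + 0)));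
  rewrite /= ?ENP ?EK ?EM //; try by (repeat split=> //; lia).
  by have [-> _ _ _] := rd 0 M MN isT.
rewrite -Fm2.
have [_ E22 E33 _] := rd 2 K KN isT.
have [_ _ E3' _] := rd 3 K KN isT.
apply: wp_seq; apply: (@wp_sto _ _ _ _ _ _ _ _ ((b + N) * 17 + 2) (m (K * 17 + 2) - o));
  rewrite /= ?ENP ?EK ?EM ?E22 //; try by (repeat split=> //; lia).
rewrite -Fm3.
apply: wp_seq; apply: (@wp_sto _ _ _ _ _ _ _ _ ((b + N) * 17 + 3) (m (K * 17 + 3)));
  rewrite /= ?ENP ?EK ?EM ?E3' //; try by (repeat split=> //; lia).
rewrite -Fm4.
apply: wp_seq; apply: (@wp_sto _ _ _ _ _ _ _ _ ((b + N) * 17 + 5) (r vR));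
  rewrite /= ?ENP ?EK ?EM //; try by (repeat split=> //; lia).
rewrite -Fm5.
apply: wp_seq; apply: (@wp_sto _ _ _ _ _ _ _ _ ((b + N) * 17 + 4) M);
  rewrite /= ?ENP ?EK ?EM //; try by (repeat split=> //; lia).
rewrite -Fm6.
apply: wp_seq; apply: (@wp_sto _ _ _ _ _ _ _ _ (K * 17 + 2) o);
  rewrite /= ?ENP ?EK ?EM //; try by (repeat split=> //; lia).
rewrite -Fm7.
apply: wp_seq; apply: (@wp_sto _ _ _ _ _ _ _ _ (K * 17 + 3) (b + N));
  rewrite /= ?ENP ?EK ?EM //; try by (repeat split=> //; lia).
rewrite -Fm8.
apply: wp_seq; apply: (@wp_asg _ _ _ _ _ _ _ _ (b + N)); rewrite /= ?ENP //.
apply: wp_seq; apply: (@wp_asg _ _ _ _ _ _ _ _ (b + N).+1); rewrite /= ?ENP ?addn1 //.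
  by repeat split=> //; lia.
apply: (@wp_asg _ _ _ _ _ _ _ _ 0); rewrite /= //; first by lia.
apply: HQ => //=.
- move=> y; rewrite !inE !negb_or => /and4P[n4 n5 n10 n11]; rewrite /rupd.
  by do 4 (case: PeanoNat.Nat.eqb_spec => [E|_]; first by rewrite E in n4 n5 n10 n11).
- by rewrite addnS.
- by rewrite Fm8 Fm7 Fm6 Fm5 Fm4 Fm3 Fm2 Fm1; do 8 (apply: keep_update => //; try lia).
- by move=> j Hj; rewrite E0 ids.
- by rewrite E1 eqxx; lia.
- by rewrite E1 E2 eqxx; lia.
- by rewrite E5 eqxx.
- by rewrite E0 E2 MN; case: eqP => [->|_]; lia.
- by rewrite /pot lag8; lia.
- lia.
Qed.

Lemma pcs_dest_update m N K M : pcs m N -> b <= K < b + N -> b <= M < b + N ->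
  m (M * 17 + 0) <= m (K * 17 + 1) -> pcs (update m (K * 17 + 4) M) N.
Proof.
move=> H HK HM le; apply: (pieces_ext H) => j Hj; rewrite !update_field //=.
by case: eqP => [->|_] //; apply: (pcs_dest H Hj).
Qed.

Lemma pcs_out m N k : pcs m N -> b <= k < b + N ->
  m (k * 17 + 1) + m (k * 17 + 2) <= n.
Proof.
move=> H Hk; have [d0 pd _] := pcs_range H Hk.
have [E _] := pcs_fl (o := (m (k * 17 + 2)).-1) H Hk ltac:(lia).
have := @fl_lt (m (k * 17 + 0) + (m (k * 17 + 2)).-1); rewrite E; lia.
Qed.

Lemma fl_spec s N (Q : state -> Prop) :
  let m := mm s in let r := rg s in
  r vNP = b + N -> pcs m N -> b <= r vK < b + N -> m (r vK * 17 + 0) <= r vI < n ->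
  (forall c r' m' N', (forall y, y \notin iota 4 8 -> r' y = r y) ->
     r' vNP = b + N' -> pcs m' N' -> N <= N' -> keep m m' ->
     (forall j, b <= j < b + N -> m' (j * 17 + 0) = m (j * 17 + 0)) ->
     b <= r' vK < b + N' ->
     m' (r' vK * 17 + 0) <= r' vI < m' (r' vK * 17 + 0) + m' (r' vK * 17 + 2) ->
     r' vI = fl (r vI) -> r' vR = ro (fl (r vI)) ->
     c + 1000 * pot m' N' <= clk s + 1000 * pot m N +
       1000 * (nstarts m N (m (r vK * 17 + 0)) (r vI)).+1 ->
     Q (State c r' m')) ->
  wp W sp fl_step Q s.
Proof.
case: s => c0 r m /= ENP H HK HI HQ.
rewrite /fl_step; apply: wp_seq; apply: (@walk_spec _ _ _ N (r vI)) => //=.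
  by move=> r' Fr; rewrite Fr.
move=> c1 r1 t1 F1 HK1 HI1 _ Ht1 Hc1.
have EI : r1 vI = r vI by rewrite F1.
have ENP1 : r1 vNP = b + N by rewrite F1.
set K := r1 vK in HK1 HI1 Ht1; move: (erefl K); rewrite {1}/K => EK.
clearbody K.
have [D0 KR KB] := pcs_range H HK1.
have [HC LC] := pcs_dest H HK1.
have QO := pcs_out H HK1.
have [Efl Ero] := pcs_fl (o := r vI - m (K * 17 + 0)) H HK1 ltac:(lia).
rewrite (_ : m (K * 17 + 0) + (r vI - m (K * 17 + 0)) = r vI) in Efl; last by lia.
have NB := pcs_size H.
apply: wp_seq; apply: (@wp_asg _ _ _ _ _ _ _ _ (m (K * 17 + 4))); rewrite /= ?EK //.
  by repeat split=> //; lia.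
apply: wp_seq; apply: (@walk_spec _ _ _ N (m (K * 17 + 1))) => //=.
- move=> r' Fr; rewrite Fr //= EK; split=> //; repeat split=> //; lia.
- lia.
move=> c2 r2 t2 F2 HM2 HI2 Ht2 _ Hc2.
have EK2 : r2 vK = K by rewrite F2.
have EI2 : r2 vI = r vI by rewrite F2.
have ENP2 : r2 vNP = b + N by rewrite F2.
set M := r2 vM in HM2 HI2 Ht2; move: (erefl M); rewrite {1}/M => EM.
clearbody M.
have [M0 MR MB] := pcs_range H HM2.
have Hlag := @lag_update b m N K M HK1 ltac:(lia).
have H1 := pcs_dest_update H HK1 HM2 ltac:(lia).
apply: wp_seq; apply: (@wp_sto _ _ _ _ _ _ _ _ (K * 17 + 4) M);
  rewrite /= ?EK2 ?EM //; try by (repeat split=> //; lia).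
set m1 := update m _ _ in Hlag H1 *.
have Em1 j g : g < 17 -> g != 4 -> m1 (j * 17 + g) = m (j * 17 + g).
  by move=> g17 g4; rewrite /m1 update_field // (negbTE g4).
have K1 : keep m m1 by apply: keep_update => //; lia.
clearbody m1.
apply: wp_seq; apply: (@wp_asg _ _ _ _ _ _ _ _ (fl (r vI))); rewrite /= ?EK2 ?EI2 ?Em1 ?Efl //.
  by repeat split=> //; lia.
apply: wp_seq; apply: (@wp_asg _ _ _ _ _ _ _ _ (ro (fl (r vI)))); rewrite /= ?EK2 ?EI2 ?Em1 //.
  by repeat split=> //; lia.
  by rewrite Efl Ero.
apply: wp_seq; apply: (@wp_asg _ _ _ _ _ _ _ _ 0); rewrite /= //; first by lia.
set c3 := (X in State X).
set xx := fl (r vI) in Efl HQ *.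
pose cb := c0 + 1000 * pot m N +
  1000 * (nstarts m N (m (r vK * 17 + 0)) (r vI)) + 400.
apply: wp_seq.
pose I k s1 := exists N1,
  let m2 := mm s1 in let K2 := rg s1 vK in let M2 := rg s1 vM in
  [/\ [/\ k = n - m2 (M2 * 17 + 0), rg s1 vNP = b + N1, pcs m2 N1 & N <= N1],
      [/\ forall y, y \notin iota 4 8 -> rg s1 y = r y, keep m m2 &
       forall j, b <= j < b + N -> m2 (j * 17 + 0) = m (j * 17 + 0)],
      [/\ b <= K2 < b + N1, b <= M2 < b + N1, rg s1 vX = xx & rg s1 vR = ro xx],
      [/\ m2 (M2 * 17 + 0) <= xx, m2 (K2 * 17 + 1) <= xx < m2 (K2 * 17 + 1) + m2 (K2 * 17 + 2),
          m2 (K2 * 17 + 1) < m2 (M2 * 17 + 0) + m2 (M2 * 17 + 2)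
         & m2 (K2 * 17 + 5) = ro xx] &
      [/\ rg s1 vC <= 3, rg s1 vC <= nstarts m2 N1 (m2 (K2 * 17 + 1)) (m2 (M2 * 17 + 0)) &
       clk s1 + 1000 * pot m2 N1 <= cb + 100 * rg s1 vC]].
apply: (@wp_while _ _ _ _ _ _ I (n - m1 (M * 17 + 0))).
  exists N; rewrite /= EM EK2 ENP2 !Em1 //; split; split=> //.
  - move=> y Hy; have ne c := notin_neq (c := c) Hy.
    by rewrite !rupd_neq ?ne // F2 ?ne // rupd_neq ?ne // F1 ?ne.
  - by move=> j Hj; rewrite Em1.
  - by lia.
  - by lia.
  - by lia.
  - by rewrite Efl.
  - have hs : nstarts m N (m (r vK * 17 + 0)) (m (K * 17 + 0)) <=
              nstarts m N (m (r vK * 17 + 0)) (r vI).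
      by apply: leq_nstarts; lia.
    rewrite /cb /c3 /pot; lia.
move=> k c r3 m3 [N1 /= [[-> ENP3 H3 leN] [F3 K3 P3] [HK3 HM3 EX3 ER3] [LM LK LKM EN3] [C3 S3 T3]]].
have [KD3 KR3 KB3] := pcs_range H3 HK3.
have [MD3 MR3 MB3] := pcs_range H3 HM3.
have KO3 := pcs_out H3 HK3.
split.
- by repeat split=> //; lia.
- rewrite EX3 => Hlt.
  apply: wp_seq.
  have tail c4 r4 m4 N4 : N1 <= N4 -> r4 vNP = b + N4 -> pcs m4 N4 ->
      (forall y, y \notin iota 4 8 -> r4 y = r y) -> keep m m4 ->
      (forall j, b <= j < b + N1 -> m4 (j * 17 + 0) = m3 (j * 17 + 0)) ->
      b <= r4 vK < b + N4 -> r4 vM = r3 vM -> r4 vX = xx -> r4 vR = ro xx ->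
      m4 (r3 vM * 17 + 0) + m4 (r3 vM * 17 + 2) <= xx ->
      m4 (r4 vK * 17 + 1) <= xx < m4 (r4 vK * 17 + 1) + m4 (r4 vK * 17 + 2) ->
      m4 (r4 vK * 17 + 1) < m4 (r3 vM * 17 + 0) + m4 (r3 vM * 17 + 2) ->
      m4 (r4 vK * 17 + 5) = ro xx -> r4 vC <= 2 ->
      r4 vC <= nstarts m4 N4 (m4 (r4 vK * 17 + 1)) (m4 (r3 vM * 17 + 0)) ->
      c4 + 1000 * pot m4 N4 + 20 <= cb + 100 * r4 vC + 100 ->
      wp W sp (Asg vM (get fNX vM) ;; Asg vC (EV vC +' EC 1))
        (fun s2 => exists2 n', n' < n - m3 (r3 vM * 17 + 0) &
           I n' (State (clk s2 + 1) (rg s2) (mm s2)))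
        (State c4 r4 m4).
    move=> leN4 ENP4 H4 F4 K4 P4 HK4 EM4 EX4 ER4 LM4 LK4 LKM4 EN4 C4 S4 T4.
    have HM4 : b <= r3 vM < b + N4 by lia.
    have [MD4 MR4 MB4] := pcs_range H4 HM4.
    have [HX EX] := pcs_next H4 HM4 ltac:(lia).
    apply: wp_seq; apply: (@wp_asg _ _ _ _ _ _ _ _ (m4 (r3 vM * 17 + 3))); rewrite /= ?EM4 //.
      by repeat split=> //; lia.
    apply: wp_asg => /=; [by repeat split=> //; lia|by []|].
    exists (n - m4 (m4 (r3 vM * 17 + 3) * 17 + 0)).
      by rewrite EX /= P4 //; lia.
    exists N4; rewrite /=; split; split=> //.
    - by lia.
    - move=> y Hy; rewrite /rupd;
        do 2 (case: PeanoNat.Nat.eqb_spec => [E|_]; first by rewrite E in Hy).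
      exact: F4.
    - by move=> j Hj; rewrite P4 ?P3 //; lia.
    - by rewrite EX.
    - have [? _ _] := pcs_range H4 HX; rewrite EX; lia.
    - by lia.
    - rewrite addn1; apply: leq_ltn_trans S4 _.
      apply: (@starts_next b (fun k => m4 (k * 17 + 0)) N4 _ (r3 vM)) => //; lia.
    - lia.
  apply: wp_if => /=.
  + by repeat split=> //; lia.
  + move=> HC3; apply: (@split_spec _ N1 (r3 vK) (r3 vM)) => //=.
    * by lia.
    * by apply: leq_trans S3; lia.
    * by rewrite ER3.
    move=> c4 r4 m4 F4 ENP4 EK4 EC4 H4 K4 P4 EQ4 EE4 ER4 LM4 T4 Hc4.
    apply: (tail _ _ _ N1.+1) => //; rewrite ?EK4 ?EC4 ?EQ4 //.
    * move=> y Hy; rewrite F4 ?F3 //; apply: contra Hy.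
      by rewrite !inE => /or4P[] /eqP ->.
    * exact: keep_trans K3 K4.
    * by lia.
    * by rewrite F4.
    * by rewrite F4 // EX3.
    * by rewrite F4 // ER3.
    * by lia.
    * by rewrite -EQ4 EE4; lia.
    * have HM4 : b <= r3 vM < b + N1.+1 by lia.
      have [? _ _] := pcs_range H4 HM4.
      by rewrite -P4 //; lia.
    * by rewrite ER4 ER3.
    * lia.
  + move=> HC3; apply: wp_skip; apply: (tail _ _ _ N1) => //; lia.
- rewrite EX3 => Hge.
  apply: wp_seq; apply: (@wp_asg _ _ _ _ _ _ _ _ (r3 vM)) => //=.
  apply: (@wp_asg _ _ _ _ _ _ _ _ xx) => //=.
  apply: (HQ _ _ _ N1) => //=.
  + move=> y Hy; rewrite /rupd;
      do 2 (case: PeanoNat.Nat.eqb_spec => [E|_]; first by rewrite E in Hy).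
    exact: F3.
  + by lia.
  + move: T3; rewrite /cb; lia.
Qed.

End Step.

(** * Suffix array, BWT and PLCP *)

Section Lexicographic.

Import Order.TTheory.

Lemma lexi_consE (x y : nat) (X Y : seqlexi nat) :
  ((x :: X : seqlexi nat) <= (y :: Y : seqlexi nat))%O =
  (x < y) || ((x == y) && (X <= Y)%O).
Proof.
rewrite lexi_cons !leEnat; case: ltngtP => //= _.
Qed.

Lemma lcp_mid (X Y Z : seqlexi nat) :
  (X <= Y)%O -> (Y <= Z)%O -> lcp X Z <= lcp Y Z.
Proof.
elim: X Y Z => [|x X IH] [|y Y] [|z Z] //=; rewrite ?lexi_consE.
case: (ltngtP x y) => //= xy; case: (ltngtP y z) => //= yz XY YZ.
- by case: eqP => //; lia.
- by case: eqP => //; lia.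
- by case: eqP => //; lia.
- by rewrite xy yz eqxx ltnS; apply: IH.
Qed.

End Lexicographic.

Section Text.

Import Order.TTheory.

Variable T : seq nat.
Hypothesis termT : terminated T.

Let n := size T.

Lemma term_size : 0 < n.
Proof. by case: termT => s [d [E _]]; rewrite /n E size_rcons. Qed.

Lemma term_last j : j < n.-1 -> nth 0 T n.-1 < nth 0 T j.
Proof.
case: termT => s [d [E /allP H]]; rewrite /n E size_rcons /= => lt.
by rewrite !nth_rcons ltnn eqxx lt; apply: H; apply: mem_nth.
Qed.

Lemma suffix_le_total : total (suffix_le T).
Proof. by move=> i j; rewrite /suffix_le le_total. Qed.

Lemma suffix_le_trans : transitive (suffix_le T).
Proof. by move=> i j k; apply: le_trans. Qed.

Lemma suffix_le_anti i j : i < n -> j < n ->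
  suffix_le T i j -> suffix_le T j i -> i = j.
Proof.
move=> Hi Hj le1 le2.
have : size (drop i T) = size (drop j T).
  by congr size; apply: (@le_anti _ (seqlexi nat)); rewrite [X in X && _]le1.
by rewrite !size_drop -/n; lia.
Qed.

Lemma perm_SA : perm_eq (SA T) (iota 0 n).
Proof. by rewrite perm_sort. Qed.

Lemma size_SA : size (SA T) = n.
Proof. by rewrite (perm_size perm_SA) size_iota. Qed.

Lemma uniq_SA : uniq (SA T).
Proof. by rewrite (perm_uniq perm_SA) iota_uniq. Qed.

Lemma mem_SA j : (j \in SA T) = (j < n).
Proof. by rewrite (perm_mem perm_SA) mem_iota. Qed.

Lemma SA_lt i : i < n -> nth 0 (SA T) i < n.
Proof. by move=> Hi; rewrite -mem_SA mem_nth ?size_SA. Qed.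

Lemma ISA_lt j : j < n -> ISA T j < n.
Proof. by rewrite -mem_SA -index_mem size_SA. Qed.

Lemma SA_ISA j : j < n -> nth 0 (SA T) (ISA T j) = j.
Proof. by rewrite -mem_SA; apply: nth_index. Qed.

Lemma ISA_SA i : i < n -> ISA T (nth 0 (SA T) i) = i.
Proof. by move=> Hi; rewrite /ISA index_uniq ?size_SA ?uniq_SA. Qed.

Lemma ISA_inj i j : i < n -> j < n -> ISA T i = ISA T j -> i = j.
Proof. by move=> Hi Hj E; rewrite -(SA_ISA Hi) E SA_ISA. Qed.

Lemma SA_sorted i j : i <= j < n ->
  suffix_le T (nth 0 (SA T) i) (nth 0 (SA T) j).
Proof.
move=> /andP[le lt].
apply: (sorted_leq_nth suffix_le_trans _ 0 (sort_sorted suffix_le_total _)) => //.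
- by move=> x; apply: lexx.
- by rewrite inE size_SA; lia.
- by rewrite inE size_SA; lia.
Qed.

Lemma ISA_ltE i j : i < n -> j < n ->
  (ISA T i < ISA T j) = ~~ suffix_le T j i.
Proof.
move=> Hi Hj; case: ltnP => le.
  apply/esym/negP => h.
  have h' := @SA_sorted (ISA T i) (ISA T j).
  rewrite (SA_ISA Hi) (SA_ISA Hj) in h'.
  have E : i = j by apply: suffix_le_anti => //; apply: h'; rewrite (ltnW le) ISA_lt.
  by rewrite E ltnn in le.
have h' := @SA_sorted (ISA T j) (ISA T i).
by rewrite (SA_ISA Hi) (SA_ISA Hj) in h'; rewrite h' // le ISA_lt.
Qed.

Lemma suffix_leS i j : i < n -> j < n ->
  suffix_le T i j = (nth 0 T i < nth 0 T j) ||
                    ((nth 0 T i == nth 0 T j) && suffix_le T i.+1 j.+1).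
Proof. by move=> Hi Hj; rewrite /suffix_le (drop_nth 0 Hi) (drop_nth 0 Hj) lexi_consE. Qed.

Lemma char_eq_lt i j : i < n -> j < n -> i != j -> nth 0 T i = nth 0 T j ->
  i.+1 < n /\ j.+1 < n.
Proof.
move=> Hi Hj ij E.
have [Ei|Hi'] := eqVneq i n.-1.
  by have := @term_last j ltac:(lia); rewrite -E Ei ltnn.
have [Ej|Hj'] := eqVneq j n.-1.
  by have := @term_last i ltac:(lia); rewrite E Ej ltnn.
lia.
Qed.

Definition fl (i : nat) : nat := ISA T ((nth 0 (SA T) i).+1 %% n).

Lemma fl_lt i : fl i < n.
Proof. by apply: ISA_lt; rewrite ltn_pmod ?term_size. Qed.

Lemma fl_ISA j : j < n -> fl (ISA T j) = ISA T (j.+1 %% n).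
Proof. by move=> Hj; rewrite /fl SA_ISA. Qed.

Lemma modS_inj i j : i < n -> j < n -> i.+1 %% n = j.+1 %% n -> i = j.
Proof.
have modE k : k < n -> k.+1 %% n = if k.+1 == n then 0 else k.+1.
  by move=> Hk; case: eqP => [->|/eqP ne]; [rewrite modnn|rewrite modn_small //; lia].
by move=> Hi Hj; rewrite !modE //; case: eqP; case: eqP; lia.
Qed.

Lemma fl_inj i j : i < n -> j < n -> fl i = fl j -> i = j.
Proof.
move=> Hi Hj /ISA_inj E.
have {}E := E (ltn_pmod _ term_size) (ltn_pmod _ term_size).
have := modS_inj (SA_lt Hi) (SA_lt Hj) E.
by move=> /(congr1 (ISA T)); rewrite !ISA_SA.
Qed.

Lemma BWT_ISA j : j < n -> nth 0 (BWT T) (ISA T (j.+1 %% n)) = nth 0 T j.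
Proof.
move=> Hj; have n0 := term_size.
have lt := ltn_pmod j.+1 n0.
rewrite (nth_map 0) ?size_SA ?ISA_lt // SA_ISA //; congr (nth 0 T _).
rewrite modnDml; have -> : j.+1 + (size T).-1 = j + n by rewrite -/n; lia.
by rewrite modnDr modn_small.
Qed.

Lemma BWT_fl i : i < n -> nth 0 (BWT T) (fl i) = nth 0 T (nth 0 (SA T) i).
Proof. by move=> Hi; rewrite /fl BWT_ISA ?SA_lt. Qed.

Definition bwt_lt (i j : nat) : bool :=
  (nth 0 (BWT T) i < nth 0 (BWT T) j) ||
  ((nth 0 (BWT T) i == nth 0 (BWT T) j) && (i < j)).

Lemma fl_bwt_lt i j : i < j < n -> bwt_lt (fl i) (fl j).
Proof.
move=> /andP[ij Hj]; have Hi := ltn_trans ij Hj.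
rewrite /bwt_lt !BWT_fl //.
have Hi' := SA_lt Hi; have Hj' := SA_lt Hj.
have : ~~ suffix_le T (nth 0 (SA T) j) (nth 0 (SA T) i) by rewrite -ISA_ltE ?ISA_SA.
rewrite suffix_leS // /fl.
case: ltngtP => //= E h.
have [] := @char_eq_lt (nth 0 (SA T) i) (nth 0 (SA T) j) Hi' Hj' _ (esym E).
  by apply/eqP => /(congr1 (ISA T)); rewrite !ISA_SA //; lia.
by move=> h1 h2; rewrite !modn_small // ISA_ltE.
Qed.

Lemma bwt_lt_trans : transitive bwt_lt.
Proof. by move=> i j k; rewrite /bwt_lt; lia. Qed.

Lemma bwt_lt_irr : irreflexive bwt_lt.
Proof. by move=> i; rewrite /bwt_lt; lia. Qed.

Lemma fl_listE G : sorted bwt_lt G -> G =i iota 0 n -> G = [seq fl i | i <- iota 0 n].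
Proof.
move=> sG mG; apply: (irr_sorted_eq bwt_lt_trans bwt_lt_irr) => //.
  rewrite sorted_map.
  apply: (@sub_in_sorted _ (fun x => x < n) ltn) (iota_ltn_sorted 0 n).
    by move=> i j _ Hj ij /=; apply: fl_bwt_lt; apply/andP.
  by apply/allP => i; rewrite mem_iota.
move=> y; rewrite mG mem_iota /=; apply/idP/mapP => [Hy|[i _ ->]]; last exact: fl_lt.
have n0 := term_size.
have Hj := SA_lt Hy.
exists (ISA T ((nth 0 (SA T) y + n.-1) %% n)).
  by rewrite mem_iota /= ISA_lt // ltn_pmod.
rewrite fl_ISA ?ltn_pmod // -addn1 modnDml -addnA.
have -> : n.-1 + 1 = n by lia.
by rewrite modnDr modn_small // ISA_SA.
Qed.

Let rs := run_starts T.

Definition rsn (k : nat) : nat := nth n rs k.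

Lemma rs_sorted : sorted ltn rs.
Proof. by apply: sorted_filter (iota_ltn_sorted 0 n); apply: ltn_trans. Qed.

Lemma mem_rs i : (i \in rs) = run_start T i && (i < n).
Proof. by rewrite mem_filter mem_iota. Qed.

Lemma rsn_mono k l : k < l < nruns T -> rsn k < rsn l.
Proof.
move=> /andP[kl lR]; apply: (sorted_ltn_nth ltn_trans _ rs_sorted) => //.
by rewrite inE (ltn_trans kl).
Qed.

Lemma rsn_lt k : k < nruns T -> rsn k < n.
Proof. by move=> Hk; have := mem_nth n Hk; rewrite mem_rs => /andP[]. Qed.

Lemma rsn_end k : nruns T <= k -> rsn k = n.
Proof. by move=> Hk; rewrite /rsn nth_default. Qed.

Lemma rsn_next k : k < nruns T -> rsn k < rsn k.+1.
Proof.
move=> Hk; case: (ltnP k.+1 (nruns T)) => h; first by apply: rsn_mono; rewrite ltnSn.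
by rewrite (rsn_end h) rsn_lt.
Qed.

Lemma rsn_le k l : k <= l -> rsn k <= rsn l.
Proof.
elim: l => [|l IH]; first by case: k.
rewrite leq_eqVlt => /orP[/eqP -> //|kl]; apply: leq_trans (IH kl) _.
case: (ltnP l (nruns T)) => h; first exact: ltnW (rsn_next h).
by rewrite !rsn_end // ltnW.
Qed.

Lemma rs_index i : i \in rs -> exists2 k, k < nruns T & rsn k = i.
Proof. by move=> Hi; exists (index i rs); rewrite ?index_mem // /rsn nth_index. Qed.

Lemma nruns_gt0 : 0 < nruns T.
Proof.
have : 0 \in rs by rewrite mem_rs term_size.
by rewrite /nruns -/rs; case: rs.
Qed.

Lemma rsn0 : rsn 0 = 0.
Proof.
have [k _ E] := @rs_index 0 ltac:(by rewrite mem_rs term_size).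
by have := @rsn_le 0 k (leq0n k); rewrite E leqn0 => /eqP.
Qed.

Lemma nruns_le : nruns T <= n.
Proof. by rewrite /nruns /run_starts size_filter -[leqRHS](size_iota 0) count_size. Qed.

Lemma run_exists i : i < n -> exists2 k, k < nruns T & rsn k <= i < rsn k.+1.
Proof.
move=> Hi.
have ex : exists k, rsn k <= i by exists 0; rewrite rsn0.
have bd k : rsn k <= i -> k <= nruns T.
  by move=> h; rewrite leqNgt; apply/negP => h'; rewrite rsn_end ?(ltnW h') // in h; lia.
case: (ex_maxnP ex bd) => k h1 h2.
exists k; first by rewrite ltnNge; apply/negP => h; rewrite rsn_end in h1; lia.
rewrite h1 ltnNge; apply/negP => /h2; lia.
Qed.

Lemma run_uniq i k l : rsn k <= i < rsn k.+1 -> rsn l <= i < rsn l.+1 -> k = l.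
Proof.
move=> hk hl; case: (ltngtP k l) => // h; have := rsn_le h; lia.
Qed.

Lemma run_startE i k : k < nruns T -> rsn k <= i < rsn k.+1 ->
  run_start T i = (i == rsn k).
Proof.
move=> Hk Hi.
have lt : i < n by have := rsn_le Hk; rewrite (rsn_end (leqnn _)); lia.
have : (i \in rs) = run_start T i by rewrite mem_rs lt andbT.
move=> <-; apply/idP/eqP => [/rs_index [l Hl E]|->]; last exact: mem_nth.
have := rsn_next Hl; rewrite E => h.
have := @run_uniq i l k; rewrite E leqnn h => /(_ isT Hi) El.
by rewrite -E El.
Qed.

Lemma BWT_run i k : k < nruns T -> rsn k <= i < rsn k.+1 ->
  nth 0 (BWT T) i = nth 0 (BWT T) (rsn k).
Proof.
move=> Hk; elim: i => [|i IH] Hi.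
  by have -> : rsn k = 0 by lia.
case: (eqVneq (rsn k) i.+1) => [-> //|ne].
have := run_startE Hk Hi; rewrite eq_sym (negbTE ne) /run_start /=.
move/negbFE/eqP => <-; apply: IH; lia.
Qed.

Definition run_of (i : nat) : nat :=
  find (fun k => rsn k <= i < rsn k.+1) (iota 0 (nruns T)).

Lemma run_ofE i k : k < nruns T -> rsn k <= i < rsn k.+1 -> run_of i = k.
Proof.
move=> Hk Hi.
have h : has (fun k => rsn k <= i < rsn k.+1) (iota 0 (nruns T)).
  by apply/hasP; exists k; rewrite // mem_iota.
have := nth_find 0 h; rewrite -/(run_of i).
have lt : run_of i < nruns T by rewrite -[ltnRHS](size_iota 0) -has_find.
by rewrite nth_iota // => h'; apply: run_uniq h' Hi.
Qed.

Definition run_len (k : nat) : nat := rsn k.+1 - rsn k.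

Definition run_lt (k l : nat) : bool :=
  (nth 0 (BWT T) (rsn k) < nth 0 (BWT T) (rsn l)) ||
  ((nth 0 (BWT T) (rsn k) == nth 0 (BWT T) (rsn l)) && (k < l)).

Lemma mem_run i k : (i \in iota (rsn k) (run_len k)) = (rsn k <= i < rsn k.+1).
Proof.
rewrite mem_iota /run_len; case: (leqP (rsn k) i) => //= h.
by have := rsn_le (leqnSn k); lia.
Qed.

(* Concatenating the runs in the order (character, position) lists the BWT
   positions in the order of the suffixes that follow their characters. *)
Lemma fl_runs L : perm_eq L (iota 0 (nruns T)) -> pairwise run_lt L ->
  flatten [seq iota (rsn k) (run_len k) | k <- L] = [seq fl i | i <- iota 0 n].
Proof.
move=> pL sL; apply: fl_listE.
  rewrite sorted_pairwise; last exact: bwt_lt_trans.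
  have : all (fun k => k < nruns T) L.
    by apply/allP => k; rewrite (perm_mem pL) mem_iota.
  elim: L sL {pL} => //= k L IH /andP[kL sL] /andP[Hk HL].
  rewrite pairwise_cat IH // andbT; apply/andP; split.
    apply/allrelP => i j; rewrite mem_run => Hi /flattenP [s /mapP [l lL ->]].
    rewrite mem_run => Hj.
    have Hl := allP HL _ lL; have := allP kL _ lL.
    rewrite /run_lt /bwt_lt (BWT_run Hk Hi) (BWT_run Hl Hj) => /orP[-> //|/andP[-> kl]].
    by rewrite /=; have := rsn_le kl; lia.
  rewrite -sorted_pairwise; last exact: bwt_lt_trans.
  apply: (@sub_in_sorted _ (fun x => rsn k <= x < rsn k.+1) ltn) (iota_ltn_sorted _ _).
    move=> i j Hi Hj ij; rewrite /bwt_lt (BWT_run Hk Hi) (BWT_run Hk Hj) eqxx.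
    by rewrite ltnn.
  by apply/allP => i; rewrite mem_run.
move=> i; rewrite mem_iota /=; apply/flattenP/idP => [[s /mapP [k kL ->]]|Hi].
  rewrite mem_run; move: kL; rewrite (perm_mem pL) mem_iota /= => Hk.
  by have := rsn_le Hk; rewrite (rsn_end (leqnn _)); lia.
have [k Hk h] := run_exists Hi.
exists (iota (rsn k) (run_len k)); last by rewrite mem_run.
by apply: map_f; rewrite (perm_mem pL) mem_iota.
Qed.

Lemma size_runs L : size (flatten [seq iota (rsn k) (run_len k) | k <- L]) =
  sumn [seq run_len k | k <- L].
Proof.
by elim: L => //= k L IH; rewrite size_cat size_iota IH.
Qed.

Lemma fl_run L1 k L2 o : perm_eq (L1 ++ k :: L2) (iota 0 (nruns T)) ->
  pairwise run_lt (L1 ++ k :: L2) -> o < run_len k ->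
  fl (sumn [seq run_len l | l <- L1] + o) = rsn k + o.
Proof.
move=> pL sL Ho; have E := fl_runs pL sL.
have := congr1 (fun s => nth 0 s (sumn [seq run_len l | l <- L1] + o)) E.
have := congr1 size E; rewrite size_map size_iota size_runs map_cat sumn_cat /= => Hn.
rewrite map_cat flatten_cat nth_cat size_runs ltnNge leq_addr /= addKn.
rewrite nth_cat size_iota Ho nth_iota // => ->.
by rewrite (nth_map 0) ?size_iota ?nth_iota //; lia.
Qed.

Lemma ISA_last : ISA T n.-1 = 0.
Proof.
have n0 := term_size.
case E: (ISA T n.-1) => [|i] //.
have h : ISA T (nth 0 (SA T) 0) < ISA T n.-1 by rewrite ISA_SA ?E.
have h0 := SA_lt n0.
have ne : nth 0 (SA T) 0 <> n.-1 by move=> E'; rewrite E' ltnn in h.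
move: h; rewrite ISA_ltE //; last by lia.
by rewrite suffix_leS ?term_last //; lia.
Qed.

Lemma PLCP_last : PLCP T n.-1 = 0.
Proof. by rewrite /PLCP ISA_last. Qed.

Definition phi (j : nat) : nat := nth 0 (SA T) (ISA T j).-1.

Lemma phi_lt j : j < n -> phi j < n.
Proof. by move=> Hj; apply: SA_lt; have := ISA_lt Hj; lia. Qed.

Lemma PLCPE j : j < n.-1 -> PLCP T j = lcp (drop (phi j) T) (drop j T).
Proof.
move=> Hj; have Hj' : j < n by lia.
rewrite /PLCP /LCP SA_ISA // -/(phi j); case: eqP => // E.
have : j = n.-1 by apply: ISA_inj => //; [lia|rewrite E ISA_last].
lia.
Qed.

Lemma ISA_gt0 j : j < n.-1 -> 0 < ISA T j.
Proof.
move=> Hj; rewrite lt0n; apply/eqP => E.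
have : j = n.-1 by apply: ISA_inj; [lia|lia|rewrite E ISA_last].
lia.
Qed.

Lemma phi_neq j : j < n.-1 -> phi j != j.
Proof.
move=> Hj; apply/eqP => E; have H0 := ISA_gt0 Hj.
have Hj' : j < n by lia.
have := ISA_lt Hj' => h.
by have := @ISA_SA (ISA T j).-1 ltac:(lia); rewrite -/(phi j) E; lia.
Qed.

Lemma lcp_testE a b l : a < n -> b < n -> a != b ->
  l <= lcp (drop a T) (drop b T) ->
  [/\ a + l < n, b + l < n &
      (nth 0 T (a + l) == nth 0 T (b + l)) = (l < lcp (drop a T) (drop b T))].
Proof.
elim: l a b => [|l IH] a b Ha Hb ab.
  by rewrite !addn0 (drop_nth 0 Ha) (drop_nth 0 Hb) /=; case: eqP.
rewrite (drop_nth 0 Ha) (drop_nth 0 Hb) /=; case: eqP => // E; rewrite !ltnS => h.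
have [Ha' Hb'] := char_eq_lt Ha Hb ab E.
by rewrite -!addSnnS; apply: IH.
Qed.

Lemma PLCP_succ j : j.+1 < n -> PLCP T j <= (PLCP T j.+1).+1.
Proof.
move=> Hj; rewrite PLCPE; last by lia.
have Hj' : j < n by lia.
have Hj1 : j < n.-1 by lia.
have Hp := phi_lt Hj'; have pj := phi_neq Hj1.
rewrite (drop_nth 0 Hp) (drop_nth 0 Hj') /=; case: eqP => // E; rewrite ltnS.
have [Hp1 Hj1'] := char_eq_lt Hp Hj' pj E.
have lt1 : ISA T (phi j) < ISA T j.
  rewrite ISA_SA; first by have := ISA_gt0 Hj1; lia.
  by have := ISA_lt Hj'; lia.
have lt2 : ISA T (phi j).+1 < ISA T j.+1.
  rewrite ISA_ltE //; move: lt1; rewrite ISA_ltE // suffix_leS // E ltnn eqxx /=.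
  by [].
have H1 := ISA_lt Hj1'; have H2 := ISA_lt Hp1.
rewrite /PLCP /LCP; case: eqP => [E0|_]; first by rewrite E0 in lt2.
rewrite (SA_ISA Hj1').
have A1 := @SA_sorted (ISA T (phi j).+1) (ISA T j.+1).-1 ltac:(lia).
have A2 := @SA_sorted (ISA T j.+1).-1 (ISA T j.+1) ltac:(lia).
rewrite (SA_ISA Hp1) in A1; rewrite (SA_ISA Hj1') in A2.
exact: lcp_mid A1 A2.
Qed.

Lemma PLCP_shift j k : j + k < n -> PLCP T j <= PLCP T (j + k) + k.
Proof.
elim: k => [|k IH] H; first by rewrite !addn0.
apply: leq_trans (IH _) _; first by lia.
have := @PLCP_succ (j + k) ltac:(lia); rewrite -addnS; lia.
Qed.

Definition irr : seq nat := [seq j <- iota 0 n | run_start T (ISA T j)].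

Lemma PLCPplusE : PLCPplus T = [seq PLCP T j | j <- irr].
Proof.
congr map; apply: (sorted_eq leq_trans anti_leq).
- exact: (sort_sorted leq_total).
- by apply: sorted_filter (iota_sorted 0 n); apply: leq_trans.
rewrite perm_sort; apply: uniq_perm.
- rewrite map_inj_in_uniq ?filter_uniq ?iota_uniq // => x y.
  rewrite -/rs !mem_rs => /andP[_ Hx] /andP[_ Hy] /(congr1 (ISA T)).
  by rewrite !ISA_SA.
- by rewrite filter_uniq ?iota_uniq.
move=> j; rewrite mem_filter mem_iota /=; apply/mapP/andP => [[i]|[H Hj]].
  by rewrite -/rs mem_rs => /andP[Hi Hn] ->; rewrite ISA_SA ?SA_lt.
by exists (ISA T j); rewrite ?SA_ISA // -/rs mem_rs H ISA_lt.
Qed.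

Lemma size_irr : size irr = nruns T.
Proof.
by rewrite -(size_map (PLCP T)) -PLCPplusE size_map size_sort size_map.
Qed.

End Text.

Notation "a *' c" := (EB OpMul a c) (at level 40, left associativity).
Notation "a /' c" := (EB OpDiv a c) (at level 40, left associativity).
Notation "a %' c" := (EB OpMod a c) (at level 40, left associativity).

(** * Reading the input *)

(* Run records: start in the BWT, character, text position preceding the start in
   the suffix array, radix sort key and link. Records [r + 1 + i] also hold bucket
   [i], the run and position of the [i]-th irreducible value, the text sample at
   [i * blk], and the piece that starts at rank [i * blk]. *)
Notation fRS := 6 (only parsing).
Notation fCH := 7 (only parsing).
Notation fPHI := 8 (only parsing).
Notation fKEY := 9 (only parsing).
Notation fLN := 10 (only parsing).
Notation fBK := 11 (only parsing).
Notation fIR := 12 (only parsing).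
Notation fIJ := 13 (only parsing).
Notation fSK := 14 (only parsing).
Notation fSI := 15 (only parsing).
Notation fBL := 16 (only parsing).

Notation vRn := 0 (only parsing).
Notation vB := 1 (only parsing).
Notation vN := 2 (only parsing).
Notation vBk := 3 (only parsing).
Notation vJ := 12 (only parsing).
Notation vOut := 13 (only parsing).
Notation vEN := 14 (only parsing).
Notation vL := 15 (only parsing).
Notation vK1 := 16 (only parsing).
Notation vI1 := 17 (only parsing).
Notation vK2 := 18 (only parsing).
Notation vI2 := 19 (only parsing).
Notation vR1 := 20 (only parsing).
Notation vGO := 21 (only parsing).
Notation vU := 22 (only parsing).
Notation vLST := 23 (only parsing).
Notation vMX := 24 (only parsing).
Notation vDD := 25 (only parsing).
Notation vPP := 26 (only parsing).
Notation vQQ := 27 (only parsing).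
Notation vEE := 28 (only parsing).
Notation vIR := 29 (only parsing).
Notation vT := 30 (only parsing).

Ltac wsafe := by rewrite /=; repeat split=> //; lia.
Ltac wasg v := apply: wp_seq; apply: (@wp_asg _ _ _ _ _ _ _ _ v); rewrite /=.
Ltac wsto a v := apply: wp_seq; apply: (@wp_sto _ _ _ _ _ _ _ _ a v); rewrite /=.

Definition read_runs : cmd :=
  Asg vRn (EM (EC 0)) ;;
  Asg vB (EV vRn +' EC 1) ;;
  Asg vN (EC 0) ;;
  Asg vMX (EC 0) ;;
  Asg vJ (EC 0) ;;
  While (EV vJ <' EV vRn)
    (Asg vT (EV vB +' EV vJ) ;;
     Asg vL (EM (EC 1 +' EC 2 *' EV vJ)) ;;
     put fCH vT (EV vL) ;;
     put fKEY vT (EV vL) ;;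
     put fRS vT (EV vN) ;;
     put fLN vT ((EV vT +' EC 1) *' (EV vJ +' EC 1 <' EV vRn)) ;;
     Asg vN (EV vN +' EM (EC 2 +' EC 2 *' EV vJ)) ;;
     If (EV vMX <' EV vL) (Asg vMX (EV vL)) Skip ;;
     Asg vJ (EV vJ +' EC 1)) ;;
  Asg vT (EV vB +' EV vRn) ;;
  put fRS vT (EV vN) ;;
  Asg vBk (EV vN /' EV vRn +' EC 1) ;;
  Asg vLST (EV vB).

Lemma nth_flatten_pairs (R : seq (nat * nat)) k :
  nth 0 (flatten [seq [:: x.1; x.2] | x <- R]) (2 * k) = (nth (0, 0) R k).1 /\
  nth 0 (flatten [seq [:: x.1; x.2] | x <- R]) (2 * k).+1 = (nth (0, 0) R k).2.
Proof.
elim: R k => [|x R IH] k; first by rewrite !nth_nil.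
case: k => [|k]; first by [].
have -> : 2 * k.+1 = (2 * k).+2 by lia.
exact: IH.
Qed.

Section Read.

Variables (T : seq nat) (W : nat).
Hypothesis termT : terminated T.

Let n := size T.
Let r := nruns T.
Let b := r.+1.
Let sp := 136 * r.

Hypothesis W_ge : sp + 2 * n + 100 <= W.
Hypothesis T_small : all (fun c => c < W) T.

Definition rchar (k : nat) : nat := nth 0 (BWT T) (rsn T k).

Lemma rchar_lt k : rchar k < W.
Proof.
rewrite /rchar; have [lt|ge] := ltnP (rsn T k) (size (BWT T)); last first.
  by rewrite nth_default //; lia.
rewrite (nth_map 0); last by rewrite size_map in lt.
apply: (allP T_small); apply: mem_nth; rewrite ltn_pmod //; exact: term_size.
Qed.

Definition input := nth 0 (encode_RLBWT (RLBWT T)).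

Lemma input0 : input 0 = r.
Proof. by rewrite /input /= size_mkseq. Qed.

Lemma input_char k : k < r -> input (1 + 2 * k) = rchar k.
Proof.
move=> Hk; rewrite /input /encode_RLBWT add1n [LHS]/=.
by rewrite (nth_flatten_pairs _ k).1 nth_mkseq.
Qed.

Lemma input_len k : k < r -> input (2 + 2 * k) = run_len T k.
Proof.
move=> Hk; rewrite /input /encode_RLBWT !addSn add0n [LHS]/=.
by rewrite (nth_flatten_pairs _ k).2 nth_mkseq.
Qed.

Lemma input_end a : 2 * r < a -> input a = 0.
Proof.
move=> Ha; rewrite /input nth_default // /encode_RLBWT /=.
have -> : size (flatten [seq [:: x.1; x.2] | x <- RLBWT T]) = 2 * size (RLBWT T).
  by elim: (RLBWT T) => //= x s IH; rewrite IH mulnS.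
by rewrite size_mkseq.
Qed.

Lemma update_raw m k f v a : b <= k -> a <= 2 * r -> update m (k * 17 + f) v a = m a.
Proof. by move=> Hk Ha; rewrite /update; case: eqP => // E; lia. Qed.

Record loaded (mx : nat) (m : nat -> nat) : Prop := Loaded {
  loaded_char : forall k, k < r -> m ((b + k) * 17 + fCH) = rchar k;
  loaded_key : forall k, k < r -> m ((b + k) * 17 + fKEY) = rchar k;
  loaded_rs : forall k, k <= r -> m ((b + k) * 17 + fRS) = rsn T k;
  loaded_ln : forall k, k < r ->
    m ((b + k) * 17 + fLN) = if k.+1 < r then b + k.+1 else 0;
  loaded_bk : forall k, m ((b + k) * 17 + fBK) = 0;
  loaded_mx : (forall k, k < r -> rchar k <= mx) /\ mx < W
}.

Lemma read_spec (Q : state -> Prop) :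
  (forall c rg' m mx, loaded mx m -> rg' vRn = r -> rg' vB = b -> rg' vN = n ->
     rg' vBk = n %/ r + 1 -> rg' vLST = b -> rg' vMX = mx ->
     c <= 200 * b -> Q (State c rg' m)) ->
  wp W sp read_runs Q (State 0 (fun=> 0) input).
Proof.
move=> HQ; rewrite /read_runs.
have r0 : 0 < r by exact: nruns_gt0.
have rn : r <= n by exact: nruns_le.
wasg r; [by split; lia|exact: input0|].
wasg b; [wsafe|by rewrite addn1|].
wasg 0; [wsafe|by []|].
wasg 0; [wsafe|by []|].
wasg 0; [wsafe|by []|].
apply: wp_seq.
pose I j (s : state) := exists2 i, j = r - i &
  [/\ [/\ i <= r, rg s vRn = r, rg s vB = b, rg s vJ = i & rg s vN = rsn T i],
      (forall k, k < i -> rchar k <= rg s vMX) /\ rg s vMX < W,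
      forall a, a <= 2 * r -> mm s a = input a,
      [/\ forall k, k < i -> mm s ((b + k) * 17 + fCH) = rchar k,
          forall k, k < i -> mm s ((b + k) * 17 + fKEY) = rchar k,
          forall k, k < i -> mm s ((b + k) * 17 + fRS) = rsn T k,
          forall k, k < i ->
            mm s ((b + k) * 17 + fLN) = if k.+1 < r then b + k.+1 else 0 &
          forall k, mm s ((b + k) * 17 + fBK) = 0] &
      clk s <= 30 + 150 * i].
apply: (@wp_while _ _ _ _ _ _ I r).
  exists 0; first by rewrite subn0.
  split=> //=; first by rewrite rsn0.
    by split=> //; lia.
  by split=> // k; apply: input_end; lia.
move=> j c rg' m [i Ej /= [[ir E0 E1 EJ EN] [Hmx Hmw] Hraw [hC hK hS hL hB] Hc]].
have rsn_n k : rsn T k <= n.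
  case: (ltnP k r) => h; first exact: ltnW (rsn_lt h).
  by rewrite rsn_end.
have := rsn_n i; have := rsn_n i.+1 => rsn1 rsni.
split.
- wsafe.
- rewrite E0 EJ => Hlt; have {}Hlt : i < r by lia.
  wasg (b + i); [by rewrite E1 EJ; wsafe|by rewrite E1 EJ|].
  wasg (rchar i).
    by rewrite EJ; wsafe.
    by rewrite EJ Hraw ?input_char //; lia.
  wsto ((b + i) * 17 + fCH) (rchar i); rewrite ?E1 ?EJ //; try wsafe.
  wsto ((b + i) * 17 + fKEY) (rchar i); rewrite ?E1 ?EJ //; try wsafe.
  wsto ((b + i) * 17 + fRS) (rsn T i); rewrite ?E1 ?EJ ?EN //; try wsafe.
  wsto ((b + i) * 17 + fLN) (if i.+1 < r then b + i.+1 else 0);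
    rewrite ?E1 ?EJ ?EN ?E0 //; try wsafe.
    by repeat split=> //; rewrite ?addn1; case: (i.+1 < r); lia.
  wasg (rsn T i.+1); rewrite ?EN ?EJ.
    repeat split=> //; try by lia.
    rewrite !update_raw ?Hraw ?input_len //; try lia.
    have := rsn_next Hlt; rewrite /run_len; lia.
  - rewrite !update_raw ?Hraw ?input_len //; try lia.
    have := rsn_next Hlt; rewrite /run_len; lia.
  set m4 := update _ _ _.
  have Hraw4 a : a <= 2 * r -> m4 a = input a.
    by move=> Ha; rewrite /m4 !update_raw ?Hraw //; lia.
  have upd f k : f < 17 -> f \notin [:: fCH; fKEY; fRS; fLN] ->
     m4 ((b + k) * 17 + f) = m ((b + k) * 17 + f).
    move=> f17; rewrite !inE !negb_or => /and4P[n1 n2 n3 n4].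
    by rewrite /m4 !update_field // (negbTE n1) (negbTE n2) (negbTE n3) (negbTE n4).
  have hC4 k : k < i.+1 -> m4 ((b + k) * 17 + fCH) = rchar k.
    move=> Hk; rewrite /m4 !update_field //= eqn_add2l; case: eqP => [-> //|ne].
    by apply: hC; lia.
  have hK4 k : k < i.+1 -> m4 ((b + k) * 17 + fKEY) = rchar k.
    move=> Hk; rewrite /m4 !update_field //= eqn_add2l; case: eqP => [-> //|ne].
    by apply: hK; lia.
  have hS4 k : k < i.+1 -> m4 ((b + k) * 17 + fRS) = rsn T k.
    move=> Hk; rewrite /m4 !update_field //= eqn_add2l; case: eqP => [-> //|ne].
    by apply: hS; lia.
  have hL4 k : k < i.+1 -> m4 ((b + k) * 17 + fLN) = if k.+1 < r then b + k.+1 else 0.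
    move=> Hk; rewrite /m4 !update_field //= eqn_add2l; case: eqP => [-> //|ne].
    by apply: hL; lia.
  have hB4 k : m4 ((b + k) * 17 + fBK) = 0 by rewrite upd.
  clearbody m4.
  have fin c' g : c' <= c + 120 -> g vRn = r -> g vB = b -> g vJ = i ->
      g vN = rsn T i.+1 ->
      (forall k, k < i.+1 -> rchar k <= g vMX) -> g vMX < W ->
      wp W sp (Asg vJ (EV vJ +' EC 1)) (fun s2 => exists2 n', n' < j &
        I n' (State (clk s2 + 1) (rg s2) (mm s2))) (State c' g m4).
    move=> Hc' G0 G1 GJ GN G1' G2'.
    apply: (@wp_asg _ _ _ _ _ _ _ _ i.+1); rewrite /= ?GJ ?addn1 //; first wsafe.
    exists (r - i.+1); first by lia.
    by exists i.+1 => //; split=> //=; lia.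
  apply: wp_seq; apply: wp_if => /=; first by [].
  - move=> h; apply: (@wp_asg _ _ _ _ _ _ _ _ (rchar i)) => //=.
    apply: fin => //=; [lia| |exact: rchar_lt].
    move=> k; rewrite ltnS leq_eqVlt => /orP[/eqP -> //|Hk].
    by have := Hmx _ Hk; lia.
  - move=> h; apply: wp_skip; apply: fin => //=; first by lia.
    move=> k; rewrite ltnS leq_eqVlt => /orP[/eqP -> //|Hk]; last exact: Hmx.
    by lia.
- rewrite E0 EJ => Hge; have Ei : i = r by lia.
  rewrite {}Ei in EJ EN Hc hC hK hS hL Hmx *.
  wasg (b + r); rewrite ?E0 ?E1 //; first wsafe.
  have ENn : rg' vN = n by rewrite EN rsn_end.
  wsto ((b + r) * 17 + fRS) n; rewrite ?ENn //; try wsafe.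
  wasg (n %/ r + 1); rewrite ?ENn ?E0 //.
    by repeat split=> //; have := leq_div n r; lia.
  apply: (@wp_asg _ _ _ _ _ _ _ _ b) => //=.
  apply: (HQ _ _ _ (rg' vMX)) => //=; last by lia.
  split.
  - by move=> k Hk; rewrite update_field //= hC.
  - by move=> k Hk; rewrite update_field //= hK.
  - move=> k Hk; rewrite update_field //= eqn_add2l; case: eqP => [->|ne].
      by rewrite rsn_end.
    by apply: hS; lia.
  - by move=> k Hk; rewrite update_field //= hL.
  - by move=> k; rewrite update_field //= hB.
  - by [].
Qed.

End Read.

(** * Radix sort of the runs *)

Definition scatter : cmd :=
  While (EV vLST)
    (Asg vT (EV vLST) ;;
     Asg vLST (get fLN vT) ;;
     Asg vDD (EV vB +' get fKEY vT %' EV vB) ;;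
     put fKEY vT (get fKEY vT /' EV vB) ;;
     put fLN vT (get fBK vDD) ;;
     put fBK vDD (EV vT)).

(* Pushing on the buckets reverses the order of equal digits, and moving the
   buckets to the front of the list, largest digit first, restores it. *)
Definition gather : cmd :=
  Asg vDD (EV vB +' EV vB) ;;
  While (EV vB <' EV vDD)
    (Asg vDD (EV vDD -' EC 1) ;;
     While (get fBK vDD)
       (Asg vT (get fBK vDD) ;;
        put fBK vDD (get fLN vT) ;;
        put fLN vT (EV vLST) ;;
        Asg vLST (EV vT))).

Definition radix_sort : cmd :=
  While (EV vMX) (scatter ;; gather ;; Asg vMX (EV vMX /' EV vB)).

Fixpoint lst (m : nat -> nat) (x : nat) (L : seq nat) : Prop :=
  if L is y :: L' then x = y /\ lst m (m (y * 17 + fLN)) L' else x = 0.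

Lemma lst_ext m m' x L :
  (forall y, y \in L -> m' (y * 17 + fLN) = m (y * 17 + fLN)) ->
  lst m x L -> lst m' x L.
Proof.
elim: L x => //= y L IH x E [-> H]; split=> //.
rewrite E ?inE ?eqxx //; apply: IH H => z Hz; apply: E.
by rewrite inE Hz orbT.
Qed.

Section Radix.

Variables W r : nat.
Let b := r.+1.
Let sp := 136 * r.

Hypothesis W_ge : sp + 100 <= W.
Hypothesis r_gt0 : 0 < r.

Definition keep_sort (m m' : nat -> nat) : Prop :=
  forall k f, f < 17 -> f \notin [:: fKEY; fLN; fBK] ->
    m' (k * 17 + f) = m (k * 17 + f).

Lemma keep_sort_trans m1 m2 m3 :
  keep_sort m1 m2 -> keep_sort m2 m3 -> keep_sort m1 m3.
Proof. by move=> H1 H2 k f f17 nf; rewrite H2 ?H1. Qed.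

Lemma keep_sort_update m m' k f v : f \in [:: fKEY; fLN; fBK] ->
  keep_sort m m' -> keep_sort m (update m' (k * 17 + f) v).
Proof.
move=> Hf H j g g17 ng.
have f17 : f < 17 by move: Hf; rewrite !inE => /or3P[] /eqP ->.
rewrite update_field //; case: eqP => [E|_]; last exact: H.
by rewrite E Hf in ng.
Qed.

Definition digits (kf : nat -> nat) (L : seq nat) (e : nat) : seq nat :=
  flatten [seq [seq y <- L | kf y %% b == d] | d <- iota e (b - e)].

Lemma digits_cons kf L e : e < b ->
  digits kf L e = [seq y <- L | kf y %% b == e] ++ digits kf L e.+1.
Proof.
move=> He; rewrite /digits; have -> : b - e = (b - e.+1).+1 by lia.
by [].
Qed.

Lemma mem_digits kf L e y : (y \in digits kf L e) = (y \in L) && (e <= kf y %% b).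
Proof.
have mb : kf y %% b < b by rewrite ltn_pmod.
apply/flattenP/andP => [[s /mapP [d]]|[yL He]].
  by rewrite mem_iota => Hd ->; rewrite mem_filter => /andP[/eqP -> ->]; split; lia.
exists [seq z <- L | kf z %% b == kf y %% b]; last by rewrite mem_filter eqxx.
by apply/mapP; exists (kf y %% b); rewrite // mem_iota; lia.
Qed.

Lemma pairwise_digits (r1 r2 : rel nat) kf L :
  pairwise r1 L ->
  {in L &, forall x y, kf x %% b < kf y %% b -> r2 x y} ->
  {in L &, forall x y, kf x %% b = kf y %% b -> r1 x y -> r2 x y} ->
  pairwise r2 (digits kf L 0).
Proof.
move=> pL H1 H2.
have H k : pairwise r2 (digits kf L (b - k)).
  elim: k => [|k IH]; first by rewrite subn0 /digits subnn.
  case: (ltnP k b) => Hk; last by have -> : b - k.+1 = b - k by lia.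
  have Ek : b - k = (b - k.+1).+1 by lia.
  rewrite Ek in IH; rewrite digits_cons; last by lia.
  rewrite pairwise_cat IH andbT; apply/andP; split.
    apply/allrelP => x y; rewrite mem_filter mem_digits => /andP[/eqP E xL] /andP[yL h].
    by apply: H1 => //; rewrite E.
  have : pairwise r1 [seq y <- L | kf y %% b == b - k.+1].
    by apply: subseq_pairwise pL; apply: filter_subseq.
  apply: (@sub_in_pairwise _ (mem [seq y <- L | kf y %% b == b - k.+1])).
    move=> x y /=; rewrite !mem_filter => /andP[/eqP Ex xL] /andP[/eqP Ey yL].
    by apply: H2 => //; rewrite Ex Ey.
  exact/allP.
by have := H b; rewrite subnn.
Qed.

Lemma uniq_digits kf L : uniq L -> uniq (digits kf L 0).
Proof.
rewrite !uniq_pairwise => uL; apply: (pairwise_digits uL) => // x y _ _.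
by move=> lt; apply: contraTneq lt => ->; rewrite ltnn.
Qed.

Lemma perm_digits kf L : uniq L -> perm_eq (digits kf L 0) L.
Proof.
move=> uL; apply: uniq_perm => // [|y]; first exact: uniq_digits.
by rewrite mem_digits andbT.
Qed.

Lemma scatter_spec s L kf (Q : state -> Prop) :
  let m := mm s in
  rg s vB = b -> lst m (rg s vLST) L -> uniq L ->
  {in L, forall y, b <= y < b + r} ->
  {in L, forall y, m (y * 17 + fKEY) = kf y} -> (forall y, kf y < W) ->
  (forall d, d < b -> m ((b + d) * 17 + fBK) = 0) ->
  (forall c r' m', (forall y, y \notin [:: vT; vLST; vDD] -> r' y = rg s y) ->
     r' vLST = 0 ->
     (forall d, d < b ->
        lst m' (m' ((b + d) * 17 + fBK)) (rev [seq y <- L | kf y %% b == d])) ->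
     {in L, forall y, m' (y * 17 + fKEY) = kf y %/ b} -> keep_sort m m' ->
     c <= clk s + 100 * size L + 10 -> Q (State c r' m')) ->
  wp W sp scatter Q s.
Proof.
case: s => c0 r0 m /= EB HL uL rL HK kW H0 HQ.
pose I j (s : state) := exists L1 L2, j = size L2 /\
  [/\ L = L1 ++ L2, lst (mm s) (rg s vLST) L2,
      (forall d, d < b ->
        lst (mm s) (mm s ((b + d) * 17 + fBK)) (rev [seq y <- L1 | kf y %% b == d])),
      [/\ {in L1, forall y, mm s (y * 17 + fKEY) = kf y %/ b},
          {in L2, forall y, mm s (y * 17 + fKEY) = kf y},
          keep_sort m (mm s) &
          forall y, y \notin [:: vT; vLST; vDD] -> rg s y = r0 y] &
      clk s <= c0 + 100 * size L1].
apply: (@wp_while _ _ _ _ _ _ I (size L)).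
  exists [::], L; split=> //; split=> //=.
  lia.
move=> j c r1 m1 [L1 [L2 [-> /= [EL HL2 HB [HK1 HK2 Hk Fr] Hc]]]].
have EB1 : r1 vB = b by rewrite Fr.
split=> //.
- case: L2 EL HL2 HK2 => [|x L2] EL /=; first by move=> ->.
  move=> [Ex HL2] HK2 _.
  have xL : x \in L by rewrite EL mem_cat inE eqxx orbT.
  have Hx := rL _ xL; have kx := HK2 x (mem_head _ _).
  have mb : kf x %% b < b by rewrite ltn_pmod.
  have kWx := kW x; have kd := leq_div (kf x) b.
  have [x1 x2] : x \notin L1 /\ x \notin L2.
    by move: uL; rewrite EL cat_uniq /= => /and4P[_ /norP[? _] ? _].
  wasg x ; rewrite ?Ex //.
  wasg (m1 (x * 17 + fLN)) => //; first wsafe.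
  wasg (b + kf x %% b); rewrite ?EB1 ?kx //; first wsafe.
  wsto (x * 17 + fKEY) (kf x %/ b); rewrite ?EB1 ?kx //; try wsafe.
  wsto (x * 17 + fLN) (m1 ((b + kf x %% b) * 17 + fBK)); try wsafe; try by [].
    by rewrite update_field.
  apply: (@wp_sto _ _ _ _ _ _ _ _ ((b + kf x %% b) * 17 + fBK) x); rewrite /=;
    try wsafe; try by [].
  set m2 := update _ _ _.
  have E9 y : m2 (y * 17 + fKEY) = if y == x then kf x %/ b else m1 (y * 17 + fKEY).
    by rewrite /m2 !update_field.
  have E10 y : m2 (y * 17 + fLN) =
      if y == x then m1 ((b + kf x %% b) * 17 + fBK) else m1 (y * 17 + fLN).
    by rewrite /m2 !update_field.
  have E11 d : m2 ((b + d) * 17 + fBK) =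
      if d == kf x %% b then x else m1 ((b + d) * 17 + fBK).
    by rewrite /m2 !update_field //= eqn_add2l.
  have k2 : keep_sort m m2 by rewrite /m2; do 3 apply: keep_sort_update => //.
  clearbody m2.
  exists (size L2); first by [].
  exists (rcons L1 x), L2; split=> //; split=> /=.
  + by rewrite cat_rcons.
  + apply: lst_ext HL2 => y Hy; rewrite E10; case: eqP => // E.
    by rewrite -E Hy in x2.
  + move=> d Hd; rewrite filter_rcons E11.
    have ext : {in [seq y <- L1 | kf y %% b == d],
        forall y, m2 (y * 17 + fLN) = m1 (y * 17 + fLN)}.
      move=> y; rewrite mem_filter E10 => /andP[_ Hy]; case: eqP => // E.
      by rewrite -E Hy in x1.
    rewrite eq_sym; case: eqP => E.
      rewrite rev_rcons /= E10 eqxx; split=> //.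
      rewrite E; apply: lst_ext (HB _ Hd) => y; rewrite mem_rev; exact: ext.
    by apply: lst_ext (HB _ Hd) => y; rewrite mem_rev; exact: ext.
  + split=> //.
    * move=> y; rewrite mem_rcons inE E9 => /orP[/eqP ->|Hy]; first by rewrite eqxx.
      by case: eqP => [-> //|_]; apply: HK1.
    * move=> y Hy; rewrite E9; case: eqP => [E|_]; first by rewrite -E Hy in x2.
      by apply: HK2; rewrite inE Hy orbT.
    * move=> y Hy; have ne c := notin_neq (c := c) Hy.
      by rewrite !rupd_neq ?ne // Fr.
  + rewrite size_rcons; lia.
- move=> h0; have L20 : L2 = [::].
    case: L2 EL HL2 {HK2} => // x L2 EL /= [E _].
    have xL : x \in L by rewrite EL mem_cat inE eqxx orbT.
    by have := rL _ xL; lia.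
  rewrite {}L20 cats0 in EL; rewrite -{}EL in HB HK1 Hc.
  by apply: HQ => //; lia.
Qed.

Lemma gather_spec s L kf (Q : state -> Prop) :
  let m := mm s in
  rg s vB = b -> rg s vLST = 0 -> uniq L ->
  {in L, forall y, b <= y < b + r} ->
  (forall d, d < b ->
     lst m (m ((b + d) * 17 + fBK)) (rev [seq y <- L | kf y %% b == d])) ->
  (forall c r' m', (forall y, y \notin [:: vT; vLST; vDD] -> r' y = rg s y) ->
     lst m' (r' vLST) (digits kf L 0) ->
     (forall d, d < b -> m' ((b + d) * 17 + fBK) = 0) ->
     (forall y, m' (y * 17 + fKEY) = m (y * 17 + fKEY)) -> keep_sort m m' ->
     c <= clk s + 100 * size L + 100 * b + 20 -> Q (State c r' m')) ->
  wp W sp gather Q s.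
Proof.
case: s => c0 r0 m /= EB EL uL rL HB HQ; rewrite /gather.
wasg (b + b); rewrite ?EB //; first wsafe.
pose I j (s : state) := j <= b /\
  [/\ lst (mm s) (rg s vLST) (digits kf L j), rg s vDD = b + j,
      (forall d, d < b -> lst (mm s) (mm s ((b + d) * 17 + fBK))
         (if d < j then rev [seq y <- L | kf y %% b == d] else [::])),
      [/\ forall y, mm s (y * 17 + fKEY) = m (y * 17 + fKEY),
          keep_sort m (mm s) &
          forall y, y \notin [:: vT; vLST; vDD] -> rg s y = r0 y] &
      clk s <= c0 + 10 + 100 * size (digits kf L j) + 100 * (b - j)].
apply: (@wp_while _ _ _ _ _ _ I b).
  split=> //; split=> //=.
  - by rewrite EL /digits subnn.
  - by move=> d Hd; rewrite Hd; apply: HB.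
  - split=> // y Hy; have ne c := notin_neq (c := c) Hy.
    by rewrite !rupd_neq ?ne.
  - by lia.
move=> j c r1 m1 [jb /= [HL ED HB1 [HK Hk Fr] Hc]].
have EB1 : r1 vB = b by rewrite Fr.
split=> //.
- rewrite EB1 ED => Hj.
  have [e Ee] : exists e, j = e.+1 by exists j.-1; lia.
  rewrite {}Ee in jb HL ED HB1 Hc *.
  wasg (b + e); rewrite ?ED //; [wsafe|by lia|].
  pose F := [seq y <- L | kf y %% b == e].
  have FL y : y \in F -> b <= y < b + r by rewrite mem_filter => /andP[_]; apply: rL.
  have Fe y : y \in F -> kf y %% b = e by rewrite mem_filter => /andP[/eqP].
  have uF : uniq F by rewrite filter_uniq.
  pose J i (s : state) := exists A C, i = size A /\
    [/\ F = A ++ C, lst (mm s) (rg s vLST) (C ++ digits kf L e.+1),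
      rg s vDD = b + e /\ (forall d, d < b -> lst (mm s) (mm s ((b + d) * 17 + fBK))
         (if d < e then rev [seq y <- L | kf y %% b == d] else
          if d == e then rev A else [::])),
      [/\ forall y, mm s (y * 17 + fKEY) = m (y * 17 + fKEY),
          keep_sort m (mm s) &
          forall y, y \notin [:: vT; vLST; vDD] -> rg s y = r0 y] &
      clk s <= c0 + 20 + 100 * size C + 100 * size (digits kf L e.+1) + 100 * (b - e.+1)].
  apply: (@wp_while _ _ _ _ _ _ J (size F)).
    exists F, [::]; split=> //; split=> //=.
    + by rewrite cats0.
    + split=> // d Hd; have := HB1 d Hd; rewrite ltnS leq_eqVlt.
      by case: (ltngtP d e) => // ->.
    + split=> // y Hy; have ne c' := notin_neq (c := c') Hy.
      by rewrite !rupd_neq ?ne // Fr.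
    + lia.
  move=> i c2 r2 m2 [A [C [-> /= [EF HL2 [ED2 HB2] [HK2 Hk2 Fr2] Hc2]]]].
  have He : e < b by lia.
  have HBe := HB2 e He; rewrite ltnn eqxx in HBe.
  rewrite ED2; split.
  + wsafe.
  + move=> h0; case: (lastP A) EF HBe => [|A' x] EF; first by move=> /= E; rewrite E in h0.
    rewrite rev_rcons /= => -[Ex HBe'].
    have xF : x \in F by rewrite EF mem_cat mem_rcons inE eqxx.
    have [xA xC] : x \notin A' /\ x \notin C.
      move: uF; rewrite EF cat_rcons cat_uniq /= => /and4P[_ /norP[? _] ? _].
      by [].
    have Hx := FL _ xF; have kx := Fe _ xF.
    wasg x; rewrite ?ED2 //; first wsafe.
    wsto ((b + e) * 17 + fBK) (m2 (x * 17 + fLN)); rewrite ?ED2 //; try wsafe.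
    wsto (x * 17 + fLN) (r2 vLST); try wsafe; try by [].
    apply: (@wp_asg _ _ _ _ _ _ _ _ x) => //=.
    set m3 := update _ _ _.
    have E9 y : m3 (y * 17 + fKEY) = m2 (y * 17 + fKEY) by rewrite /m3 !update_field.
    have E10 y : m3 (y * 17 + fLN) = if y == x then r2 vLST else m2 (y * 17 + fLN).
      by rewrite /m3 !update_field.
    have E11 d : m3 ((b + d) * 17 + fBK) =
        if d == e then m2 (x * 17 + fLN) else m2 ((b + d) * 17 + fBK).
      by rewrite /m3 !update_field //= eqn_add2l.
    have k3 : keep_sort m m3 by rewrite /m3; do 2 apply: keep_sort_update => //.
    clearbody m3.
    have ext s0 : x \notin s0 ->
        {in s0, forall y, m3 (y * 17 + fLN) = m2 (y * 17 + fLN)}.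
      by move=> xs y ys; rewrite E10; case: eqP => // E; rewrite -E ys in xs.
    exists (size A'); first by rewrite size_rcons.
    exists A', (x :: C); split=> //; split=> /=.
    * by rewrite EF cat_rcons.
    * rewrite E10 eqxx; split=> //; apply: lst_ext HL2; apply: ext.
      by rewrite mem_cat (negbTE xC) mem_digits kx ltnn andbF.
    * split=> // d Hd; rewrite E11.
      case: (ltngtP d e) => de.
      - have := HB2 d Hd; rewrite de => h; apply: lst_ext h; apply: ext.
        by rewrite mem_rev mem_filter kx; case: eqP => // E; rewrite E ltnn in de.
      - by have := HB2 d Hd; rewrite ltnNge (ltnW de) /=; case: eqP => // E; rewrite E ltnn in de.
      - by apply: lst_ext HBe'; apply: ext; rewrite mem_rev.
    * split=> //; first by move=> y; rewrite E9.
      move=> y Hy; have ne c' := notin_neq (c := c') Hy.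
      by rewrite !rupd_neq ?ne // Fr2.
    * lia.
  + move=> h0; have A0 : A = [::].
      case: (lastP A) EF HBe => // A' x EF.
      rewrite rev_rcons /= => -[Ex _].
      have xF : x \in F by rewrite EF mem_cat mem_rcons inE eqxx.
      by have := FL _ xF; lia.
    rewrite {}A0 /= in EF HB2; rewrite -{}EF in HL2 Hc2.
    exists e => //; split; first by lia.
    rewrite digits_cons // size_cat; split=> //=; last first. rewrite (_ : b - e = (b - e.+1).+1); last by lia.
      by move: Hc2; rewrite /F; move: (size _) (size _) => u v; lia.
    by move=> d Hd; have := HB2 d Hd; case: (ltngtP d e).
- rewrite EB1 ED => Hj; have j0 : j = 0 by lia.
  rewrite {}j0 in HL HB1 Hc.
  apply: HQ => //; last first.
    by move: Hc; rewrite (perm_size (perm_digits kf uL)) subn0; move: (size _) => u; lia.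
Qed.

Lemma modn_expS c i :
  c %% b ^ i.+1 = (c %/ b ^ i) %% b * b ^ i + c %% b ^ i.
Proof.
have b0 : 0 < b ^ i by rewrite expn_gt0.
have H1 := divn_eq c (b ^ i); have H2 := divn_eq (c %/ b ^ i) b.
set q := c %/ b ^ i in H1 H2 *; set u := c %% b ^ i in H1 *.
have ub : u < b ^ i by rewrite ltn_pmod.
have vb : q %% b < b by rewrite ltn_pmod.
rewrite {1}H1 {1}H2 mulnDl -mulnA -expnS -addnA modnMDl modn_small //.
rewrite expnS; apply: leq_trans (_ : (q %% b).+1 * b ^ i <= _).
  by rewrite mulSn addnC ltn_add2r.
by rewrite leq_mul2r vb orbT.
Qed.

Definition key_lt (ck : nat -> nat) (x y : nat) : bool :=
  (ck x < ck y) || ((ck x == ck y) && (x < y)).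

Lemma pairwise_key_lt_step ck i L :
  pairwise (key_lt (fun y => ck y %% b ^ i)) L ->
  pairwise (key_lt (fun y => ck y %% b ^ i.+1)) (digits (fun y => ck y %/ b ^ i) L 0).
Proof.
move=> pL; apply: (pairwise_digits pL) => x y _ _; rewrite /key_lt !modn_expS.
  move=> lt; apply/orP; left.
  have xb : ck x %% b ^ i < b ^ i by rewrite ltn_pmod ?expn_gt0.
  apply: leq_trans (leq_addr _ _).
  apply: leq_trans (_ : ((ck x %/ b ^ i) %% b).+1 * b ^ i <= _).
    by rewrite mulSn addnC ltn_add2r.
  by rewrite leq_mul2r lt orbT.
by move=> ->; rewrite ltn_add2l eqn_add2l.
Qed.

Lemma radix_spec s ck mx (Q : state -> Prop) :
  let m := mm s in
  let L0 := iota b r in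
  rg s vB = b -> lst m (rg s vLST) L0 ->
  {in L0, forall y, m (y * 17 + fKEY) = ck y} -> (forall y, ck y < W) ->
  (forall d, d < b -> m ((b + d) * 17 + fBK) = 0) ->
  rg s vMX = mx -> {in L0, forall y, ck y <= mx} ->
  (forall c r' m' L i, perm_eq L L0 -> pairwise (key_lt ck) L ->
     lst m' (r' vLST) L -> keep_sort m m' ->
     (forall y, y \notin [:: vT; vLST; vDD; vMX] -> r' y = rg s y) ->
     (i == 0) || (b ^ i.-1 <= mx) -> c <= clk s + 400 * (b * i) + 10 ->
     Q (State c r' m')) ->
  wp W sp radix_sort Q s.
Proof.
case: s => c0 r0 m /= EB HL HK kW HB EM Hmx HQ.
have ids L : perm_eq L (iota b r) -> {in L, forall y, b <= y < b + r}.
  by move=> pL y; rewrite (perm_mem pL) mem_iota.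
pose I j (s : state) := exists i L, j = rg s vMX /\
  [/\ perm_eq L (iota b r) /\ pairwise (key_lt (fun y => ck y %% b ^ i)) L,
      lst (mm s) (rg s vLST) L /\ keep_sort m (mm s),
      {in L, forall y, mm s (y * 17 + fKEY) = ck y %/ b ^ i} /\
      (forall d, d < b -> mm s ((b + d) * 17 + fBK) = 0),
      (forall y, y \notin [:: vT; vLST; vDD; vMX] -> rg s y = r0 y) /\
      rg s vMX = mx %/ b ^ i &
      (i == 0) || (b ^ i.-1 <= mx) /\ clk s <= c0 + 400 * (b * i)].
apply: (@wp_while _ _ _ _ _ _ I (r0 vMX)).
  exists 0, (iota b r); split=> //; split=> //=.
  - split=> //; rewrite -sorted_pairwise; last by move=> x y z; rewrite /key_lt; lia.
    apply: sub_sorted (iota_ltn_sorted b r) => x y; rewrite /key_lt expn0 !modn1 => xy.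
    by apply/orP; right.
  - by split=> // y Hy; rewrite HK // expn0 divn1.
  - by rewrite expn0 divn1.
  - by split=> //; lia.
move=> j c r1 m1 [i [L [-> /= [[pL sL] [HL1 Hk] [HK1 HB1] [Fr EM1] [Hi Hc]]]]].
have EB1 : r1 vB = b by rewrite Fr.
have uL : uniq L by rewrite (perm_uniq pL) iota_uniq.
have sL' : size L = r by rewrite (perm_size pL) size_iota.
have b1 : 1 < b by [].
split=> //.
- move=> hM; apply: wp_seq.
  apply: (@scatter_spec _ L (fun y => ck y %/ b ^ i)) => //=; first exact: ids.
    by move=> y; apply: leq_ltn_trans (leq_div _ _) (kW y).
  move=> c2 r2 m2 F2 EL2 HB2 HK2 Hk2 Hc2; apply: wp_seq.
  have EB2 : r2 vB = b by rewrite F2.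
  apply: (@gather_spec _ L (fun y => ck y %/ b ^ i)) => //=; first exact: ids.
  move=> c3 r3 m3 F3 HL3 HB3 HK3 Hk3 Hc3.
  have EB3 : r3 vB = b by rewrite F3.
  have EM3 : r3 vMX = mx %/ b ^ i by rewrite F3 // F2.
  apply: (@wp_asg _ _ _ _ _ _ _ _ (mx %/ b ^ i.+1)); rewrite /= ?EM3 ?EB3 //.
    by rewrite -divnMA -expnSr.
  have M0 : 0 < mx %/ b ^ i by rewrite lt0n -EM1; apply/eqP.
  exists (mx %/ b ^ i.+1).
    by rewrite EM1 expnSr divnMA ltn_Pdiv.
  exists i.+1, (digits (fun y => ck y %/ b ^ i) L 0); split=> //; split=> //=.
  + by split; [apply: perm_trans (perm_digits _ uL) pL|apply: pairwise_key_lt_step].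
  + by split=> //; apply: keep_sort_trans Hk (keep_sort_trans Hk2 Hk3).
  + split=> // y; rewrite mem_digits => /andP[yL _].
    by rewrite HK3 HK2 // -divnMA -expnSr.
  + split=> // y Hy; have ne c' := notin_neq (c := c') Hy.
    rewrite rupd_neq ?ne // F3 ?F2 ?Fr //; rewrite !inE !negb_or !ne //.
  + split; first by move: M0; rewrite divn_gt0 ?expn_gt0.
    rewrite sL' in Hc2 Hc3; rewrite mulnS.
    by move: (b * i) Hc => bi; lia.
- rewrite EM1 => hM.
  apply: (HQ _ _ _ L i) => //; last by lia.
  have mb : mx < b ^ i.
    by rewrite ltnNge -divn_gt0 ?expn_gt0 // hM.
  rewrite (eq_in_pairwise (P := [in L]) (r' := key_lt (fun y => ck y %% b ^ i))) //.
    move=> x y /= xL yL; rewrite /key_lt !modn_small //.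
    + by apply: leq_ltn_trans mb; apply: Hmx; rewrite -(perm_mem pL).
    + by apply: leq_ltn_trans mb; apply: Hmx; rewrite -(perm_mem pL).
Qed.

End Radix.

(** * Building the pieces *)

Definition add_piece : cmd :=
  put fP vNP (EV vPP) ;;
  put fQ vNP (EV vQQ) ;;
  put fD vNP (EV vDD) ;;
  put fNX vNP (EV vNP +' EC 1) ;;
  put fRN vNP (EV vLST) ;;
  Asg vPP (EV vPP +' EV vDD) ;;
  Asg vQQ (EV vQQ +' EV vDD) ;;
  Asg vNP (EV vNP +' EC 1).

Definition make_pieces : cmd :=
  Asg vNP (EV vB) ;;
  Asg vPP (EC 0) ;;
  While (EV vLST)
    (Asg vQQ (get fRS vLST) ;;
     Asg vT (EV vLST +' EC 1) ;;
     Asg vEE (get fRS vT) ;;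
     While (EV vQQ <' EV vEE)
       (Asg vDD (EV vBk -' EV vPP %' EV vBk) ;;
        If (EV vEE -' EV vQQ <' EV vDD) (Asg vDD (EV vEE -' EV vQQ)) Skip ;;
        If (EV vPP %' EV vBk) Skip
          (Asg vT (EV vB +' EV vPP /' EV vBk) ;; put fBL vT (EV vNP)) ;;
        add_piece) ;;
     Asg vLST (get fLN vLST)).

Definition set_dest : cmd :=
  Asg vJ (EV vB) ;;
  While (EV vJ <' EV vNP)
    (Asg vT (EV vB +' get fQ vJ /' EV vBk) ;;
     put fCI vJ (get fBL vT) ;;
     Asg vJ (EV vJ +' EC 1)).

Section Make.

Variables (T : seq nat) (W : nat).
Hypothesis termT : terminated T.

Let n := size T.
Let r := nruns T.
Let b := r.+1.
Let sp := 136 * r.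

Definition blk : nat := n %/ r + 1.
Let Bk := blk.
Definition ro (i : nat) : nat := b + run_of T i.

Let r_gt0 : 0 < r. Proof. exact: nruns_gt0. Qed.
Let r_le : r <= n. Proof. exact: nruns_le. Qed.

Lemma blk_gt0 : 0 < Bk.
Proof. by rewrite /Bk /blk addn1. Qed.

Lemma blk_le : Bk <= n + 1.
Proof. by rewrite /Bk /blk leq_add2r leq_div. Qed.

Lemma ltn_blk : n < r * Bk.
Proof. by rewrite /Bk /blk mulnC addn1 ltn_ceil. Qed.

Lemma blk_mul_le : r * Bk <= 2 * n.
Proof.
have := leq_divM n r; rewrite /Bk /blk mulnDr muln1 mulnC; lia.
Qed.

Lemma blk_div x : x < n -> x %/ Bk < r.
Proof. by move=> Hx; rewrite ltn_divLR ?blk_gt0 //; have := ltn_blk; lia. Qed.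

Hypothesis W_ge : sp + 2 * n + 100 <= W.

Record made (m : nat -> nat) (N PP : nat) : Prop := Made {
  made_range : forall k, b <= k < b + N ->
    [/\ 0 < m (k * 17 + 2), m (k * 17 + 0) + m (k * 17 + 2) <= PP &
        m (k * 17 + 0) %% Bk + m (k * 17 + 2) <= Bk];
  made_fl : forall k o, b <= k < b + N -> o < m (k * 17 + 2) ->
    fl T (m (k * 17 + 0) + o) = m (k * 17 + 1) + o /\
    ro (m (k * 17 + 1) + o) = m (k * 17 + 5);
  made_mono : forall k j, b <= k -> k < j < b + N ->
    m (k * 17 + 0) + m (k * 17 + 2) <= m (j * 17 + 0);
  made_next : forall k, b <= k < b + N -> m (k * 17 + 3) = k.+1 /\
    m (k * 17 + 0) + m (k * 17 + 2) = if k.+1 < b + N then m (k.+1 * 17 + 0) else PP;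
  made_block : forall e, e * Bk < PP ->
    b <= m ((b + e) * 17 + 16) < b + N /\ m (m ((b + e) * 17 + 16) * 17 + 0) = e * Bk
}.

Definition keep_runs (m m' : nat -> nat) : Prop :=
  forall k f, 6 <= f < 16 -> m' (k * 17 + f) = m (k * 17 + f).

Lemma keep_runs_update m m' k f v : f < 17 -> ~~ (6 <= f < 16) ->
  keep_runs m m' -> keep_runs m (update m' (k * 17 + f) v).
Proof.
move=> f17 nf H j g Hg; rewrite update_field //; last by lia.
by case: eqP => [E|_]; [lia|apply: H].
Qed.

Lemma add_piece_spec s m N PP QQ d x (Q : state -> Prop) :
  let g := rg s in
  made m N PP -> keep_runs m (mm s) ->
  (forall k f, f < 16 -> mm s (k * 17 + f) = m (k * 17 + f)) ->
  (forall e, e * Bk < PP + d -> mm s ((b + e) * 17 + 16) =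
     if e * Bk < PP then m ((b + e) * 17 + 16) else b + N) ->
  (forall e, PP <= e * Bk < PP + d -> e * Bk = PP) ->
  N < 2 * r -> 0 < d -> PP + d <= n -> QQ + d <= n -> PP %% Bk + d <= Bk ->
  (forall o, o < d -> fl T (PP + o) = QQ + o /\ ro (QQ + o) = x) ->
  g vNP = b + N -> g vPP = PP -> g vQQ = QQ -> g vDD = d -> g vLST = x ->
  (forall c g' m', made m' N.+1 (PP + d) -> keep_runs m m' ->
     (forall y, y \notin [:: vPP; vQQ; vNP] -> g' y = g y) ->
     g' vNP = b + N.+1 -> g' vPP = PP + d -> g' vQQ = QQ + d ->
     c <= clk s + 80 -> Q (State c g' m')) ->
  wp W sp add_piece Q s.
Proof.
case: s => c0 g m0 /= H kr Em Eb He HN d0 Pn Qn Pd Hfl ENP EPP EQQ EDD EL HQ.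
rewrite /add_piece.
wsto ((b + N) * 17 + 0) PP; rewrite ?ENP //; try wsafe.
wsto ((b + N) * 17 + 1) QQ; rewrite ?ENP //; try wsafe.
wsto ((b + N) * 17 + 2) d; rewrite ?ENP //; try wsafe.
wsto ((b + N) * 17 + 3) (b + N + 1); rewrite ?ENP //; try wsafe.
wsto ((b + N) * 17 + 5) x; rewrite ?ENP //; try wsafe.
wasg (PP + d); rewrite ?EPP ?EDD //; first wsafe.
wasg (QQ + d); rewrite ?EQQ ?EDD //; first wsafe.
apply: (@wp_asg _ _ _ _ _ _ _ _ (b + N + 1)); rewrite /= ?ENP //; first wsafe.
set m1 := update _ _ _.
have E0 j : m1 (j * 17 + 0) = if j == b + N then PP else m (j * 17 + 0).
  by rewrite /m1 !update_field //= Em.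
have E1 j : m1 (j * 17 + 1) = if j == b + N then QQ else m (j * 17 + 1).
  by rewrite /m1 !update_field //= Em.
have E2 j : m1 (j * 17 + 2) = if j == b + N then d else m (j * 17 + 2).
  by rewrite /m1 !update_field //= Em.
have E3 j : m1 (j * 17 + 3) = if j == b + N then b + N + 1 else m (j * 17 + 3).
  by rewrite /m1 !update_field //= Em.
have E5 j : m1 (j * 17 + 5) = if j == b + N then x else m (j * 17 + 5).
  by rewrite /m1 !update_field //= Em.
have E16 j : m1 (j * 17 + 16) = m0 (j * 17 + 16).
  by rewrite /m1 !update_field.
have kr1 : keep_runs m m1 by rewrite /m1; do 5 apply: keep_runs_update => //.
clearbody m1.
have ids j : b <= j < b + N.+1 -> j != b + N -> b <= j < b + N by lia.
apply: HQ => //=; last by lia.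
- split.
  + move=> k Hk; rewrite E0 E2; case: eqP => [_|/eqP nk]; first by [].
    by have [? ? ?] := made_range H (ids _ Hk nk); split=> //; lia.
  + move=> k o Hk; rewrite E0 E1 E2 E5; case: eqP => [_|/eqP nk]; first exact: Hfl.
    exact: (made_fl H (ids _ Hk nk)).
  + move=> k j bk kj; rewrite !E0 E2.
    have -> : (k == b + N) = false by lia.
    case: eqP => [_|/eqP nj].
      by have [] := made_range H (_ : b <= k < b + N); lia.
    by apply: (made_mono H); lia.
  + move=> k Hk; rewrite E3 !E0 E2; case: eqP => [->|/eqP nk].
      by rewrite addn1; split=> //; have -> : (b + N).+1 < b + N.+1 = false by lia.
    have Hk' := ids _ Hk nk; have [h1 h2] := made_next H Hk'.
    split=> //; rewrite h2.
    have -> : k.+1 < b + N.+1 by lia.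
    case: eqP => [->|/eqP ne]; first by rewrite ltnn.
    by have -> : k.+1 < b + N by lia.
  + move=> e Hlt; rewrite E16 Eb //; case: ltnP => h.
      have [h1 h2] := made_block H h; rewrite E0.
      have -> : (m ((b + e) * 17 + 16) == b + N) = false by lia.
      by rewrite h2; split=> //; lia.
    by rewrite E0 eqxx (He e) ?h //; split=> //; lia.
- move=> y Hy; have ne c' := notin_neq (c := c') Hy.
  by rewrite !rupd_neq ?ne.
- by rewrite addn1 addnS.
Qed.

Lemma sum_runs (L : seq nat) : perm_eq L (iota 0 r) -> pairwise (run_lt T) L ->
  sumn [seq run_len T k | k <- L] = n.
Proof.
move=> pL sL; have := congr1 size (fl_runs termT pL sL).
by rewrite size_runs size_map size_iota.
Qed.

Lemma make_spec s (L : seq nat) (Q : state -> Prop) :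
  let m := mm s in let g := rg s in
  g vB = b -> g vBk = Bk -> perm_eq L (iota 0 r) -> pairwise (run_lt T) L ->
  lst m (g vLST) [seq b + k | k <- L] ->
  (forall k, k <= r -> m ((b + k) * 17 + fRS) = rsn T k) ->
  (forall c g' m' N, made m' N n -> keep_runs m m' -> N <= 2 * r ->
     (forall y, y \notin [:: vNP; vPP; vLST; vQQ; vT; vEE; vDD] -> g' y = g y) ->
     g' vNP = b + N -> c <= clk s + 500 * b -> Q (State c g' m')) ->
  wp W sp make_pieces Q s.
Proof.
case: s => c0 g m /= EB EBk pL sL HL HS HQ; rewrite /make_pieces.
have Bk0 := blk_gt0; have Bkn := blk_le.
wasg b => //.
wasg 0 => //; first wsafe.
pose S (L1 : seq nat) := sumn [seq run_len T k | k <- L1].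
pose reg := [:: vNP; vPP; vLST; vQQ; vT; vEE; vDD].
have fr_trans g1 g2 (s0 : seq nat) : (forall y, y \notin s0 -> g2 y = g1 y) ->
   {subset s0 <= reg} -> (forall y, y \notin reg -> g1 y = g y) ->
   (forall y, y \notin reg -> g2 y = g y).
  by move=> h1 sub h2 y Hy; rewrite h1 ?h2 //; apply: contra Hy => /sub.
pose I j (s : state) := exists (L1 L2 : seq nat) (N : nat), j = size L2 /\
  [/\ L = L1 ++ L2, lst (mm s) (rg s vLST) [seq b + k | k <- L2],
      made (mm s) N (S L1) /\ keep_runs m (mm s),
      [/\ rg s vNP = b + N, rg s vPP = S L1, N <= size L1 + S L1 %/ Bk &
          forall y, y \notin reg -> rg s y = g y] &
      clk s <= c0 + 20 + 60 * size L1 + 200 * N].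
apply: (@wp_while _ _ _ _ _ _ I (size L)).
  exists [::], L, 0; split=> //; split=> //=.
  - by split=> //; split=> // *; lia.
  - split=> //; first by rewrite addn0.
    move=> y Hy; have ne c' := notin_neq (c := c') Hy.
    by rewrite !rupd_neq ?ne.
  - lia.
move=> j c g1 m1 [L1 [L2 [N [-> /= [EL HL1 [H1 k1] [ENP EPP HN Fr] Hc]]]]].
have EB1 : g1 vB = b by rewrite Fr.
have EBk1 : g1 vBk = Bk by rewrite Fr.
have sumL := sum_runs pL sL.
have szL : size L = r by rewrite (perm_size pL) size_iota.
split=> //.
- case: L2 EL HL1 => [|x L2] EL /=; first by move=> ->.
  move=> [Ex HL2] _.
  have Hx : x < r.
    have : x \in L by rewrite EL mem_cat inE eqxx orbT.
    by rewrite (perm_mem pL) mem_iota.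
  have Sx : S L1 + run_len T x <= n.
    by rewrite -sumL EL map_cat sumn_cat /= -/(S L1); lia.
  have L1r : size L1 < r by rewrite -szL EL size_cat /=; lia.
  have rs1 := rsn_next Hx.
  have rs2 : rsn T x.+1 <= n.
    have := rsn_le T Hx; rewrite (rsn_end (leqnn _)); exact.
  have Hfl o : o < run_len T x -> fl T (S L1 + o) = rsn T x + o.
    by move=> Ho; apply: (fl_run termT (L2 := L2)) => //; rewrite -EL.
  have Hro o : o < run_len T x -> ro (rsn T x + o) = b + x.
    by move=> Ho; rewrite /ro (@run_ofE _ _ x) //; rewrite /run_len in Ho; lia.
  wasg (rsn T x); rewrite ?Ex //; [wsafe|by rewrite k1 // HS // ltnW|].
  wasg (b + x.+1); rewrite ?Ex //; [wsafe|by lia|].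
  wasg (rsn T x.+1) => //; [wsafe|by rewrite k1 // HS|].
  apply: wp_seq.
  pose J i (s : state) := exists N1 u,
    [/\ i = run_len T x - u /\ u <= run_len T x,
      [/\ made (mm s) N1 (S L1 + u), keep_runs m (mm s) &
      lst (mm s) (mm s ((b + x) * 17 + fLN)) [seq b + k | k <- L2]],
      [/\ rg s vNP = b + N1, rg s vPP = S L1 + u, rg s vQQ = rsn T x + u,
          rg s vEE = rsn T x.+1 & rg s vLST = b + x],
      N1 <= size L1 + (S L1 + u) %/ Bk + (u == run_len T x) /\
          (forall y, y \notin reg -> rg s y = g y) &
      clk s <= c0 + 60 + 60 * size L1 + 200 * N1].
  apply: (@wp_while _ _ _ _ _ _ J (run_len T x)).
    exists N, 0; split=> //=; rewrite ?subn0 ?addn0 //.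
    + split; first by lia.
      apply: (fr_trans g1 _ [:: vQQ; vT; vEE]) => //.
        move=> y Hy; have ne c' := notin_neq (c := c') Hy.
        by rewrite !rupd_neq ?ne.
      by apply/allP.
    + lia.
  move=> i c2 g2 m2 [N1 [u /= [[-> ur] [H2 k2 HL3] [ENP2 EPP2 EQQ2 EEE2 ELST2] [HN1 Fr2] Hc2]]].
  have EB2 : g2 vB = b by rewrite Fr2.
  have EBk2 : g2 vBk = Bk by rewrite Fr2.
  have rl : rsn T x + run_len T x = rsn T x.+1 by rewrite /run_len; lia.
  split=> //.
  + rewrite EQQ2 EEE2 => Hlt; have {}Hlt : u < run_len T x by lia.
    have [PP EPP'] : exists PP, PP = S L1 + u by eexists.
    rewrite -EPP' in H2 EPP2 HN1.
    have PPn : PP < n by lia.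
    have dv := blk_div PPn.
    have md : PP %% Bk < Bk by rewrite ltn_pmod.
    have de := divn_eq PP Bk.
    have N1r : N1 < 2 * r.
      by move: HN1 dv; rewrite (ltn_eqF Hlt) addn0; move: (PP %/ Bk) => q; lia.
    wasg (Bk - PP %% Bk); rewrite ?EBk2 ?EPP2 //; first wsafe.
    have [d Ed] : exists d, d = minn (Bk - PP %% Bk) (run_len T x - u) by eexists.
    have d0 : 0 < d by lia.
    have dr : u + d <= run_len T x by lia.
    have dB : PP %% Bk + d <= Bk by lia.
    have N2 : N1 < size L1 + (PP + d) %/ Bk + (u + d == run_len T x).
      rewrite (ltn_eqF Hlt) addn0 in HN1.
      have [E|ne] := eqVneq (u + d) (run_len T x).
        by have := leq_div2r Bk (leq_addr d PP); rewrite addn1; lia.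
      have -> : PP + d = (PP %/ Bk).+1 * Bk by rewrite mulSn {1}de; lia.
      by rewrite mulnK // addn0; lia.
    have Eblk e : PP <= e * Bk < PP + d -> e = PP %/ Bk /\ e * Bk = PP.
      move=> He.
      have Ee : e = PP %/ Bk.
        have h1 : e * Bk < (PP %/ Bk).+1 * Bk by rewrite mulSn; lia.
        have h2 : PP %/ Bk * Bk <= e * Bk by lia.
        by move: h1 h2; rewrite ltn_mul2r leq_mul2r; lia.
      by split=> //; rewrite Ee in He *; lia.
    have last c4 g4 m4 :
        keep_runs m2 m4 ->
        (forall k f, f < 16 -> m4 (k * 17 + f) = m2 (k * 17 + f)) ->
        (forall e, e * Bk < PP + d -> m4 ((b + e) * 17 + 16) =
           if e * Bk < PP then m2 ((b + e) * 17 + 16) else b + N1) ->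
        g4 vNP = b + N1 -> g4 vPP = PP -> g4 vQQ = rsn T x + u -> g4 vDD = d ->
        g4 vLST = b + x -> g4 vEE = rsn T x.+1 ->
        (forall y, y \notin reg -> g4 y = g y) ->
        c4 <= c2 + 80 ->
        wp W sp add_piece (fun s2 => exists2 n', n' < run_len T x - u &
          J n' (State (clk s2 + 1) (rg s2) (mm s2))) (State c4 g4 m4).
      move=> k4 E4 B4 G1 G2 G3 G4 G5 G6 F4 Hc4.
      apply: (@add_piece_spec _ m2 N1 PP (rsn T x + u) d (b + x)) => //=.
      - by move=> e /Eblk [].
      - by lia.
      - by lia.
      - move=> o Ho; rewrite EPP' -!addnA; split; [apply: Hfl|apply: Hro]; lia.
      move=> c5 g5 m5 H5 k5 F5 ENP5 EPP5 EQQ5 Hc5.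
      exists (run_len T x - (u + d)); first by lia.
      exists N1.+1, (u + d); split=> //=.
      - rewrite addnA -EPP'; split=> //; first by move=> k f Hf; rewrite k5 // k2.
        have E10 k : m5 (k * 17 + fLN) = m2 (k * 17 + fLN) by rewrite k5.
        by rewrite E10; apply: lst_ext HL3 => y _.
      - by rewrite !addnA -EPP'; split=> //; rewrite F5.
      - split; first by rewrite addnA -EPP'.
        by apply: (fr_trans g4 _ [:: vPP; vQQ; vNP]) => //; apply/allP.
      - lia.
    have mid c3 g3 : g3 vNP = b + N1 -> g3 vPP = PP -> g3 vQQ = rsn T x + u ->
        g3 vDD = d -> g3 vLST = b + x -> g3 vEE = rsn T x.+1 ->
        (forall y, y \notin reg -> g3 y = g y) -> c3 <= c2 + 40 ->
        wp W sp (If (EV vPP %' EV vBk) Skip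
          (Asg vT (EV vB +' EV vPP /' EV vBk) ;; put fBL vT (EV vNP)) ;;
          add_piece) (fun s2 => exists2 n', n' < run_len T x - u &
          J n' (State (clk s2 + 1) (rg s2) (mm s2))) (State c3 g3 m2).
      move=> G1 G2 G3 G4 G5 G6 F3 Hc3.
      have G7 : g3 vB = b by rewrite F3.
      have G8 : g3 vBk = Bk by rewrite F3.
      apply: wp_seq; apply: wp_if => //=; rewrite G2 G8.
      - move=> h0; apply: wp_skip; apply: last => //=; last by lia.
        move=> e He; case: ltnP => // h.
        have [|Ee E] := Eblk e; first by lia.
        by case: h0; rewrite -E modnMl.
      - move=> h0; wasg (b + PP %/ Bk); rewrite ?G2 ?G7 ?G8 //; first wsafe.
        apply: (@wp_sto _ _ _ _ _ _ _ _ ((b + PP %/ Bk) * 17 + fBL) (b + N1));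
          rewrite /= ?G1 //; try wsafe.
        apply: last => //=.
        + by apply: keep_runs_update.
        + by move=> k f Hf; rewrite update_field //; [case: eqP => // E; lia|lia].
        + move=> e He; rewrite update_field //= eqn_add2l; case: ltnP => h.
            by case: eqP => // E; rewrite E in h; lia.
          have [|Ee E] := Eblk e; first by lia.
          by rewrite Ee eqxx.
        + apply: (fr_trans g3 _ [:: vT]) => //; last by apply/allP.
          move=> y Hy; have ne c' := notin_neq (c := c') Hy.
          by rewrite !rupd_neq ?ne.
        + lia.
    have frd v1 v2 y : y \notin reg -> rupd (rupd g2 vDD v1) vDD v2 y = g y.
      move=> Hy; have ne c' := notin_neq (c := c') Hy.
      by rewrite !rupd_neq ?ne ?Fr2.
    have frd1 v1 y : y \notin reg -> rupd g2 vDD v1 y = g y.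
      move=> Hy; have ne c' := notin_neq (c := c') Hy.
      by rewrite !rupd_neq ?ne ?Fr2.
    apply: wp_seq; apply: wp_if => /=; rewrite ?EEE2 ?EQQ2.
    * wsafe.
    * move=> h0; apply: (@wp_asg _ _ _ _ _ _ _ _ d); rewrite /= ?EEE2 ?EQQ2.
      - wsafe.
      - move: h0; rewrite Ed -rl subnDl; move: (_ - u) (Bk - _) => v q; clear; lia.
      - by apply: mid => //=; [apply: frd|clear; lia].
    * move=> h0; apply: wp_skip; apply: mid => //=; [|exact: frd1|clear; lia].
      move: h0; rewrite Ed -rl subnDl; move: (_ - u) (Bk - _) => v q; clear; lia.
  + rewrite EQQ2 EEE2 => Hge; have Eu : u = run_len T x by lia.
    rewrite {}Eu ?eqxx in H2 HN1 EQQ2 EPP2.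
    have SE : S (rcons L1 x) = S L1 + run_len T x.
      by rewrite /S map_rcons -cats1 sumn_cat /= addn0.
    apply: (@wp_asg _ _ _ _ _ _ _ _ (m2 ((b + x) * 17 + fLN))); rewrite /= ?ELST2 //.
      by wsafe.
    exists (size L2); first by [].
    exists (rcons L1 x), L2, N1; rewrite SE size_rcons; split=> //; split=> //=.
    * by rewrite EL cat_rcons.
    * split=> //.
        by move: HN1; move: (_ %/ _) (size L1) => q z /=; clear; lia.
      move=> y Hy; have ne c' := notin_neq (c := c') Hy.
      by rewrite !rupd_neq ?ne ?Fr2.
    * by move: Hc2; clear; lia.
- move=> h0; have L20 : L2 = [::].
    by case: L2 EL HL1 => // x L2 EL /= [E _]; rewrite h0 in E; lia.
  rewrite {}L20 cats0 in EL; rewrite -{}EL in H1 HN Hc.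
  rewrite /S sumL in H1 HN; rewrite szL in HN Hc.
  have nB : n %/ Bk < r by rewrite ltn_divLR //; have := ltn_blk; lia.
  have NR : N <= 2 * r by move: (n %/ Bk) nB HN => q; lia.
  by apply: (HQ _ _ _ N) => //; lia.
Qed.

Lemma dest_spec s N (Q : state -> Prop) :
  let m := mm s in let g := rg s in
  g vB = b -> g vBk = Bk -> g vNP = b + N -> made m N n -> N <= 2 * r ->
  (forall c g' m', pcs b N n Bk (fl T) ro m' N -> lag b m' N <= 4 * n ->
     (forall k f, f < 17 -> f != fCI -> m' (k * 17 + f) = m (k * 17 + f)) ->
     (forall y, y \notin [:: vJ; vT] -> g' y = g y) -> c <= clk s + 200 * b ->
     Q (State c g' m')) ->
  wp W sp set_dest Q s.
Proof.
case: s => c0 g m /= EB EBk ENP H HN HQ; rewrite /set_dest.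
have Bk0 := blk_gt0; have Bkn := blk_le.
wasg b => //.
pose I j (s : state) := exists i, j = N - i /\
  [/\ i <= N, rg s vJ = b + i,
     forall k, b <= k < b + i -> mm s (k * 17 + fCI) = m ((b + m (k * 17 + 1) %/ Bk) * 17 + fBL),
     (forall k f, f < 17 -> f != fCI -> mm s (k * 17 + f) = m (k * 17 + f)) /\
     (forall y, y \notin [:: vJ; vT] -> rg s y = g y) &
     clk s <= c0 + 10 + 60 * i].
have outn k : b <= k < b + N -> m (k * 17 + 1) < n.
  move=> Hk; have [d0 _ _] := made_range H Hk.
  have [E _] := made_fl H Hk d0; rewrite addn0 in E; rewrite -[m (k * 17 + 1)]addn0 -E.
  exact: fl_lt.
have blk_of k : b <= k < b + N ->
    b <= m ((b + m (k * 17 + 1) %/ Bk) * 17 + fBL) < b + N /\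
    m (m ((b + m (k * 17 + 1) %/ Bk) * 17 + fBL) * 17 + 0) = m (k * 17 + 1) %/ Bk * Bk.
  by move=> Hk; apply: (made_block H); apply: leq_ltn_trans (leq_divM _ _) (outn _ Hk).
apply: (@wp_while _ _ _ _ _ _ I N).
  exists 0; split; first by rewrite subn0.
  split=> //=; [by rewrite addn0|by move=> k; lia| |lia].
  split=> // y Hy; have ne c' := notin_neq (c := c') Hy.
  by rewrite !rupd_neq ?ne.
move=> j c g1 m1 [i [-> /= [iN EJ HC [Hm Fr] Hc]]].
have ENP1 : g1 vNP = b + N by rewrite Fr.
have EB1 : g1 vB = b by rewrite Fr.
have EBk1 : g1 vBk = Bk by rewrite Fr.
split=> //.
- rewrite EJ ENP1 => Hlt; have {}Hlt : i < N by lia.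
  have Hid : b <= b + i < b + N by lia.
  have qn := outn _ Hid.
  have dv := blk_div qn.
  wasg (b + m ((b + i) * 17 + 1) %/ Bk); rewrite ?EB1 ?EBk1 ?EJ ?Hm //.
    by move: (_ %/ _) dv => q dv; wsafe.
  wsto ((b + i) * 17 + fCI) (m ((b + m ((b + i) * 17 + 1) %/ Bk) * 17 + fBL));
    rewrite ?EJ ?Hm //; try by move: (_ %/ _) dv => q dv; wsafe.
  apply: (@wp_asg _ _ _ _ _ _ _ _ (b + i + 1)); rewrite /= ?EJ //; first wsafe.
  exists (N - i.+1); first by lia.
  exists i.+1; split=> //; split=> //=.
  + by lia.
  + move=> k Hk; rewrite update_field //=; case: eqP => [-> //|ne].
    by apply: HC; lia.
  + split.
      by move=> k f f17 nf; rewrite update_field // (negbTE nf) /= Hm.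
    move=> y Hy; have ne c' := notin_neq (c := c') Hy.
    by rewrite !rupd_neq ?ne ?Fr.
  + lia.
- rewrite EJ ENP1 => Hge; have Ei : i = N by lia.
  rewrite {}Ei in HC Hc.
  apply: HQ => //; last by lia.
  + split; rewrite ?Hm //.
    * move=> k Hk; rewrite !Hm //.
      by have [? ? _] := made_range H Hk.
    * by move=> k o Hk; rewrite !Hm //; apply: (made_fl H Hk).
    * move=> k l x Hk Hl; rewrite !Hm // => xk xl.
      case: (ltngtP k l) => // kl.
      - by have := @made_mono _ _ _ H k l; lia.
      - by have := @made_mono _ _ _ H l k; lia.
    * move=> k Hk; rewrite !Hm //; have [-> ->] := made_next H Hk.
      by case: ltnP => h; [right|left]; lia.
    * move=> k Hk; rewrite HC // !Hm //; have [h1 ->] := blk_of _ Hk.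
      by split=> //; apply: leq_divM.
    * by move=> k Hk; rewrite Hm //; have [_ _ h] := made_range H Hk; lia.
    * by rewrite leq_addr.
  + have : lag b m1 N <= \sum_(k <- iota b N) Bk.
      rewrite /lag !big_seq; apply: leq_sum => k; rewrite mem_iota => Hk.
      rewrite HC // !Hm //; have [_ ->] := blk_of _ Hk.
      have := divn_eq (m (k * 17 + 1)) Bk; have := @ltn_pmod (m (k * 17 + 1)) _ Bk0.
      by move: (_ %/ _ * _) => q; lia.
    rewrite sum_const_iota => h; apply: leq_trans h _.
    apply: leq_trans (_ : 2 * r * Bk <= _); first by rewrite leq_mul2r HN orbT.
    by rewrite -mulnA; have := blk_mul_le; move: (r * Bk) => q; lia.
Qed.

End Make.

(** * Scanning the text *)

Definition record_head : cmd :=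
  If (EV vI =' get fRS vR)
    (put fIR vIR (EV vR) ;; put fIJ vIR (EV vJ) ;; Asg vIR (EV vIR +' EC 1)) Skip.

Definition record_phi : cmd :=
  Asg vT (EV vR +' EC 1) ;;
  If (EV vI +' EC 1 =' get fRS vT) (put fPHI vT (EV vJ)) Skip.

Definition record_sample : cmd :=
  If (EV vJ %' EV vBk) Skip
    (Asg vT (EV vB +' EV vJ /' EV vBk) ;; put fSK vT (EV vK) ;; put fSI vT (EV vI)).

Definition scan_text : cmd :=
  Asg vK (get fBL vB) ;;
  Asg vI (EC 0) ;;
  Asg vJ (EC 0) ;;
  Asg vIR (EV vB) ;;
  While (EV vJ <' EV vN)
    (fl_step ;; record_head ;; record_phi ;; record_sample ;;
     Asg vJ (EV vJ +' EC 1)).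

Section Scan.

Variables (T : seq nat) (W N0 : nat).
Let n := size T.
Let r := nruns T.
Let b := r.+1.
Let sp := 136 * r.
Let Bk := blk T.

Local Notation pcs := (pcs b N0 n Bk (fl T) (ro T)).
Local Notation nstarts := (nstarts b).
Local Notation keep := (keep b).
Local Notation pot := (pot b N0).

Definition irr_pre (j : nat) : seq nat := [seq x <- iota 0 j | run_start T (ISA T x)].

Definition only (s : seq nat) (m m' : nat -> nat) : Prop :=
  forall k f, f < 17 -> f \notin s -> m' (k * 17 + f) = m (k * 17 + f).

Lemma only_update s m m' k f v : f \in s -> f < 17 -> only s m m' ->
  only s m (update m' (k * 17 + f) v).
Proof.
move=> fs f17 H j g g17 gs; rewrite update_field //; case: eqP => [E|_]; last exact: H.
by rewrite E fs in gs.
Qed.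

Definition tab_runs (m : nat -> nat) : Prop :=
  (forall k, k <= r -> m ((b + k) * 17 + fRS) = rsn T k) /\
  (forall k, k < r -> m ((b + k) * 17 + fCH) = rchar T k).

Definition tab_irr (m : nat -> nat) (j : nat) : Prop :=
  forall i, i < size (irr_pre j) ->
    m ((b + i) * 17 + fIJ) = nth 0 (irr_pre j) i /\
    m ((b + i) * 17 + fIR) = ro T (ISA T (nth 0 (irr_pre j) i)).

Definition tab_phi (m : nat -> nat) (j : nat) : Prop :=
  forall k, 0 < k < r -> nth 0 (SA T) (rsn T k).-1 < j ->
    m ((b + k) * 17 + fPHI) = nth 0 (SA T) (rsn T k).-1.

Definition tab_samples (m : nat -> nat) (N j : nat) : Prop :=
  forall e, e * Bk < j ->
    [/\ b <= m ((b + e) * 17 + fSK) < b + N,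
        m (m ((b + e) * 17 + fSK) * 17 + 0) <= m ((b + e) * 17 + fSI) <=
          m (m ((b + e) * 17 + fSK) * 17 + 0) + Bk &
        m ((b + e) * 17 + fSI) = ISA T (e * Bk)].

Lemma only_same s m m' : all (fun f => 6 <= f) s -> only s m m' -> same_pieces b m m'.
Proof.
move=> Hs H k f _ Hf; apply: H; first by lia.
by apply/negP => /(allP Hs); lia.
Qed.

Lemma only_runs s m m' : all (fun f => 8 <= f) s -> only s m m' ->
  tab_runs m -> tab_runs m'.
Proof.
move=> Hs H [h1 h2]; have nf f : f < 8 -> f \notin s.
  by move=> Hf; apply/negP => /(allP Hs); lia.
by split=> k Hk; rewrite H ?nf // ?h1 ?h2.
Qed.

Lemma tab_runs_keep m m' : keep m m' -> tab_runs m -> tab_runs m'.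
Proof. by move=> K [h1 h2]; split=> k Hk; rewrite (keep_field _ K) // ?h1 ?h2. Qed.

Lemma tab_irr_keep m m' j : keep m m' -> tab_irr m j -> tab_irr m' j.
Proof. by move=> K h i Hi; rewrite !(keep_field _ K) //; apply: h. Qed.

Lemma tab_phi_keep m m' j : keep m m' -> tab_phi m j -> tab_phi m' j.
Proof. by move=> K h k Hk Hj; rewrite !(keep_field _ K) //; apply: h. Qed.

Lemma tab_samples_keep m m' N N' j : keep m m' -> N <= N' ->
  (forall k, b <= k < b + N -> m' (k * 17 + 0) = m (k * 17 + 0)) ->
  tab_samples m N j -> tab_samples m' N' j.
Proof.
move=> K le E h e He; have [h1 h2 h3] := h e He.
have E14 := keep_field (b + e) K (isT : 6 <= fSK < 17).
have E15 := keep_field (b + e) K (isT : 6 <= fSI < 17).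
by rewrite E14 E15 (E _ h1); split=> //; lia.
Qed.

Definition scanned (m : nat -> nat) (N : nat) : Prop :=
  [/\ pcs m N, tab_runs m, tab_irr m n, tab_phi m n & tab_samples m N n].

Hypothesis termT : terminated T.

Hypothesis W_ge : sp + 2 * n + 100 <= W.
Hypothesis N0_le : N0 <= 2 * r.

Let r_gt0 : 0 < r. Proof. exact: nruns_gt0. Qed.
Let r_le : r <= n. Proof. exact: nruns_le. Qed.
Let n_gt0 : 0 < n. Proof. exact: term_size. Qed.

Lemma irr_preS j :
  irr_pre j.+1 = if run_start T (ISA T j) then rcons (irr_pre j) j else irr_pre j.
Proof. by rewrite /irr_pre -addn1 iotaD filter_cat /= add0n; case: ifP; rewrite ?cats1 ?cats0. Qed.

Lemma size_irr_pre j : j <= n -> size (irr_pre j) <= r.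
Proof.
move=> Hj; rewrite -[leqRHS](size_irr T) /irr -/n -(subnKC Hj) iotaD filter_cat.
by rewrite size_cat leq_addr.
Qed.

Lemma fl_hyps : [/\ forall x y, x < n -> y < n -> fl T x = fl T y -> x = y,
  forall x, x < n -> fl T x < n & (b + 2 * N0 + 2) * 17 <= sp].
Proof.
split; first by move=> x y; apply: fl_inj.
  by move=> x _; apply: fl_lt.
by rewrite /sp /b; lia.
Qed.

Lemma ro_run j : j < n -> exists2 k, k < r & ro T (ISA T j) = b + k /\
  rsn T k <= ISA T j < rsn T k.+1.
Proof.
move=> Hj; have [k Hk h] := run_exists termT (ISA_lt Hj).
by exists k => //; rewrite /ro (run_ofE Hk h).
Qed.

Lemma head_spec s j k (Q : state -> Prop) :
  let m := mm s in let g := rg s in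
  j < n -> k < r -> rsn T k <= ISA T j < rsn T k.+1 -> ro T (ISA T j) = b + k ->
  g vI = ISA T j -> g vR = b + k -> g vJ = j -> g vIR = b + size (irr_pre j) ->
  tab_runs m -> tab_irr m j ->
  (forall c g' m', only [:: fIR; fIJ] m m' -> tab_irr m' j.+1 ->
     g' vIR = b + size (irr_pre j.+1) -> (forall y, y != vIR -> g' y = g y) ->
     c <= clk s + 50 -> Q (State c g' m')) ->
  wp W sp record_head Q s.
Proof.
case: s => c0 g m /= Hj Hk Hin Ero EI ER EJ EIR [HS HC] HT HQ.
have Ers := run_startE Hk Hin.
have szl := size_irr_pre Hj; rewrite irr_preS Ers in szl.
have rsk := HS k (ltnW Hk).
rewrite /record_head; apply: wp_if => /=; rewrite ?ER ?EI ?rsk.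
- wsafe.
- move=> h; have {h}E : ISA T j == rsn T k by case: eqP h.
  rewrite E size_rcons in szl.
  have Ej : irr_pre j.+1 = rcons (irr_pre j) j by rewrite irr_preS Ers E.
  wsto ((b + size (irr_pre j)) * 17 + fIR) (b + k); rewrite ?EIR //; try wsafe.
  wsto ((b + size (irr_pre j)) * 17 + fIJ) j; rewrite ?EIR //; try wsafe.
  apply: (@wp_asg _ _ _ _ _ _ _ _ (b + size (irr_pre j) + 1)); rewrite /= ?EIR //; first wsafe.
  apply: HQ => //=.
  + by do 2 apply: only_update => //.
  + move=> i; rewrite Ej size_rcons ltnS => Hi; rewrite !update_field //= eqn_add2l nth_rcons.
    move: Hi; rewrite leq_eqVlt => /orP[/eqP ->|h]; first by rewrite eqxx ltnn Ero.
    by rewrite h (ltn_eqF h); apply: HT.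
  + by rewrite Ej size_rcons addn1 addnS.
  + by move=> y Hy; rewrite rupd_neq.
  + lia.
- move=> h; have {h}E : (ISA T j == rsn T k) = false by case: eqP h.
  have Ej : irr_pre j.+1 = irr_pre j by rewrite irr_preS Ers E.
  apply: wp_skip; apply: HQ => //; last by lia.
  + by rewrite /tab_irr Ej.
  + by rewrite EIR Ej.
Qed.

Lemma phi_spec s j k (Q : state -> Prop) :
  let m := mm s in let g := rg s in
  j < n -> k < r -> rsn T k <= ISA T j < rsn T k.+1 ->
  g vI = ISA T j -> g vR = b + k -> g vJ = j ->
  tab_runs m -> tab_phi m j ->
  (forall c g' m', only [:: fPHI] m m' -> tab_phi m' j.+1 ->
     (forall y, y != vT -> g' y = g y) ->
     c <= clk s + 50 -> Q (State c g' m')) ->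
  wp W sp record_phi Q s.
Proof.
case: s => c0 g m /= Hj Hk Hin EI ER EJ [HS HC] HT HQ.
have rsk := HS k.+1 Hk.
have In := ISA_lt Hj.
have rsn_eq l : 0 < l < r -> nth 0 (SA T) (rsn T l).-1 = j ->
    ISA T j = (rsn T l).-1 /\ l = k.+1.
  move=> Hl E.
  have l0 : 0 < rsn T l by have := @rsn_mono T 0 l; rewrite (rsn0 termT); lia.
  have ln : rsn T l < n by apply: rsn_lt; lia.
  have E' : ISA T j = (rsn T l).-1 by rewrite -E ISA_SA //; lia.
  split=> //.
  have Hl1 : l.-1 < r by lia.
  have : l.-1 = k; last by lia.
  have := rsn_next Hl1; rewrite prednK; last by lia.
  move=> h; apply: (@run_uniq T (ISA T j)) => //.
  by rewrite prednK; lia.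
rewrite /record_phi; wasg (b + k.+1); rewrite ?ER //; [wsafe|by lia|].
apply: wp_if => /=; rewrite ?EI ?rsk.
- wsafe.
- move=> h; have {h}E : ISA T j + 1 = rsn T k.+1 by case: eqP h.
  apply: (@wp_sto _ _ _ _ _ _ _ _ ((b + k.+1) * 17 + fPHI) j); rewrite /= //; try wsafe.
  apply: HQ => //=.
  + by apply: only_update.
  + move=> l Hl; rewrite ltnS leq_eqVlt update_field //= eqn_add2l.
    have [El|/eqP ne] := eqVneq l k.+1 => h.
      by rewrite El -E addn1 /= SA_ISA.
    apply: HT => //; case/orP: h => // /eqP E'.
    by have [_ /ne] := rsn_eq _ Hl E'.
  + by move=> y Hy; rewrite rupd_neq.
  + lia.
- move=> h; have {h}E : ISA T j + 1 <> rsn T k.+1 by case: eqP h.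
  apply: wp_skip; apply: HQ => //=.
  + move=> l Hl; rewrite ltnS leq_eqVlt => /orP[/eqP E'|]; last exact: HT.
    have [h1 h2] := rsn_eq _ Hl E'; rewrite h2 in h1.
    by have := @rsn_next T k Hk; lia.
  + by move=> y Hy; rewrite rupd_neq.
  + lia.
Qed.

Lemma sample_spec s N j (Q : state -> Prop) :
  let m := mm s in let g := rg s in
  j < n -> g vB = b -> g vBk = Bk -> g vJ = j ->
  b <= g vK < b + N -> m (g vK * 17 + 0) <= g vI <= m (g vK * 17 + 0) + Bk ->
  g vI = ISA T j -> tab_samples m N j ->
  (forall c g' m', only [:: fSK; fSI] m m' -> tab_samples m' N j.+1 ->
     (forall y, y != vT -> g' y = g y) ->
     c <= clk s + 50 -> Q (State c g' m')) ->
  wp W sp record_sample Q s.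
Proof.
case: s => c0 g m /= Hj EB EBk EJ HK HI EI HT HQ.
have Bk0 : 0 < Bk by exact: blk_gt0.
have dv := blk_div termT Hj.
have de := divn_eq j Bk.
rewrite -/r -/Bk in dv.
rewrite /record_sample; apply: wp_if => //=; rewrite ?EJ ?EBk => h.
- apply: wp_skip; apply: HQ => //=; last by lia.
  move=> e; rewrite ltnS leq_eqVlt => /orP[/eqP E|]; last exact: HT.
  by case: h; rewrite -E modnMl.
- rewrite h addn0 in de.
  have [q Eq] : exists q, q = j %/ Bk by eexists.
  rewrite -Eq in dv de.
  wasg (b + q); rewrite ?EJ ?EBk ?EB -?Eq //; first wsafe.
  wsto ((b + q) * 17 + fSK) (g vK); rewrite //; try wsafe.
  apply: (@wp_sto _ _ _ _ _ _ _ _ ((b + q) * 17 + fSI) (g vI)); rewrite /= //; try wsafe.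
  apply: HQ => //=.
  + by do 2 apply: only_update => //.
  + move=> e; rewrite ltnS leq_eqVlt !update_field //= eqn_add2l => /orP[/eqP E|lt].
      have -> : e = q.
        by apply/eqP; rewrite -(eqn_pmul2r Bk0) E -de.
      by rewrite eqxx -de.
    have [h1 h2 h3] := HT e lt.
    case: eqP => [Ee|_]; first by rewrite Ee -de ltnn in lt.
    by [].
  + by move=> y Hy; rewrite rupd_neq.
  + lia.
Qed.

Lemma scan_spec s N (Q : state -> Prop) :
  let m := mm s in let g := rg s in
  pcs m N -> tab_runs m -> b <= m (b * 17 + fBL) < b + N ->
  m (m (b * 17 + fBL) * 17 + 0) = 0 ->
  g vB = b -> g vN = n -> g vBk = Bk -> g vNP = b + N ->
  (forall c g' m' N', scanned m' N' -> g' vNP = b + N' ->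
     (forall y, y < 4 -> g' y = g y) ->
     c + 1000 * pot m' N' <= clk s + 1000 * pot m N + 1300 * n + 50 ->
     Q (State c g' m')) ->
  wp W sp scan_text Q s.
Proof.
case: s => c0 g m /= H HR HK HK0 EB EN EBk ENP HQ; rewrite /scan_text.
have [fi fl_n sp_ge] := fl_hyps.
have NB := pcs_size fi H.
have Bk0 : 0 < Bk by exact: blk_gt0.
wasg (m (b * 17 + fBL)); rewrite ?EB //; first wsafe.
wasg 0 => //; first wsafe.
wasg 0 => //; first wsafe.
wasg b => //.
pose I i (s : state) := exists N1 j, i = n - j /\
  [/\ [/\ j <= n, rg s vJ = j, rg s vNP = b + N1, rg s vIR = b + size (irr_pre j) &
          forall y, y < 4 -> rg s y = g y],
      pcs (mm s) N1 /\ tab_runs (mm s),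
      [/\ tab_irr (mm s) j, tab_phi (mm s) j & tab_samples (mm s) N1 j],
      [/\ b <= rg s vK < b + N1, mm s (rg s vK * 17 + 0) <= rg s vI < n,
          nstarts (mm s) N1 (mm s (rg s vK * 17 + 0)) (rg s vI) = 0 &
          j < n -> fl T (rg s vI) = ISA T j] &
      clk s + 1000 * pot (mm s) N1 <= c0 + 1000 * pot m N + 1300 * j + 30].
apply: (@wp_while _ _ _ _ _ _ I n).
  exists N, 0; split; first by rewrite subn0.
  split=> //=.
  - split=> //; first by rewrite addn0.
    by move=> y Hy; rewrite !rupd_neq //; apply/eqP; lia.
  - rewrite HK0; split=> //.
      by have := nstarts_leq 0 0 H; rewrite leqn0 => /eqP.
    have := @fl_ISA T n.-1; rewrite (ISA_last termT) prednK // modnn.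
    by move=> E _; apply: E.
  - lia.
move=> i c g1 m1 [N1 [j [-> /= [[jn EJ ENP1 EIR Fr] [H1 HR1] [T1 T2 T3] [HK1 HI1 Hns Efl] Hc]]]].
have EN1 : g1 vN = n by rewrite Fr.
split=> //.
- rewrite EJ EN1 => Hlt; have {}Hlt : j < n by lia.
  have {}Efl := Efl Hlt.
  apply: wp_seq; apply: (@fl_spec _ _ b N0 n Bk (fl T) (ro T) fi fl_n sp_ge W_ge isT _ N1) => //=.
  move=> c2 g2 m2 N2 F2 ENP2 H2 leN K2 P2 HK2 HI2 EI2 ER2 Hc2.
  rewrite Efl in EI2 ER2; rewrite Hns in Hc2.
  have [k Hk [Ero Hin]] := ro_run Hlt; rewrite Ero in ER2.
  have {}HR1 := tab_runs_keep K2 HR1.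
  have {}T1 := tab_irr_keep K2 T1.
  have {}T2 := tab_phi_keep K2 T2.
  have {}T3 := tab_samples_keep K2 leN P2 T3.
  have len2 := piece_len H2 HK2.
  have nst2 := nstarts0 H2 HK2 (proj2 (andP HI2)).
  have [_ rg2 _] := pcs_range fi sp_ge W_ge isT H2 HK2.
  have G x : x \notin iota 4 8 -> g2 x = g1 x := F2 x.
  have GJ : g2 vJ = j by rewrite G.
  have GIR : g2 vIR = b + size (irr_pre j) by rewrite G.
  have GB : g2 vB = b by rewrite G // Fr.
  have GBk : g2 vBk = Bk by rewrite G // Fr.
  apply: wp_seq; apply: (@head_spec _ j k) => //=.
  move=> c3 g3 m3 O3 T1' EIR3 F3 Hc3.
  have S3 := only_same (isT : all (fun f => 6 <= f) [:: fIR; fIJ]) O3.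
  apply: wp_seq; apply: (@phi_spec _ j k) => //=; rewrite ?F3 //.
  + exact: (only_runs _ O3 HR1).
  + by move=> l Hl Hl'; rewrite O3 //; apply: T2.
  move=> c4 g4 m4 O4 T2' F4 Hc4.
  have S4 := only_same (isT : all (fun f => 6 <= f) [:: fPHI]) O4.
  apply: wp_seq; apply: (@sample_spec _ N2 j) => //=; rewrite ?F4 ?F3 //.
  + by rewrite O4 // O3 //; lia.
  + move=> e He; have [h1 h2 h3] := T3 e He.
    by rewrite !(O4 _ fSK) // !(O3 _ fSK) // !(O4 _ 0) // !(O3 _ 0) // !(O4 _ fSI) // !(O3 _ fSI).
  move=> c5 g5 m5 O5 T3' F5 Hc5.
  have S5 := only_same (isT : all (fun f => 6 <= f) [:: fSK; fSI]) O5.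
  have H3 := same_pcs S3 H2; have H4 := same_pcs S4 H3; have H5 := same_pcs S5 H4.
  have GG x : x \notin iota 4 8 -> x != vIR -> x != vT -> g5 x = g1 x.
    by move=> x1 x2 x3; rewrite F5 // F4 // F3 // G.
  have GK : g5 vK = g2 vK by rewrite F5 // F4 // F3.
  have GI : g5 vI = g2 vI by rewrite F5 // F4 // F3.
  have bK : b <= g2 vK by case/andP: HK2.
  apply: (@wp_asg _ _ _ _ _ _ _ _ (j + 1)); rewrite /= ?(GG vJ) ?EJ //; first wsafe.
  exists (n - j.+1); first by lia.
  exists N2, j.+1; split=> //; split=> //=.
  + split=> //; first by rewrite addn1.
    * by rewrite F5 // F4 // F3.
    * by rewrite F5 // F4 // EIR3.
    * move=> y Hy; rewrite rupd_neq; last by apply/eqP; lia.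
      rewrite GG ?Fr //; try (by apply/eqP; lia).
      by rewrite mem_iota; lia.
  + split=> //; apply: (only_runs _ O5) => //; apply: (only_runs _ O4) => //.
    exact: (only_runs _ O3 HR1).
  + split=> //.
    * by move=> e He; rewrite !O5 // !O4 //; apply: T1'.
    * by move=> e He Hj'; rewrite !O5 //; apply: T2'.
  + rewrite GK GI S5 // S4 // S3 //; split=> //.
    * by lia.
    * by rewrite (same_nstarts _ _ _ S5) (same_nstarts _ _ _ S4) (same_nstarts _ _ _ S3).
    * by move=> h; rewrite EI2 fl_ISA // modn_small.
  + rewrite (same_pot S5 H4) (same_pot S4 H3) (same_pot S3 H2); lia.
- rewrite EJ EN1 => Hge; have Ej : j = n by lia.
  rewrite {}Ej in T1 T2 T3 Hc.
  by apply: (HQ _ _ _ N1) => //; lia.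
Qed.

End Scan.

(** * Kasai's algorithm on the irreducible positions *)

Definition access : cmd :=
  Asg vU (EV vT %' EV vBk) ;;
  Asg vT (EV vB +' EV vT /' EV vBk) ;;
  Asg vK (get fSK vT) ;;
  Asg vI (get fSI vT) ;;
  While (EV vU) (fl_step ;; Asg vU (EV vU -' EC 1)).

Definition compare_step : cmd :=
  Asg vK (EV vK1) ;; Asg vI (EV vI1) ;;
  fl_step ;;
  Asg vK1 (EV vK) ;; Asg vI1 (EV vI) ;; Asg vR1 (get fCH vR) ;;
  Asg vK (EV vK2) ;; Asg vI (EV vI2) ;;
  fl_step ;;
  Asg vK2 (EV vK) ;; Asg vI2 (EV vI) ;;
  If (get fCH vR =' EV vR1) (Asg vL (EV vL +' EC 1)) (Asg vGO (EC 0)).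

Definition extend : cmd := Asg vGO (EC 1) ;; While (EV vGO) compare_step.

Definition plcp_next : cmd :=
  Asg vT (EV vJ +' EV vL) ;;
  access ;;
  Asg vK1 (EV vK) ;;
  Asg vI1 (EV vI) ;;
  Asg vT (EV vDD +' EV vL) ;;
  access ;;
  Asg vK2 (EV vK) ;;
  Asg vI2 (EV vI) ;;
  extend ;;
  Sto (EV vOut) (EV vL) ;;
  Asg vEN (EV vJ +' EV vL) ;;
  Asg vOut (EV vOut +' EC 1).

Definition kasai : cmd :=
  Asg vOut (EC 0) ;;
  Asg vEN (EC 0) ;;
  While (EV vOut +' EC 1 <' EV vRn)
    (Asg vT (EV vB +' EV vOut) ;;
     Asg vJ (get fIJ vT) ;;
     Asg vT (get fIR vT) ;;
     Asg vDD (get fPHI vT) ;;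
     If (EV vJ <' EV vEN) (Asg vL (EV vEN -' EV vJ)) (Asg vL (EC 0)) ;;
     plcp_next) ;;
  Sto (EV vOut) (EC 0).

Section Kasai.

Variables (T : seq nat) (W N0 : nat).
Hypothesis termT : terminated T.

Let n := size T.
Let r := nruns T.
Let b := r.+1.
Let sp := 136 * r.
Let Bk := blk T.

Hypothesis W_ge : sp + 2 * n + 100 <= W.
Hypothesis N0_le : N0 <= 2 * r.

Let r_gt0 : 0 < r. Proof. exact: nruns_gt0. Qed.
Let r_le : r <= n. Proof. exact: nruns_le. Qed.
Let n_gt0 : 0 < n. Proof. exact: term_size. Qed.

Local Notation pcs := (pcs b N0 n Bk (fl T) (ro T)).
Local Notation nstarts := (nstarts b).
Local Notation keep := (keep b).
Local Notation pot := (pot b N0).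
Local Notation scanned := (scanned T N0).

Lemma scanned_keep m m' N N' : pcs m' N' -> keep m m' -> N <= N' ->
  (forall k, b <= k < b + N -> m' (k * 17 + 0) = m (k * 17 + 0)) ->
  scanned m N -> scanned m' N'.
Proof.
move=> H' K le E [_ h1 h2 h3 h4]; split=> //.
- exact: tab_runs_keep K h1.
- exact: tab_irr_keep K h2.
- exact: tab_phi_keep K h3.
- exact: tab_samples_keep K le E h4.
Qed.

Lemma scanned_high m m' N : (forall a, b * 17 <= a -> m' a = m a) ->
  scanned m N -> scanned m' N.
Proof.
move=> E [h0 [h1 h1'] h2 h3 h4].
have Ef k f : m' ((b + k) * 17 + f) = m ((b + k) * 17 + f) by apply: E; lia.
split.
- by apply: same_pcs h0 => k f Hk _; apply: E; lia.
- by split=> k Hk; rewrite Ef; [apply: h1|apply: h1'].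
- by move=> i Hi; rewrite !Ef; apply: h2.
- by move=> k Hk Hj; rewrite Ef; apply: h3.
- move=> e He; have [a1 a2 a3] := h4 e He.
  have h : b * 17 <= m ((b + e) * 17 + fSK) * 17 + 0.
    by case/andP: a1 => a1 _; rewrite addn0 leq_mul2r.
  by rewrite !Ef (E _ h).
Qed.

Lemma char_of m x : tab_runs T m -> x < n ->
  b <= ro T x < b + r /\ m (ro T x * 17 + fCH) = nth 0 (BWT T) x.
Proof.
move=> [_ HC] Hx; have [k Hk h] := run_exists termT Hx.
rewrite /ro (run_ofE Hk h) HC //; split; first by rewrite -/r /b; lia.
by rewrite (BWT_run Hk h).
Qed.

Definition same_starts (m m' : nat -> nat) (N N' : nat) : Prop :=
  N <= N' /\ forall k, b <= k < b + N -> m' (k * 17 + 0) = m (k * 17 + 0).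

Lemma same_starts_trans m1 m2 m3 N1 N2 N3 :
  same_starts m1 m2 N1 N2 -> same_starts m2 m3 N2 N3 -> same_starts m1 m3 N1 N3.
Proof.
move=> [l1 h1] [l2 h2]; split; first by lia.
by move=> k Hk; rewrite h2 ?h1 //; lia.
Qed.

Lemma access_spec s N t (Q : state -> Prop) :
  let m := mm s in let g := rg s in
  scanned m N -> g vNP = b + N -> g vB = b -> g vBk = Bk -> g vT = t -> t < n ->
  (forall c g' m' N', scanned m' N' -> g' vNP = b + N' -> same_starts m m' N N' ->
     keep m m' -> (forall y, y \notin [:: vT, vU & iota 4 8] -> g' y = g y) ->
     b <= g' vK < b + N' -> m' (g' vK * 17 + 0) <= g' vI -> g' vI = ISA T t ->
     nstarts m' N' (m' (g' vK * 17 + 0)) (g' vI) <= Bk ->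
     c + 1000 * pot m' N' <= clk s + 1000 * pot m N + 3000 * (Bk + 1) ->
     Q (State c g' m')) ->
  wp W sp access Q s.
Proof.
case: s => c0 g m /= HS ENP EB EBk ET Ht HQ; rewrite /access.
have [fi fl_n sp_ge] := fl_hyps termT W_ge N0_le.
have Bk0 : 0 < Bk by exact: blk_gt0.
have dv := blk_div termT Ht; rewrite -/r -/Bk in dv.
have de := divn_eq t Bk; have md := ltn_pmod t Bk0.
have [q Eq] : exists q, q = t %/ Bk by eexists.
have [u0 Eu] : exists u, u = t %% Bk by eexists.
rewrite -?Eq -?Eu in dv de md.
have [H _ _ _ HT] := HS.
have [|h1 h2 h3] := HT q; first by rewrite -/Bk -/n; lia.
rewrite -/r -/b -/Bk in h1 h2 h3.
have NB := pcs_size fi H.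
wasg u0; rewrite ?ET ?EBk -?Eu //.
wasg (b + q); rewrite ?ET ?EBk ?EB -?Eq //; first wsafe.
wasg (m ((b + q) * 17 + fSK)) => //; first wsafe.
wasg (m ((b + q) * 17 + fSI)) => //; first wsafe.
pose I i (s : state) := exists N1, i = rg s vU /\
  [/\ rg s vU <= u0, [/\ scanned (mm s) N1, rg s vNP = b + N1,
        same_starts m (mm s) N N1, keep m (mm s) &
        forall y, y \notin [:: vT, vU & iota 4 8] -> rg s y = g y],
      b <= rg s vK < b + N1,
      [/\ mm s (rg s vK * 17 + 0) <= rg s vI, rg s vI = ISA T (t - rg s vU) &
       nstarts (mm s) N1 (mm s (rg s vK * 17 + 0)) (rg s vI) <= Bk] &
      clk s + 1000 * pot (mm s) N1 +
        1000 * nstarts (mm s) N1 (mm s (rg s vK * 17 + 0)) (rg s vI) <=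
      c0 + 1000 * pot m N + 1000 * Bk + 1100 * (u0 - rg s vU) + 50].
apply: (@wp_while _ _ _ _ _ _ I u0).
  have hs := nstarts_leq (m (m ((b + q) * 17 + fSK) * 17 + 0)) (m ((b + q) * 17 + fSI)) H.
  have {}hs := leq_trans hs (_ : _ <= Bk).
  have {}hs := hs ltac:(lia).
  exists N; split=> //; split=> //=.
  - split=> //; move=> y Hy; have ne c' := notin_neq (c := c') Hy.
    by rewrite !rupd_neq ?ne.
  - split; first by case/andP: h2.
      by rewrite h3; congr ISA; lia.
    exact: hs.
  - by move: hs; set z := nstarts _ _ _ _; lia.
move=> i c g1 m1 [N1 [-> /= [uu [HS1 ENP1 SS1 K1 F1] HK1 [HI1 EI1 Hns1] Hc1]]].
split=> //.
- move=> Hu; have [H1 _ _ _ _] := HS1.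
  have tu : t - g1 vU < n by lia.
  have In := ISA_lt tu; rewrite -EI1 in In.
  apply: wp_seq; apply: (@fl_spec _ _ b N0 n Bk (fl T) (ro T) fi fl_n sp_ge W_ge isT _ N1) => //=.
    by rewrite HI1.
  move=> c2 g2 m2 N2 F2 ENP2 H2 leN K2 P2 HK2 HI2 EI2 _ Hc2.
  have EU2 : g2 vU = g1 vU by rewrite F2.
  have SS2 : same_starts m1 m2 N1 N2 by [].
  have nst2 := nstarts0 H2 HK2 (proj2 (andP HI2)).
  apply: (@wp_asg _ _ _ _ _ _ _ _ (g1 vU - 1)); rewrite /= ?EU2 //; first wsafe.
  exists (g1 vU - 1); first by lia.
  exists N2; split=> //; split=> //=.
  + by lia.
  + split=> //.
    * exact: scanned_keep H2 K2 leN P2 HS1.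
    * exact: same_starts_trans SS1 SS2.
    * exact: keep_trans K1 K2.
    * move=> y Hy; have ne c' := notin_neq (c := c') Hy.
      rewrite rupd_neq ?ne // F2 ?F1 //.
      by apply: contra Hy; rewrite !inE => ->; rewrite !orbT.
  + split; first by case/andP: HI2.
      rewrite EI2 EI1 fl_ISA // modn_small; last by lia.
      by congr ISA; lia.
    by rewrite nst2.
  + rewrite nst2; lia.
- move=> Hu.
  apply: (HQ _ _ _ N1) => //; first by rewrite EI1 Hu subn0.
  lia.
Qed.

(* The second summand pays for the pieces that a step on one pointer inserts
   behind the other one. *)
Definition gauge (m : nat -> nat) (N : nat) : nat := pot m N + (2 * N0 - N).

Lemma extend_spec s N j p (Q : state -> Prop) :
  let m := mm s in let g := rg s in
  let lc := lcp (drop p T) (drop j T) in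
  scanned m N -> g vNP = b + N -> j < n -> p < n -> p != j -> g vL <= lc ->
  b <= g vK1 < b + N -> m (g vK1 * 17 + 0) <= g vI1 -> g vI1 = ISA T (j + g vL) ->
  b <= g vK2 < b + N -> m (g vK2 * 17 + 0) <= g vI2 -> g vI2 = ISA T (p + g vL) ->
  (forall c g' m' N', scanned m' N' -> g' vNP = b + N' -> keep m m' -> g' vL = lc ->
     (forall y, y \notin [:: vK1, vI1, vK2, vI2, vR1, vGO, vL & iota 4 8] -> g' y = g y) ->
     c + 1000 * gauge m' N' <= clk s + 1000 * gauge m N +
        1000 * (nstarts m N (m (g vK1 * 17 + 0)) (g vI1) +
                nstarts m N (m (g vK2 * 17 + 0)) (g vI2)) +
        2300 * (lc - g vL + 1) + 20 ->
     Q (State c g' m')) ->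
  wp W sp extend Q s.
Proof.
case: s => c0 g m /= HS ENP Hj Hp pj HL HK1 HI1 EI1 HK2 HI2 EI2 HQ; rewrite /extend.
set lc := lcp _ _ in HL HQ.
have [fi fl_n sp_ge] := fl_hyps termT W_ge N0_le.
wasg 1 => //; first wsafe.
pose R := [:: vK1, vI1, vK2, vI2, vR1, vGO, vL & iota 4 8].
pose psi m1 N1 (g1 : nat -> nat) :=
  nstarts m1 N1 (m1 (g1 vK1 * 17 + 0)) (g1 vI1) +
  nstarts m1 N1 (m1 (g1 vK2 * 17 + 0)) (g1 vI2).
have FR g1 g2 x v : x \in R -> (forall y, y \notin R -> g2 y = g1 y) ->
    (forall y, y \notin R -> rupd g2 x v y = g1 y).
  move=> xR h y Hy; rewrite rupd_neq ?h //; exact: notin_neq Hy xR.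
have Ffl g1 g2 : (forall y, y \notin iota 4 8 -> g2 y = g1 y) ->
    (forall y, y \notin R -> g1 y = g y) -> (forall y, y \notin R -> g2 y = g y).
  move=> h1 h2 y Hy; rewrite h1 ?h2 //.
  by apply: contra Hy; rewrite !inE => ->; rewrite !orbT.
pose I i (s : state) := exists N1, i = rg s vGO + (lc - rg s vL) /\
  [/\ [/\ scanned (mm s) N1, rg s vNP = b + N1, keep m (mm s) &
         forall y, y \notin R -> rg s y = g y],
      g vL <= rg s vL <= lc, rg s vGO <= 1,
      (rg s vGO = 1 -> 
       [/\ b <= rg s vK1 < b + N1, mm s (rg s vK1 * 17 + 0) <= rg s vI1,
           rg s vI1 = ISA T (j + rg s vL) &
        [/\ b <= rg s vK2 < b + N1, mm s (rg s vK2 * 17 + 0) <= rg s vI2 &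
           rg s vI2 = ISA T (p + rg s vL)]]) /\
      (rg s vGO = 0 -> rg s vL = lc) &
      clk s + 1000 * gauge (mm s) N1 + 1000 * (rg s vGO * psi (mm s) N1 (rg s)) <=
      c0 + 1000 * gauge m N + 1000 * psi m N g +
        2300 * (rg s vL - g vL + (1 - rg s vGO)) + 10].
apply: (@wp_while _ _ _ _ _ _ I (1 + (lc - g vL))).
  exists N; split=> //; split=> //=.
  - by split=> //; apply: (FR _).
  - by rewrite leqnn.
  - by rewrite /psi /=; lia.
move=> i c g1 m1 [N1 [-> /= [[HS1 ENP1 K1 F1] /andP[HL0 HL1] HG [HG1 HG0] Hc]]].
have [Hlc1 Hlc2 Htest] := lcp_testE termT Hp Hj pj HL1.
split=> //.
- move=> HGn; have EG : g1 vGO = 1 by lia.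
  have [HK1' HI1' EI1' [HK2' HI2' EI2']] := HG1 EG.
  have [H1 _ _ _ _] := HS1.
  rewrite EG mul1n subnn addn0 in Hc.
  have In1 := ISA_lt Hlc2; rewrite -EI1' in In1.
  have In2 := ISA_lt Hlc1; rewrite -EI2' in In2.
  rewrite /compare_step; wasg (g1 vK1) => //; wasg (g1 vI1) => //.
  apply: wp_seq; apply: (@fl_spec _ _ b N0 n Bk (fl T) (ro T) fi fl_n sp_ge W_ge isT _ N1) => //=.
    by rewrite HI1'.
  move=> c2 g2 m2 N2 F2 ENP2 H2 leN2 K2 P2 HK2n HI2n EI2n ER2 Hc2.
  have HS2 := scanned_keep H2 K2 leN2 P2 HS1.
  have NB2 := pcs_size fi H2.
  have [_ HR2 _ _ _] := HS2.
  have fI1 : fl T (g1 vI1) < n by exact: fl_lt.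
  have [hro2 hch2] := char_of HR2 fI1.
  have G2 x : x \notin iota 4 8 -> g2 x = g1 x.
    move=> Hx; have ne c' := notin_neq (c := c') Hx.
    by rewrite F2 // !rupd_neq ?ne.
  rewrite /= in EI2n ER2.
  wasg (g2 vK) => //; wasg (g2 vI) => //.
  wasg (nth 0 (BWT T) (fl T (g1 vI1))); rewrite ?ER2 //; first wsafe.
  wasg (g1 vK2); rewrite ?(G2 vK2) //.
  wasg (g1 vI2); rewrite ?(G2 vI2) //.
  have PK2 : m2 (g1 vK2 * 17 + 0) = m1 (g1 vK2 * 17 + 0) by apply: P2.
  apply: wp_seq; apply: (@fl_spec _ _ b N0 n Bk (fl T) (ro T) fi fl_n sp_ge W_ge isT _ N2) => //=.
    by lia.
    by rewrite PK2 HI2'.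
  move=> c3 g3 m3 N3 F3 ENP3 H3 leN3 K3 P3 HK3n HI3n EI3n ER3 Hc3.
  have HS3 := scanned_keep H3 K3 leN3 P3 HS2.
  have NB3 := pcs_size fi H3.
  have [_ HR3 _ _ _] := HS3.
  have fI2 : fl T (g1 vI2) < n by exact: fl_lt.
  have [hro3 hch3] := char_of HR3 fI2.
  rewrite /= in EI3n ER3.
  have E16 : g3 vK1 = g2 vK by rewrite F3.
  have E17 : g3 vI1 = g2 vI by rewrite F3 //=.
  have E20 : g3 vR1 = nth 0 (BWT T) (fl T (g1 vI1)) by rewrite F3 //=.
  have E15 : g3 vL = g1 vL by rewrite F3 //= G2.
  have E21 : g3 vGO = g1 vGO by rewrite F3 //= G2.
  have Fr3 y : y \notin R -> g3 y = g y.
    apply: (Ffl _ _ F3); do 5 apply: (FR _) => //.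
    by apply: (Ffl _ _ F2); do 2 apply: (FR _) => //.
  wasg (g3 vK) => //; wasg (g3 vI) => //.
  have g1d := nstarts_grow (m1 (g1 vK2 * 17 + 0)) (g1 vI2) leN2 P2.
  rewrite PK2 in Hc3.
  have nst2 := nstarts0 H2 HK2n (proj2 (andP HI2n)).
  have nst3 := nstarts0 H3 HK3n (proj2 (andP HI3n)).
  have g3c := nstarts_grow (m2 (g2 vK * 17 + 0)) (g2 vI) leN3 P3.
  rewrite nst2 in g3c.
  have PK3 : m3 (g2 vK * 17 + 0) = m2 (g2 vK * 17 + 0) by apply: P3.
  have C1 : nth 0 (BWT T) (fl T (g1 vI1)) = nth 0 T (j + g1 vL).
    by rewrite EI1' fl_ISA // BWT_ISA.
  have C2 : nth 0 (BWT T) (fl T (g1 vI2)) = nth 0 T (p + g1 vL).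
    by rewrite EI2' fl_ISA // BWT_ISA.
  have K13 : keep m m3 by apply: keep_trans K1 (keep_trans K2 K3).
  apply: wp_if => /=; rewrite ?ER3 ?hch3 ?E20 ?C1 ?C2 ?Htest.
  + wsafe.
  + move=> ht; have {ht}lt : g1 vL < lc by case: ltnP ht.
    have [Hlc1' Hlc2' _] := lcp_testE termT Hp Hj pj lt.
    apply: (@wp_asg _ _ _ _ _ _ _ _ (g1 vL + 1)); rewrite /= ?E15 //; first wsafe.
    exists (1 + (lc - (g1 vL + 1))); first by rewrite EG; lia.
    exists N3; split; first by rewrite /= E21 EG.
    split=> //=.
    * by split=> //; do 3 apply: (FR _) => //.
    * by lia.
    * by rewrite E21.
    * rewrite E21 EG; split=> // _; rewrite E16 E17 PK3; split=> //.
      - by lia.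
      - by case/andP: HI2n.
      - rewrite EI2n EI1' fl_ISA // modn_small; last by lia.
        by rewrite addn1 addnS.
      split=> //; first by case/andP: HI3n.
      rewrite EI3n EI2' fl_ISA // modn_small; last by lia.
      by rewrite addn1 addnS.
    * rewrite E21 EG mul1n /psi /= E16 E17 PK3 nst3.
      move: Hc HL0 leN2 leN3 NB2 NB3 Hc2 Hc3 g1d g3c; rewrite /psi /gauge; clear.
      move: (nstarts m3 _ _ _) (nstarts m2 _ _ _) (nstarts m1 _ _ _) (nstarts m1 _ _ _).
      move: (pot m1 N1) (pot m2 N2) (pot m3 N3) => *; lia.
  + move=> ht; have Elc : g1 vL = lc by move: ht; case: (ltnP (g1 vL) lc) => //; lia.
    apply: (@wp_asg _ _ _ _ _ _ _ _ 0) => //=; first wsafe.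
    exists (0 + (lc - g1 vL)); first by rewrite EG; lia.
    exists N3; split; first by rewrite /= E15.
    split=> //=.
    * by split=> //; do 3 apply: (FR _) => //.
    * by rewrite E15 HL0.
    * by rewrite E15.
    * rewrite E15 mul0n.
      move: Hc HL0 leN2 leN3 NB2 NB3 Hc2 Hc3 g1d g3c; rewrite /psi /gauge; clear.
      move: (nstarts m3 _ _ _) (nstarts m2 _ _ _) (nstarts m1 _ _ _) (nstarts m1 _ _ _).
      move: (pot m1 N1) (pot m2 N2) (pot m3 N3) => *; lia.
- move=> EG; rewrite EG in Hc; have El := HG0 EG; rewrite El in Hc.
  apply: (HQ _ _ _ N1) => //; rewrite /psi in Hc; lia.
Qed.

Lemma keep_low m m' a : keep m m' -> a < b * 17 -> m' a = m a.
Proof. by move=> K Ha; rewrite K // Ha. Qed.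

Lemma next_spec s N x j p (Q : state -> Prop) :
  let m := mm s in let g := rg s in
  let lc := lcp (drop p T) (drop j T) in
  scanned m N -> g vNP = b + N -> g vB = b -> g vBk = Bk ->
  j < n -> p < n -> p != j -> g vL <= lc -> g vJ = j -> g vDD = p ->
  g vOut = x -> x < r ->
  (forall c g' m' N', scanned m' N' -> g' vNP = b + N' ->
     (forall y, y < 4 -> g' y = g y) -> g' vEN = j + lc -> g' vOut = x.+1 ->
     m' x = lc -> (forall a, a < x -> m' a = m a) ->
     c + 1000 * gauge m' N' <= clk s + 1000 * gauge m N + 2300 * (lc - g vL) +
        20 * (1000 * (Bk + 1)) ->
     Q (State c g' m')) ->
  wp W sp plcp_next Q s.
Proof.
case: s => c0 g m /= HS ENP EB EBk Hj Hp pj HL EJ EDD EX Hx HQ; rewrite /plcp_next.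
have [fi fl_n sp_ge] := fl_hyps termT W_ge N0_le.
have [Hlc1 Hlc2 _] := lcp_testE termT Hp Hj pj HL.
rewrite -/n in Hlc1 Hlc2.
wasg (j + g vL); rewrite ?EJ //; first wsafe.
apply: wp_seq; apply: (@access_spec _ N (j + g vL)) => //=.
move=> c1 g1 m1 N1 HS1 ENP1 SS1 K1 F1 HK1 HI1 EI1 Hns1 Hc1.
have G1 y : y \notin [:: vT, vU & iota 4 8] -> g1 y = g y.
  move=> Hy; have ne c' := notin_neq (c := c') Hy.
  by rewrite F1 // rupd_neq ?ne.
wasg (g1 vK) => //; wasg (g1 vI) => //.
wasg (p + g vL); rewrite ?(G1 vDD) ?(G1 vL) ?EDD //; first wsafe.
apply: wp_seq; apply: (@access_spec _ N1 (p + g vL)) => //=; rewrite ?(G1 vB) ?(G1 vBk) //.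
move=> c2 g2 m2 N2 HS2 ENP2 SS2 K2 F2 HK2 HI2 EI2 Hns2 Hc2.
have G2 y : y \notin [:: vT, vU, vK1, vI1 & iota 4 8] -> g2 y = g y.
  move=> Hy; have ne c' := notin_neq (c := c') Hy.
  rewrite F2; last by apply: contra Hy; rewrite !inE => /or3P[] ->; rewrite ?orbT.
  rewrite !rupd_neq ?ne // G1 //.
  by apply: contra Hy; rewrite !inE => /or3P[] ->; rewrite ?orbT.
have E16 : g2 vK1 = g1 vK by rewrite F2.
have E17 : g2 vI1 = g1 vI by rewrite F2.
have E15 : g2 vL = g vL by rewrite G2.
have [le12 P12] := SS2.
have PK : m2 (g1 vK * 17 + 0) = m1 (g1 vK * 17 + 0) by apply: P12.
have Hg := nstarts_grow (m1 (g1 vK * 17 + 0)) (g1 vI) le12 P12.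
wasg (g2 vK) => //; wasg (g2 vI) => //.
apply: wp_seq; apply: (@extend_spec _ N2 j p) => //=; rewrite ?E15 ?E16 ?E17 ?PK //.
  by lia.
move=> c3 g3 m3 N3 HS3 ENP3 K3 EL3 F3 Hc3.
have G3 y : y \notin [:: vT, vU, vK1, vI1, vK2, vI2, vR1, vGO, vL & iota 4 8] -> g3 y = g y.
  move=> Hy; have ne c' := notin_neq (c := c') Hy.
  rewrite F3; last first.
    apply: contra Hy; rewrite !inE; do 7 (case/orP => [->|]; rewrite ?orbT //).
    by move=> ->; rewrite !orbT.
  rewrite !rupd_neq ?ne // G2 //.
  apply: contra Hy; rewrite !inE; do 4 (case/orP => [->|]; rewrite ?orbT //).
  by move=> ->; rewrite !orbT.
have Hxb : x < b * 17 by rewrite /b; lia.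
set lc := lcp _ _ in HQ EL3 Hc3 HL.
have lcn : j + lc < n by have [] := lcp_testE termT Hp Hj pj (leqnn lc).
wsto x lc; rewrite ?(G3 vOut) ?EX ?EL3 //; first by rewrite /sp; lia.
wasg (j + lc); rewrite ?(G3 vJ) ?EJ ?EL3 //; first wsafe.
apply: (@wp_asg _ _ _ _ _ _ _ _ (x + 1)); rewrite /= ?(G3 vOut) ?EX //; first wsafe.
have Hcost : c3 + 3 + 4 + 4 + 1000 * gauge (update m3 x lc) N3 <=
    c0 + 1000 * gauge m N + 2300 * (lc - g vL) + 20 * (1000 * (Bk + 1)).
  have [le1 _] := SS1.
  have -> : gauge (update m3 x lc) N3 = gauge m3 N3.
    rewrite /gauge; congr (_ + _); have [H3 _ _ _ _] := HS3.
    apply: same_pot H3 => k f Hk _; rewrite /update; case: eqP => // E; lia.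
  have [H1 _ _ _ _] := HS1; have [H2 _ _ _ _] := HS2.
  have NB1 := pcs_size fi H1; have NB2 := pcs_size fi H2.
  move: Hc1 Hc2 Hc3 Hns1 Hns2 Hg; rewrite /gauge; clear -le1 le12 NB1 NB2.
  move: (pot m N) (pot m1 N1) (pot m2 N2) (pot m3 N3) => p0 p1 p2 p3.
  move: (nstarts m1 _ _ _) (nstarts m2 _ _ _) (nstarts m2 _ _ _) => q1 q2 q3.
  move: (lc - _) => dl; lia.
apply: (HQ _ _ _ N3 _ _ _ _ _ _ _ Hcost) => /=; rewrite ?addn1 //.
- apply: scanned_high HS3 => a Ha; rewrite /update; case: eqP => // E; lia.
- move=> y Hy; rewrite !rupd_neq; try by apply/eqP; lia.
  by apply: G3; rewrite !inE; do ![case: eqP => [?|_] /=; first lia].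
- by rewrite /update eqxx.
- move=> a Ha; rewrite /update; case: eqP => [E|_]; first by lia.
  by rewrite (keep_low K3) ?(keep_low K2) ?(keep_low K1) //; lia.
Qed.

Lemma irr_mono x y : x < y < r -> nth 0 (irr T) x < nth 0 (irr T) y.
Proof.
move=> /andP[xy yr].
have srt : sorted ltn (irr T) by apply: sorted_filter (iota_ltn_sorted 0 n); apply: ltn_trans.
apply: (sorted_ltn_nth ltn_trans 0 srt) => //; rewrite inE size_irr //.
exact: ltn_trans yr.
Qed.

Lemma irr_nth x : x < r -> nth 0 (irr T) x < n /\ run_start T (ISA T (nth 0 (irr T) x)).
Proof.
move=> Hx; have : nth 0 (irr T) x \in irr T by rewrite mem_nth ?size_irr.
by rewrite mem_filter mem_iota => /andP[].
Qed.

Lemma irr_inner x : x.+1 < r -> nth 0 (irr T) x < n.-1.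
Proof.
move=> Hx; have [h _] := irr_nth Hx; have := @irr_mono x x.+1; rewrite ltnSn Hx => /(_ isT).
lia.
Qed.

Lemma irr_last : nth 0 (irr T) r.-1 = n.-1.
Proof.
have : n.-1 \in irr T by rewrite mem_filter (ISA_last termT) mem_iota /=; lia.
move=> /(nthP 0) [i]; rewrite size_irr -/r => Hi E.
have [<- //|ne] := eqVneq i r.-1.
by have := @irr_inner i ltac:(lia); rewrite E ltnn.
Qed.

Lemma kasai_spec s N (Q : state -> Prop) :
  let m := mm s in let g := rg s in
  scanned m N -> g vNP = b + N -> g vRn = r -> g vB = b -> g vBk = Bk ->
  (forall c g' m', (forall i, i < r -> m' i = PLCP T (nth 0 (irr T) i)) ->
     c <= clk s + 1000 * gauge m N + 2300 * n + 21 * (1000 * (r * (Bk + 1))) + 50 ->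
     Q (State c g' m')) ->
  wp W sp kasai Q s.
Proof.
case: s => c0 g m /= HS ENP ER EB EBk HQ; rewrite /kasai.
have [fi fl_n sp_ge] := fl_hyps termT W_ge N0_le.
wasg 0 => //; first wsafe.
wasg 0 => //; first wsafe.
apply: wp_seq.
pose J x := nth 0 (irr T) x.
pose en x := if x is x'.+1 then J x' + PLCP T (J x') else 0.
pose I i (s : state) := exists N1 x, i = r - x /\
  [/\ [/\ x.+1 <= r, rg s vOut = x, rg s vEN = en x, rg s vNP = b + N1 &
          forall y, y < 4 -> rg s y = g y],
      scanned (mm s) N1, forall i, i < x -> mm s i = PLCP T (J i) &
      en x <= n /\ clk s + 1000 * gauge (mm s) N1 <= c0 + 1000 * gauge m N +
         2300 * en x + 21 * (1000 * (x * (Bk + 1))) + 20].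
apply: (@wp_while _ _ _ _ _ _ I r).
  exists N, 0; split; first by rewrite subn0.
  split=> //=; last by lia.
  by split=> // y Hy; rewrite !rupd_neq //; apply/eqP; lia.
move=> i c g1 m1 [N1 [x [-> /= [[xr EX EEN ENP1 F1] HS1 Hout [enn Hc]]]]].
have ER1 : g1 vRn = r by rewrite F1.
have EB1 : g1 vB = b by rewrite F1.
have EBk1 : g1 vBk = Bk by rewrite F1.
split.
- wsafe.
- rewrite EX ER1 => Hlt; have {}Hlt : x.+1 < r by lia.
  have Hj1 := irr_inner Hlt; rewrite -/(J x) in Hj1.
  have Hj : J x < n by lia.
  have [_ Hrs] := irr_nth xr; rewrite -/(J x) in Hrs.
  have [_ [HRS HCH] HTI HTP _] := HS1.
  have [|EIJ EIR] := HTI x; first by rewrite size_irr.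
  rewrite -[irr_pre T _]/(irr T) -/(J x) -/r -/b in EIJ EIR.
  have [k Hk [Ero Hin]] := ro_run termT Hj.
  rewrite -/r -/b in Ero Hk.
  have EISA : ISA T (J x) = rsn T k by move: Hrs; rewrite (run_startE Hk Hin) => /eqP.
  have I0 := ISA_gt0 termT Hj1.
  have k0 : 0 < k by case: k EISA {Hk Ero Hin} => // E; rewrite E (rsn0 termT) in I0.
  have Ephi : nth 0 (SA T) (rsn T k).-1 = phi T (J x) by rewrite /phi EISA.
  have Hp := phi_lt Hj; rewrite -/n in Hp.
  have EPH : m1 ((b + k) * 17 + fPHI) = phi T (J x).
    by rewrite -Ephi; apply: HTP; rewrite ?k0 // Ephi.
  have pj := phi_neq termT Hj1.
  have EPL := PLCPE termT Hj1.
  have Len : en x <= J x + PLCP T (J x).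
    rewrite /en; case: x {EEN enn Hout Hc EPH Ephi I0 EISA Hin Ero EIR EIJ EX} xr Hlt Hj1 Hj Hrs Hp pj EPL => [|x'] // xr Hlt Hj1 Hj _ _ _ _.
    have lt : J x' < J x'.+1 by apply: irr_mono; rewrite ltnSn.
    have := PLCP_shift termT (j := J x') (k := J x'.+1 - J x').
    by rewrite subnKC ?(ltnW lt) // => /(_ Hj); lia.
  have lcn : J x + PLCP T (J x) < n.
    by rewrite EPL; have [] := lcp_testE termT Hp Hj pj (leqnn _).
  wasg (b + x); rewrite ?EB1 ?EX //; first wsafe.
  wasg (J x); rewrite ?EIJ //; first wsafe.
  wasg (b + k); rewrite ?EIR ?Ero //; first wsafe.
  wasg (phi T (J x)); rewrite ?EPH //; first wsafe.
  have fin c2 g2 : g2 vL = en x - J x -> g2 vJ = J x -> g2 vDD = phi T (J x) ->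
      g2 vOut = x -> g2 vNP = b + N1 -> (forall y, y < 4 -> g2 y = g y) ->
      c2 <= c + 100 ->
      wp W sp plcp_next (fun s2 => exists2 n', n' < r - x &
        I n' (State (clk s2 + 1) (rg s2) (mm s2))) (State c2 g2 m1).
    move=> GL GJ GD GX GN GF Hc2.
    apply: (@next_spec _ N1 x (J x) (phi T (J x))) => //=; rewrite ?(GF vB) ?(GF vBk) //.
      by rewrite GL -EPL; lia.
    move=> c3 g3 m3 N3 HS3 ENP3 F3 EEN3 EX3 Em3 Eout3 Hc3.
    rewrite -EPL in EEN3 Em3 Hc3.
    exists (r - x.+1); first by lia.
    exists N3, x.+1; split=> //; split=> //=.
    + by split=> // y Hy; rewrite F3 // GF.
    + move=> i'; rewrite ltnS leq_eqVlt => /orP[/eqP -> //|Hi'].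
      by rewrite Eout3 // Hout.
    + split; first by lia.
      rewrite GL in Hc3; move: Hc Hc2 Hc3 Len; rewrite (mulSn x).
      move: (x * (Bk + 1)) => q; clear; lia.
  have F4 y v1 v2 v3 v4 v5 : y < 4 ->
      rupd (rupd (rupd (rupd (rupd g1 vT v1) vJ v2) vT v3) vDD v4) vL v5 y = g y.
    by move=> Hy; rewrite !rupd_neq ?F1 //; apply/eqP; lia.
  apply: wp_seq; apply: wp_if => /=; rewrite ?EEN.
  + by [].
  + move=> h; have {}h : J x < en x by case: ltnP h.
    apply: (@wp_asg _ _ _ _ _ _ _ _ (en x - J x)); rewrite /= ?EEN //; first wsafe.
    apply: fin => //=; last by lia.
    by move=> y Hy; apply: F4.
  + move=> h; have {}h : en x <= J x by case: ltnP h.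
    apply: (@wp_asg _ _ _ _ _ _ _ _ 0); rewrite //=; first wsafe.
    apply: fin => //=; [by lia|by move=> y Hy; apply: F4|by lia].
- rewrite EX ER1 => Hge; have Ex : x = r.-1 by lia.
  apply: (@wp_sto _ _ _ _ _ _ _ _ x 0); rewrite /= ?EX //; [by lia|by rewrite /sp; lia|].
  apply: HQ => //=.
  + move=> i' Hi'; rewrite /update; case: eqP => [->|ne]; last by apply: Hout; lia.
    by rewrite Ex irr_last (PLCP_last termT).
  + have : x * (Bk + 1) <= r * (Bk + 1) by rewrite leq_mul2r; lia.
    move: (x * _) (r * _) Hc enn => q1 q2; clear; lia.
Qed.

End Kasai.

(** * The program *)

Definition plcp_program : cmd :=
  read_runs ;; radix_sort ;; make_pieces ;; set_dest ;; scan_text ;; kasai.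

(* [R^(i-1) < 2^w] bounds the number [i] of passes by [w / log R + 1], and
   [R / log R] is at most of the order of [n / log n]. *)
Lemma radix_passes_leq n r w c1 i : 0 < r <= n ->
  w <= c1 * bit_length n -> (i == 0) || (r.+1 ^ i.-1 < 2 ^ w) ->
  r.+1 * i <= (2 + 4 * c1) * n.
Proof.
move=> /andP[r0 rn] Hw Hi; case: i Hi => [|i] /=; first by rewrite muln0.
move=> Hi.
pose k := trunc_log 2 r.+1; pose L := trunc_log 2 n.
have k0 : 0 < k by rewrite /k -[0](trunc_log1 2) ; apply: trunc_log_max.
have kb : 2 ^ k <= r.+1 < 2 ^ k.+1 by apply: trunc_log_bounds.
have Lb : 2 ^ L <= n < 2 ^ L.+1 by apply: trunc_log_bounds => //; lia.
have kL : k <= L.+1.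
  rewrite -ltnS -(ltn_exp2l _ _ (isT : 1 < 2)); case/andP: kb => kb _.
  apply: leq_ltn_trans kb _; rewrite expnS; lia.
have ki : k * i <= c1 * L.+1.
  apply: leq_trans (_ : w <= _); last exact: Hw.
  apply: ltnW; rewrite -(ltn_exp2l _ _ (isT : 1 < 2)) expnM.
  apply: leq_ltn_trans Hi; case/andP: kb => kb _.
  by case: (i) => // i'; rewrite leq_exp2r.
have kL2 : L.+1 * 2 ^ k <= k * 2 ^ L.+1.
  rewrite -(subnK kL) expnD mulnA leq_mul2r; apply/orP; right.
  apply: leq_trans (_ : k * (L.+1 - k).+1 <= _); last first.
    by rewrite leq_mul2l ltn_expl ?orbT.
  by rewrite subnK //; nia.
have H : 2 ^ k * i <= c1 * 2 ^ L.+1.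
  rewrite -(leq_pmul2l k0) mulnCA; apply: leq_trans (leq_mul (leqnn (2 ^ k)) ki) _.
  rewrite mulnCA [leqRHS]mulnCA leq_mul2l; apply/orP; right.
  by rewrite mulnC.
have H2 : r.+1 * i <= 2 * (2 ^ k * i).
  by rewrite mulnA -expnS leq_mul2r; apply/orP; right; case/andP: kb => _ /ltnW.
rewrite mulnS; apply: leq_trans (leq_add (leqnn _) H2) _.
rewrite mulnDl; apply: leq_add; first by lia.
apply: leq_trans (_ : 2 * (c1 * 2 ^ L.+1) <= _); first by rewrite leq_mul2l H orbT.
rewrite expnS; move: Lb => /andP[Lb _]; nia.
Qed.

Section Main.

Variables (T : seq nat) (w c1 : nat).
Hypothesis termT : terminated T.

Let n := size T.
Let r := nruns T.
Let b := r.+1.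
Let W := 2 ^ w.

Hypothesis W_ge : 136 * r + 2 * n + 100 <= W.
Hypothesis w_le : w <= c1 * bit_length n.
Hypothesis T_small : all (fun c => c < W) T.

Lemma lst_loaded mx m : loaded T W mx m -> lst m b (iota b r).
Proof.
move=> H; have r0 : 0 < r by exact: nruns_gt0.
suff HL k : k <= r -> lst m (if r - k < r then b + (r - k) else 0) (iota (b + (r - k)) k).
  by have := HL r (leqnn r); rewrite subnn r0 addn0.
elim: k => [|k IH] Hk; first by rewrite subn0 ltnn.
have -> : r - k.+1 < r by lia.
split=> //; rewrite (loaded_ln H); last by rewrite -/r; lia.
have E : (r - k.+1).+1 = r - k by lia.
rewrite -addnS E; apply: IH; lia.
Qed.

Lemma input_lt a : nth 0 (encode_RLBWT (RLBWT T)) a < W.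
Proof.
rewrite -/(input T a).
have rn : r <= n by exact: nruns_le.
case: (ltnP (2 * r) a) => [h|h]; first by rewrite input_end //; lia.
case: a h => [|a] h; first by rewrite input0 -/r; lia.
have [k Ek] : exists k, a = k.*2 \/ a = k.*2.+1.
  by exists a./2; have := odd_double_half a; case: (odd a); lia.
have Hk : k < r by lia.
case: Ek => ->.
  have -> : k.*2.+1 = 1 + 2 * k by lia.
  by rewrite input_char // rchar_lt.
have -> : k.*2.+2 = 2 + 2 * k by lia.
rewrite input_len //; apply: (@leq_ltn_trans n); last by lia.
rewrite /run_len; apply: leq_trans (leq_subr _ _) _.
by have := rsn_le T Hk; rewrite (rsn_end (leqnn _)).
Qed.

Lemma program_spec :
  wp W (136 * r) plcp_program
    (fun s => clk s <= (80 * 1000 + 1600 * c1) * n /\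
              mkseq (mm s) (size (PLCPplus T)) = PLCPplus T)
    (State 0 (fun=> 0) (input T)).
Proof.
have r0 : 0 < r by exact: nruns_gt0.
have rn : r <= n by exact: nruns_le.
apply: wp_seq; apply: read_spec => //.
move=> c g m mx Hld E0 E1 E2 E3 E23 E24 Hc.
have [HC HKY HRS HLN HBK [Hmx mxW]] := Hld.
pose ck y := rchar T (y - b).
have W1 : 136 * r + 100 <= W by lia.
have ckE k : ck (b + k) = rchar T k by rewrite /ck addKn.
have ids y : y \in iota b r -> exists2 k, k < r & y = b + k.
  by rewrite mem_iota => Hy; exists (y - b); lia.
apply: wp_seq; apply: (@radix_spec _ r W1 r0 _ ck mx) => //=.
- by rewrite E23; apply: lst_loaded Hld.
- by move=> y /ids [k Hk ->]; rewrite HKY // ckE.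
- by move=> y; apply: rchar_lt.
- by move=> y /ids [k Hk ->]; rewrite ckE; apply: Hmx.
move=> c1' g1 m1 Lp i pL sL HL1 K1 F1 Hi Hc1.
pose L := [seq y - b | y <- Lp].
have Lall y : y \in Lp -> b <= y by rewrite (perm_mem pL) mem_iota => /andP[].
have LpE : Lp = [seq b + k | k <- L].
  rewrite -map_comp -[LHS]map_id; apply/eq_in_map => y /Lall Hy /=; lia.
have pL' : perm_eq L (iota 0 r).
  have -> : iota 0 r = [seq y - b | y <- iota b r].
    have -> : iota b r = [seq b + k | k <- iota 0 r] by rewrite -iotaDl addn0.
    rewrite -map_comp -[LHS]map_id.
    by apply: eq_map => y /=; rewrite addKn.
  exact: perm_map.
have sL' : pairwise (run_lt T) L.
  move: sL; rewrite LpE pairwise_map; apply: sub_pairwise => x y /=.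
  by rewrite /key_lt !ckE ltn_add2l.
have i_le : b * i <= (2 + 4 * c1) * n.
  apply: (radix_passes_leq (w := w)) => //; first by rewrite r0.
  by case/orP: Hi => [->//|h]; rewrite (leq_ltn_trans h mxW) orbT.
apply: wp_seq; apply: (@make_spec T W termT W_ge _ L) => //=.
- by rewrite F1.
- by rewrite F1 // E3.
- by rewrite -LpE.
- by move=> k Hk; rewrite K1 // HRS.
move=> c2 g2 m2 N Hmade K2 HN F2 ENP2 Hc2.
rewrite -/r -/b in HN ENP2 Hc2.
apply: wp_seq; apply: (@dest_spec T W termT W_ge _ N) => //=.
- by rewrite F2 // F1.
- by rewrite F2 // F1 // E3.
move=> c3 g3 m3 H3 Hlag K3 F3 Hc3.
rewrite -/r -/b -/n in H3 Hlag Hc3.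
have n0 : 0 < n by exact: term_size.
have [hb1 hb2] := made_block Hmade (e := 0) n0.
rewrite addn0 in hb1 hb2.
apply: wp_seq; apply: (@scan_spec T W N termT W_ge HN _ N) => //=.
- split=> k Hk; rewrite K3 // K2 // K1 //; [exact: HRS|exact: HC].
- by rewrite K3.
- by rewrite !K3.
- by rewrite F3 // F2 // F1.
- by rewrite F3 // F2 // F1.
- by rewrite F3 // F2 // F1 // E3.
- by rewrite F3.
move=> c4 g4 m4 N4 HS4 ENP4 F4 Hc4.
apply: (@kasai_spec T W N termT W_ge HN _ N4) => //=.
- by rewrite F4 // F3 // F2 // F1.
- by rewrite F4 // F3 // F2 // F1.
- by rewrite F4 // F3 // F2 // F1 // E3.
move=> c5 g5 m5 Hout Hc5; split.
  rewrite -/n -/r -/b in Hc4 Hc5.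
  have h1 : r * (blk T + 1) <= 3 * n.
    by rewrite mulnDr muln1; have := blk_mul_le termT; rewrite -/r -/n; lia.
  move: Hc1 i_le; move: (b * i) => bi.
  rewrite mulnDl => Hc1 i_le; rewrite mulnDl.
  have h2 : 4 * c1 * n = 4 * (c1 * n) by rewrite mulnA.
  have h3 : 1600 * c1 * n = 1600 * (c1 * n) by rewrite mulnA.
  rewrite h3; rewrite h2 in i_le; move: (c1 * n) i_le => cn i_le.
  move: Hc5 Hc4 h1; rewrite /gauge; move: (r * (blk T + 1)) => rb.
  rewrite /pot; move: (lag _ m3 _) Hlag (lag _ m4 _) => l3 Hlag l4 Hc5 Hc4 h1.
  rewrite /b in Hc Hc2 Hc3; lia.
rewrite PLCPplusE size_map size_irr; apply: (@eq_from_nth _ 0).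
  by rewrite size_mkseq size_map size_irr.
move=> k; rewrite size_mkseq => Hk; rewrite nth_mkseq // Hout //.
by rewrite (nth_map 0) ?size_irr.
Qed.

End Main.

Theorem theorem30 :
  exists (P : program) (c0 : nat), forall c1 : nat, exists a b : nat,
  forall (w : nat) (T : seq nat),
    terminated T ->
    c0 * bit_length (size T) <= w <= c1 * bit_length (size T) ->
    all (fun c => c < 2 ^ w) T ->
    computes_within w P (encode_RLBWT (RLBWT T)) (PLCPplus T)
      (a * size T) (b * nruns T).
Proof.
exists (compile plcp_program 0), 9 => c1; exists (80 * 1000 + 1600 * c1), 136.
move=> w T termT /andP[w_ge w_le] T_small.
have n0 : 0 < size T by exact: term_size.
have rn := nruns_le T.
have W_ge : 136 * nruns T + 2 * size T + 100 <= 2 ^ w.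
  have h1 : 2 ^ (9 * bit_length (size T)) <= 2 ^ w by rewrite leq_exp2l.
  apply: leq_trans h1.
  have h2 : size T < 2 ^ bit_length (size T).
    by have /andP[] := trunc_log_bounds (isT : 1 < 2) n0.
  have h3 : 8 + bit_length (size T) <= 9 * bit_length (size T).
    by rewrite /bit_length; lia.
  apply: leq_trans (_ : 2 ^ (8 + bit_length (size T)) <= _); last by rewrite leq_exp2l.
  rewrite expnD; move: h2; move: (2 ^ bit_length _) => u; lia.
have w0 : 0 < w by move: w_ge; rewrite /bit_length; lia.
apply: compile_computes => //.
- by move=> a; apply: (input_lt termT W_ge w_le T_small).
- exact: (program_spec termT W_ge w_le T_small).
Qed.
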